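(* Let $M$ be a smooth $7$-manifold with a $G_2$-structure $\varphi$ with torsion $T$, and let the octonion product on $\mathbb{O}M$ be defined by $\varphi$. Suppose $P\in\Omega^p(\mathbb{O}M)$. Then $$d_D^2P=\mathrm{Riem}\wedge(\mathrm{Im}P)-P\overset{\circ}{\wedge}d_DT=\mathrm{Riem}\wedge(\mathrm{Im}P)-\tfrac14P\overset{\circ}{\wedge}(\pi_7\mathrm{Riem}).$$
   Context: Setting. A $G_2$-structure on a smooth $7$-manifold $M$ is identified with a positive $3$-form $\varphi$, i.e. one that at each point lies in the $GL(7,\mathbb{R})$-orbit of $\varphi_0=e^{123}+e^{145}+e^{167}+e^{246}-e^{257}-e^{347}-e^{356}$. It determines a unique Riemannian metric $g$ and volume form $\mathrm{vol}$ (hence an orientation) by $g(u,v)\,\mathrm{vol}=\frac16(u\lrcorner\varphi)\wedge(v\lrcorner\varphi)\wedge\varphi$, where $\lrcorner$ is contraction. Let $*$ be the Hodge star, $\psi=*\varphi$, and $\nabla$ the Levi-Civita connection of $g$. Octonion bundle. $\mathbb{O}M=\Lambda^0\oplus TM$, where $\Lambda^0$ is the trivial real line bundle; an octonion section is $A=(a,\alpha)$ with $a=\mathrm{Re}A$ a function and $\alpha=\mathrm{Im}A$ a vector field. Inner product: $\langle (a,\alpha),(b,\beta)\rangle=ab+g(\alpha,\beta)$. Cross product: $\langle\alpha\times\beta,\gamma\rangle=\varphi(\alpha,\beta,\gamma)$. Octonion product: $A\circ B=AB=(ab-\langle\alpha,\beta\rangle,\ a\beta+b\alpha+\alpha\times\beta)$.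 $\Omega^p(\mathbb{O}M)$ denotes $\mathbb{O}M$-valued $p$-forms; $\overset{\circ}{\wedge}$ denotes the wedge product of $\mathbb{O}M$-valued forms in which coefficients are multiplied by the octonion product in the written order. Torsion and $d_D$. The torsion tensor $T_{ab}$ of $\varphi$ is the $2$-tensor with $\nabla_a\varphi_{bcd}=2T_a{}^{e}\psi_{ebcd}$; it is viewed as the $\mathrm{Im}\,\mathbb{O}M$-valued $1$-form with $T_i=(0,T_i{}^\alpha)$. $\nabla$ acts on $\mathbb{O}M$ by $\nabla_X(a,\alpha)=(\nabla_Xa,\nabla_X\alpha)$, and $d_\nabla$ is the corresponding exterior covariant derivative. For $Q\in\Omega^p(\mathbb{O}M)$, $d_DQ=d_\nabla Q-(-1)^pQ\overset{\circ}{\wedge}T$, i.e. $(d_DQ)_{b_1\dots b_{p+1}}=(p+1)\left(\nabla_{[b_1}Q_{b_2\dots b_{p+1}]}-(-1)^pQ_{[b_1\dots b_p}\circ T_{b_{p+1}]}\right)$. Curvature. $(\nabla_i\nabla_j-\nabla_j\nabla_i)v^k=\mathrm{Riem}^k{}_{lij}v^l$, with $\mathrm{Ric}_{jl}=g^{ik}\mathrm{Riem}_{ijkl}$. $\mathrm{Riem}$ is regarded as a section of $\Omega^2(M)\otimes\mathrm{End}(\mathrm{Im}\,\mathbb{O}M)$, and $\mathrm{Riem}\wedge(\mathrm{Im}P)$ is the imaginary octonion-valued $(p+2)$-form obtained by wedging forms while $\mathrm{Riem}$ acts as an endomorphism on $\mathrm{Im}P$: its components are $\frac12(p+2)(p+1)\mathrm{Riem}^{\alpha}{}_{\beta[b_0b_1}(\mathrm{Im}P)_{b_2\dots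 b_{p+1}]}{}^{\beta}$. Finally $(\pi_7\mathrm{Riem})_{ij}{}^{\alpha}=\mathrm{Riem}_{ij}{}^{\beta\gamma}\varphi^{\alpha}{}_{\beta\gamma}$, regarded as an element of $\Omega^2(\mathrm{Im}\,\mathbb{O}M)$. *)

(* Defs.v *)
From HB Require Import structures.
From mathcomp Require Import all_boot all_order all_algebra all_fingroup.
From mathcomp Require Import all_classical all_reals all_analysis.

Set Implicit Arguments.
Unset Strict Implicit.
Unset Printing Implicit Defensive.

Import Order.TTheory GRing.Theory Num.Theory numFieldNormedType.Exports.

Local Open Scope classical_set_scope.
Local Open Scope ring_scope.

(* Tensor fields are given by their components in the charts of an atlas.
   Coordinate and frame indices live in ['I_7], so that the index written [k]
   (1 <= k <= 7) on paper is the ordinal of value [k - 1]. *)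

Definition partial (R : realType) (i : 'I_7) (f : 'rV[R]_7 -> R^o) :
    'rV[R]_7 -> R^o :=
  fun x => 'D_(delta_mx ord0 i) f x.

(* C^infinity on the open set [U]: every iterated partial derivative exists and
   is differentiable (hence continuous) at every point of [U]. *)
Definition smooth_on (R : realType) (U : set 'rV[R]_7) (f : 'rV[R]_7 -> R^o) :=
  forall (s : seq 'I_7) x, U x -> differentiable (foldr (@partial R) f s) x.

(* [chart c] and [coord_inv c] are total functions whose values are only
   meaningful on [dom c] and on [chart c @` dom c] respectively. *)
Record manifold7 (R : realType) := Manifold7 {
  carrier :> topologicalType ;
  atlas : Type ;
  dom : atlas -> set carrier ;
  chart : atlas -> carrier -> 'rV[R]_7 ;
  coord_inv : atlas -> 'rV[R]_7 -> carrier ;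
  carrier_hausdorff : hausdorff_space carrier ;
  carrier_second_countable : @second_countable carrier ;
  dom_open : forall c, open (dom c) ;
  dom_cover : forall m, exists c, dom c m ;
  img_open : forall c, open (chart c @` dom c) ;
  chartK : forall c m, dom c m -> coord_inv c (chart c m) = m ;
  chart_continuous : forall c m, dom c m -> {for m, continuous (chart c)} ;
  coord_inv_continuous : forall c x, (chart c @` dom c) x ->
    {for x, continuous (coord_inv c)} ;
  transition_smooth : forall c c' (k : 'I_7),
    smooth_on (chart c @` (dom c `&` dom c'))
      (fun x => chart c' (coord_inv c x) ord0 k)
}.

Definition img (R : realType) (M : manifold7 R) (c : atlas M) : set 'rV[R]_7 :=
  chart c @` dom c.

Definition transition (R : realType) (M : manifold7 R) (c c' : atlas M) :
    'rV[R]_7 -> 'rV[R]_7 :=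
  chart c' \o coord_inv c.

Definition mindex (n : nat) := n.-tuple 'I_7.

Definition perm_idx n (s : 'S_n) (b : mindex n) : mindex n :=
  [tuple tnth b (s k) | k < n].

Definition subst_idx n (b : mindex n) (k : 'I_n) (e : 'I_7) : mindex n :=
  [tuple if l == k then e else tnth b l | l < n].

Definition left_idx p q (b : mindex (p + q)) : mindex p :=
  [tuple tnth b (lshift q k) | k < p].

Definition right_idx p q (b : mindex (p + q)) : mindex q :=
  [tuple tnth b (rshift p k) | k < q].

Definition tail_idx p (b : mindex p.+1) : mindex p := [tuple of behead b].

(* b |-> F_{[b_1 ... b_n]}, with total weight one *)
Definition antisym (R : realType) (V : lmodType R) n (F : mindex n -> V)
    (b : mindex n) : V :=
  (n`!%:R)^-1 *: \sum_(s : 'S_n) (-1) ^+ s *: F (perm_idx s b).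

Definition alternating (R : realType) (V : lmodType R) n (F : mindex n -> V) :=
  forall (s : 'S_n) b, F (perm_idx s b) = (-1) ^+ s *: F b.

(* With [J i a] = d y^a / d x^i, the components in the coordinates x of the
   covariant tensor whose components in the coordinates y are [F]. *)
Definition pullback (R : realType) (V : lmodType R) n (J : 'M[R]_7)
    (F : mindex n -> V) (b : mindex n) : V :=
  \sum_(a : mindex n) (\prod_(k < n) J (tnth b k) (tnth a k)) *: F a.

(* [Q c x b] is the component of index [b] at the point of coordinates [x] in
   the chart [c]; only points [x] of [img c] matter. *)
Definition tensor (R : realType) (M : manifold7 R) (V : Type) (p : nat) :=
  atlas M -> 'rV[R]_7 -> mindex p -> V.

Definition cast_deg (R : realType) (M : manifold7 R) (V : Type) m n
    (e : m = n) (Q : tensor M V m) : tensor M V n :=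
  fun c x b => Q c x (tcast (esym e) b).

(* The library's Jacobian acts on row vectors on the right, so ['J tau x] has
   entries (i, a) |-> d_i tau^a. *)
Definition tensor_field (R : realType) (M : manifold7 R) p
    (w : tensor M R^o p) :=
  (forall c b, smooth_on (img c) (fun x => w c x b)) /\
  (forall c c' m, dom c m -> dom c' m -> forall b,
     w c (chart c m) b =
     pullback ('J (transition c c') (chart c m)) (w c' (chart c' m)) b).

Definition form (R : realType) (M : manifold7 R) p (w : tensor M R^o p) :=
  tensor_field w /\ (forall c x, img c x -> alternating (w c x)).

(* The fibre of OM in a chart: real part, and the contravariant components of
   the imaginary part. *)
Definition octo (R : realType) := (R^o * 'rV[R]_7)%type.

Definition Re_part (R : realType) (M : manifold7 R) p (Q : tensor M (octo R) p) :
    tensor M R^o p :=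
  fun c x b => (Q c x b).1.

Definition Im_part (R : realType) (M : manifold7 R) p (Q : tensor M (octo R) p) :
    tensor M 'rV[R]_7 p :=
  fun c x b => (Q c x b).2.

Definition smooth_tangent (R : realType) (M : manifold7 R) p
    (v : tensor M 'rV[R]_7 p) :=
  forall c b (k : 'I_7), smooth_on (img c) (fun x => v c x b ord0 k).

(* Omega^p(OM).  Row vectors of contravariant components are pushed forward by
   multiplication by the Jacobian on the right. *)
Definition oform (R : realType) (M : manifold7 R) p (Q : tensor M (octo R) p) :=
  [/\ form (Re_part Q),
      smooth_tangent (Im_part Q),
      (forall c c' m, dom c m -> dom c' m -> forall b,
         let J := 'J (transition c c') (chart c m) in
         Im_part Q c (chart c m) b *m J =
         pullback J (Im_part Q c' (chart c' m)) b) &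
      (forall c x, img c x -> alternating (Im_part Q c x))].

(* Wedge product of forms whose coefficients are multiplied, in this order, by
   the pointwise product [mul]. *)
Definition wedge (R : realType) (M : manifold7 R) (U V : Type) (W : lmodType R)
    (mul : atlas M -> 'rV[R]_7 -> U -> V -> W) p q
    (A : tensor M U p) (B : tensor M V q) : tensor M W (p + q) :=
  fun c x b =>
    ((p + q)`!%:R / (p`!%:R * q`!%:R)) *:
    antisym (fun b' => mul c x (A c x (left_idx b')) (B c x (right_idx b'))) b.

Definition rwedge (R : realType) (M : manifold7 R) p q
    (A : tensor M R^o p) (B : tensor M R^o q) : tensor M R^o (p + q) :=
  wedge (fun _ _ (a b : R^o) => a * b) A B.

Definition contract (R : realType) (M : manifold7 R) p (u : 'rV[R]_7)
    (w : tensor M R^o p.+1) : tensor M R^o p :=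
  fun c x b => \sum_(i < 7) u ord0 i * w c x [tuple of i :: b].

Definition gmat (R : realType) (M : manifold7 R) (g : tensor M R^o 2)
    (c : atlas M) (x : 'rV[R]_7) : 'M[R]_7 :=
  \matrix_(i, j) g c x [tuple i; j].

Definition ginv (R : realType) (M : manifold7 R) (g : tensor M R^o 2)
    (c : atlas M) (x : 'rV[R]_7) : 'M[R]_7 :=
  invmx (gmat g c x).

Definition inner (R : realType) (M : manifold7 R) (g : tensor M R^o 2)
    (c : atlas M) (x u v : 'rV[R]_7) : R :=
  \sum_i \sum_j g c x [tuple i; j] * u ord0 i * v ord0 j.

Definition riemannian (R : realType) (M : manifold7 R) (g : tensor M R^o 2) :=
  [/\ tensor_field g,
      (forall c x, img c x -> forall u v, inner g c x u v = inner g c x v u) &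
      (forall c x, img c x -> forall u, u != 0 -> 0 < inner g c x u u)].

(* The volume form of [g] for one of the orientations of M. *)
Definition volume_form (R : realType) (M : manifold7 R) (g : tensor M R^o 2)
    (vol : tensor M R^o 7) :=
  form vol /\
  (forall c x, img c x -> vol c x (ord_tuple 7) ^+ 2 = \det (gmat g c x)).

(* (star w)_b = 1/p! w^a vol_{a b} *)
Definition hodge (R : realType) (M : manifold7 R) (g : tensor M R^o 2) p q
    (vol : tensor M R^o (p + q)) (w : tensor M R^o p) : tensor M R^o q :=
  fun c x b =>
    (p`!%:R)^-1 *
    \sum_(a : mindex p) pullback (ginv g c x) (w c x) a
                        * vol c x [tuple of a ++ b].

(* Christoffel symbols Gamma^k_{ij} *)
Definition christoffel (R : realType) (M : manifold7 R) (g : tensor M R^o 2)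
    (c : atlas M) (x : 'rV[R]_7) (k i j : 'I_7) : R :=
  2^-1 * \sum_(l < 7) ginv g c x k l *
    (partial i (fun y => g c y [tuple j; l]) x
     + partial j (fun y => g c y [tuple i; l]) x
     - partial l (fun y => g c y [tuple i; j]) x).

(* In all covariant derivatives the differentiation index comes first. *)
Definition nabla (R : realType) (M : manifold7 R) (g : tensor M R^o 2) p
    (w : tensor M R^o p) : tensor M R^o p.+1 :=
  fun c x b =>
    partial (thead b) (fun y => w c y (tail_idx b)) x
    - \sum_(k < p) \sum_(e < 7)
        christoffel g c x e (thead b) (tnth (tail_idx b) k)
        * w c x (subst_idx (tail_idx b) k e).

Definition nabla_tangent (R : realType) (M : manifold7 R) (g : tensor M R^o 2) p
    (v : tensor M 'rV[R]_7 p) : tensor M 'rV[R]_7 p.+1 :=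
  fun c x b => \row_k
    (nabla g (fun c' y b' => v c' y b' ord0 k) c x b
     + \sum_(j < 7) christoffel g c x k (thead b) j
                    * v c x (tail_idx b) ord0 j).

Definition nabla_octo (R : realType) (M : manifold7 R) (g : tensor M R^o 2) p
    (Q : tensor M (octo R) p) : tensor M (octo R) p.+1 :=
  fun c x b =>
    (nabla g (Re_part Q) c x b, nabla_tangent g (Im_part Q) c x b).

(* [Riem c x [tuple i; j]] is the endomorphism with entries
   (k, l) |-> Riem^k_{l i j}.  It is characterised by the Ricci identity on
   local vector fields: [v] ranges over families of smooth vector fields, one
   on the domain of each chart, with no compatibility between charts. *)
Definition is_riemann (R : realType) (M : manifold7 R) (g : tensor M R^o 2)
    (Riem : tensor M 'M[R]_7 2) :=
  forall v : tensor M 'rV[R]_7 0, smooth_tangent v ->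
  forall c x, img c x -> forall i j k : 'I_7,
    nabla_tangent g (nabla_tangent g v) c x [tuple i; j] ord0 k
    - nabla_tangent g (nabla_tangent g v) c x [tuple j; i] ord0 k
    = \sum_(l < 7) Riem c x [tuple i; j] k l * v c x [tuple] ord0 l.

(* Riem_{ijkl} = g_{im} Riem^m_{jkl} *)
Definition riem_low (R : realType) (M : manifold7 R) (g : tensor M R^o 2)
    (Riem : tensor M 'M[R]_7 2) (c : atlas M) (x : 'rV[R]_7)
    (i j k l : 'I_7) : R :=
  \sum_(m < 7) g c x [tuple i; m] * Riem c x [tuple k; l] m j.

Definition riem_wedge (R : realType) (M : manifold7 R)
    (Riem : tensor M 'M[R]_7 2) p (v : tensor M 'rV[R]_7 p) :
    tensor M (octo R) p.+2 :=
  fun c x b =>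
    (0, wedge (fun _ _ (E : 'M[R]_7) (u : 'rV[R]_7) => u *m E^T) Riem v c x b).

(* The components of e^{ijk} = e^i /\ e^j /\ e^k, with i, j, k in 1..7 *)
Definition e3 (R : realType) (i j k : nat) (b : mindex 3) : R :=
  \det (\matrix_(r < 3, s < 3) (tnth [tuple i; j; k] r == (tnth b s).+1)%:R).

Definition phi0 (R : realType) (b : mindex 3) : R^o :=
  e3 R 1 2 3 b + e3 R 1 4 5 b + e3 R 1 6 7 b + e3 R 2 4 6 b
  - e3 R 2 5 7 b - e3 R 3 4 7 b - e3 R 3 5 6 b.

Definition G2_structure (R : realType) (M : manifold7 R)
    (phi : tensor M R^o 3) :=
  form phi /\
  (forall c x, img c x -> exists2 A : 'M[R]_7, A \in unitmx &
     forall b, phi c x b = pullback A (@phi0 R) b).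

(* g and vol are the metric and the volume form determined by phi:
   g(u,v) vol = 1/6 (u -| phi) /\ (v -| phi) /\ phi *)
Definition G2_metric (R : realType) (M : manifold7 R) (phi : tensor M R^o 3)
    (g : tensor M R^o 2) (vol : tensor M R^o 7) :=
  [/\ riemannian g, volume_form g vol &
      forall c x, img c x -> forall (u v : 'rV[R]_7) (b : mindex 7),
        inner g c x u v * vol c x b =
        6^-1 * rwedge (rwedge (contract u phi) (contract v phi)) phi c x b].

Definition G2_psi (R : realType) (M : manifold7 R) (phi : tensor M R^o 3)
    (g : tensor M R^o 2) (vol : tensor M R^o 7) : tensor M R^o 4 :=
  @hodge R M g 3 4 vol phi.

(* T_a^e *)
Definition torsion_up (R : realType) (M : manifold7 R) (g T : tensor M R^o 2)
    (c : atlas M) (x : 'rV[R]_7) (a e : 'I_7) : R :=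
  \sum_(f < 7) ginv g c x e f * T c x [tuple a; f].

(* nabla_a phi_{bcd} = 2 T_a^e psi_{ebcd} *)
Definition is_torsion (R : realType) (M : manifold7 R) (phi : tensor M R^o 3)
    (g : tensor M R^o 2) (vol : tensor M R^o 7) (T : tensor M R^o 2) :=
  tensor_field T /\
  (forall c x, img c x -> forall (a : 'I_7) (b : mindex 3),
     nabla g phi c x [tuple of a :: b] =
     2 * \sum_(e < 7) torsion_up g T c x a e
                      * G2_psi phi g vol c x [tuple of e :: b]).

Definition torsion_octo (R : realType) (M : manifold7 R) (g T : tensor M R^o 2) :
    tensor M (octo R) 1 :=
  fun c x b => (0, \row_a torsion_up g T c x (thead b) a).

(* (u x v)^k = g^{kl} phi(u, v, e_l), that is <u x v, w> = phi(u, v, w) *)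
Definition cross (R : realType) (M : manifold7 R) (phi : tensor M R^o 3)
    (g : tensor M R^o 2) (c : atlas M) (x u v : 'rV[R]_7) : 'rV[R]_7 :=
  \row_k \sum_(l < 7) ginv g c x k l *
    \sum_(i < 7) \sum_(j < 7) phi c x [tuple i; j; l] * u ord0 i * v ord0 j.

Definition omul (R : realType) (M : manifold7 R) (phi : tensor M R^o 3)
    (g : tensor M R^o 2) (c : atlas M) (x : 'rV[R]_7) (A B : octo R) : octo R :=
  (A.1 * B.1 - inner g c x A.2 B.2,
   A.1 *: B.2 + B.1 *: A.2 + cross phi g c x A.2 B.2).

Definition owedge (R : realType) (M : manifold7 R) (phi : tensor M R^o 3)
    (g : tensor M R^o 2) p q
    (A : tensor M (octo R) p) (B : tensor M (octo R) q) :
    tensor M (octo R) (p + q) :=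
  wedge (omul phi g) A B.

Definition d_nabla (R : realType) (M : manifold7 R) (g : tensor M R^o 2) p
    (Q : tensor M (octo R) p) : tensor M (octo R) p.+1 :=
  fun c x b => p.+1%:R *: antisym (nabla_octo g Q c x) b.

Definition d_D (R : realType) (M : manifold7 R) (phi : tensor M R^o 3)
    (g T : tensor M R^o 2) p (Q : tensor M (octo R) p) :
    tensor M (octo R) p.+1 :=
  fun c x b =>
    d_nabla g Q c x b
    - (-1) ^+ p *: cast_deg (addn1 p) (owedge phi g Q (torsion_octo g T)) c x b.

(* (pi_7 Riem)_{ij}^a = Riem_{ij}^{bc} phi^a_{bc} *)
Definition pi7_riem (R : realType) (M : manifold7 R) (phi : tensor M R^o 3)
    (g : tensor M R^o 2) (Riem : tensor M 'M[R]_7 2) : tensor M (octo R) 2 :=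
  fun c x ij =>
    let i := tnth ij ord0 in let j := tnth ij ord_max in
    (0, \row_a \sum_(b < 7) \sum_(d < 7)
          (\sum_(k < 7) \sum_(l < 7)
             ginv g c x b k * ginv g c x d l * riem_low g Riem c x i j k l)
          * (\sum_(f < 7) ginv g c x a f * phi c x [tuple f; b; d])).

(* Main.v *)
Require Import Defs.
From mathcomp Require Import all_boot all_order all_algebra all_fingroup.
From mathcomp Require Import all_classical all_reals all_analysis.
From mathcomp Require Import ring lra.

(* In a chart put D_i A = nabla_i A - A o T_i on OM-valued functions.
   The torsion identity nabla phi = 2 T -| psi and the fact that the associator
   (XY)Z - X(YZ) is 2 psi(Z, X, Y, .)^# for imaginary Z give the Leibniz rule
     D_i (A o B) = (nabla_i A) o B + A o D_i B.
   Applied to A o T_j it yields [D_i, D_j] A = Riem_ij (Im A) - A o F_ij with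
   F = d_D T; the terms with a single derivative of A, and (A T_i) T_j, are
   symmetric in i, j.  As d_D Q is (p+1) times the antisymmetrisation of
   D_{b_0} Q_{b_1...b_p} (the Christoffel terms on form indices cancel), the first
   equality follows.
   Applying [D_i, D_j] to a product A o B in two ways gives
     R(AB) - (RA)B - A(RB) = (AB)F - A(BF),   R = Riem_ij,
   so F measures by how much R fails to be a derivation.  Contracting with psi in
   a frame where phi is phi0 solves this for F and gives F = 1/4 pi_7 Riem.
   That such a frame is orthonormal and oriented, and the contraction identities
   of phi0 and psi0, are finite computations with integers. *)

Set Implicit Arguments.
Unset Strict Implicit.
Unset Printing Implicit Defensive.

Import Order.TTheory GRing.Theory Num.Theory numFieldNormedType.Exports.

Local Open Scope classical_set_scope.
Local Open Scope ring_scope.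

(** * Partial derivatives *)

(** Differentiation takes place in coordinates, octonion algebra at a single point in a frame [A].
    So no regularity of the frame in the point is ever involved: the derivative of the product is
    found from its coordinate structure constants, and associators are carried to the standard
    octonions pointwise. The identity between R and F involves the endomorphism indices of Riem,
    whereas pi_7 contracts its two form indices; the exchange Riem_{ijkl} = Riem_{klij} joins the
    two. Of the symmetries behind this exchange, antisymmetry in the first pair is extracted from
    the real part of that same identity, and the cyclic identity from the symmetry of the
    Christoffel symbols. That F is imaginary has to be known beforehand, since the associator is
    given by psi only for an imaginary last factor. Riem is specified only through its action on
    smooth vector fields. Its coordinate formula is therefore read off from constant fields, and
    then applied to octonion functions that are merely twice differentiable. *)

Section PartialDerivatives.
Variable R : realType.
Implicit Types (f h : 'rV[R]_7 -> R^o) (x : 'rV[R]_7) (i j : 'I_7).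

Lemma partial_near i f h x :
  (\forall y \near x, f y = h y) -> partial i f x = partial i h x.
Proof. exact: near_eq_derive. Qed.

(** The first-order expansion at [x] involves only values near [x], so the differential of [f]
    serves for [h]. Component functions are controlled only on the open image of a chart, which
    makes this locality indispensable. *)
Lemma differentiable_near f h x :
  (\forall y \near x, f y = h y) -> differentiable f x -> differentiable h x.
Proof.
move=> fh /diff_locallyP[dfcont dfo]; have fhx : f x = h x := nbhs_singleton fh.
have E : (h \o shift x : 'rV[R]_7 -> R^o) =
    (cst (h x) : 'rV[R]_7 -> R^o) + ('d f x : 'rV[R]_7 -> R^o) +o_ (0 : 'rV[R]_7) id.
  apply/eqaddoP => e e0; move/eqaddoP: dfo => /(_ e e0) dfo.
  have fh0 : \forall y \near (0 : 'rV[R]_7), f (y + x) = h (y + x).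
    by move: fh; rewrite (near_shift 0) subr0.
  near=> y.
  have : `|((f \o shift x : 'rV[R]_7 -> R^o) -
      ((cst (f x) : 'rV[R]_7 -> R^o) + ('d f x : 'rV[R]_7 -> R^o))) y| <= e * `|y|.
    by near: y.
  by rewrite !fctE /= fhx (near fh0 y).
by apply/diff_locallyP; rewrite (diff_unique dfcont E).
Unshelve. all: by end_near. Qed.

Lemma partial_cst i (a : R) x : partial i (fun=> a) x = 0.
Proof. by rewrite /partial (_ : (fun=> a) = cst (a : R^o)) // derive_cst. Qed.

Lemma partialD i f h x : differentiable f x -> differentiable h x ->
  partial i (fun y => f y + h y) x = partial i f x + partial i h x.
Proof. by move=> df dh; rewrite /partial -deriveD //; exact: diff_derivable. Qed.

Lemma partialB i f h x : differentiable f x -> differentiable h x ->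
  partial i (fun y => f y - h y) x = partial i f x - partial i h x.
Proof. by move=> df dh; rewrite /partial -deriveB //; exact: diff_derivable. Qed.

Lemma partialM i f h x : differentiable f x -> differentiable h x ->
  partial i (fun y => f y * h y) x = partial i f x * h x + f x * partial i h x.
Proof.
move=> df dh; rewrite /partial.
have := deriveM (diff_derivable (v := delta_mx ord0 i) df)
                (diff_derivable (v := delta_mx ord0 i) dh).
by rewrite /GRing.scale /= => ->; rewrite addrC mulrC.
Qed.

Lemma partial_sum i n (F : 'I_n -> 'rV[R]_7 -> R^o) x :
  (forall k, differentiable (F k) x) ->
  partial i (fun y => \sum_(k < n) F k y) x = \sum_(k < n) partial i (F k) x.
Proof.
move=> dF; rewrite /partial -derive_sum; last by move=> k; exact: diff_derivable.
by congr (derive _ _ _); apply/funext => y; rewrite fct_sumE.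
Qed.

Lemma differentiable_add f h x : differentiable f x -> differentiable h x ->
  differentiable (fun y => f y + h y : R^o) x.
Proof. exact: differentiableD. Qed.

Lemma differentiable_opp f x : differentiable f x -> differentiable (fun y => - f y : R^o) x.
Proof. exact: differentiableN. Qed.

Lemma differentiable_sub f h x : differentiable f x -> differentiable h x ->
  differentiable (fun y => f y - h y : R^o) x.
Proof. exact: differentiableB. Qed.

Lemma differentiable_mul f h x : differentiable f x -> differentiable h x ->
  differentiable (fun y => f y * h y : R^o) x.
Proof. exact: differentiableM. Qed.

Lemma differentiable_const (a : R) x : differentiable (fun=> a : R^o) x.
Proof. exact: differentiable_cst. Qed.

Lemma differentiable_bigsum n (F : 'I_n -> 'rV[R]_7 -> R^o) x :
  (forall k, differentiable (F k) x) ->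
  differentiable (fun y => \sum_(k < n) F k y : R^o) x.
Proof.
move=> dF; rewrite (_ : (fun y => _) = \sum_(k < n) F k); last first.
  by apply/funext => y; rewrite fct_sumE.
exact: differentiable_sum.
Qed.

(** The two difference quotients are literally the same function of the increment. This reduces
    increments in seven variables to the one-variable mean value theorem. *)
Lemma derive_line f (p v : 'rV[R]_7) (s : R) : differentiable f (s *: v + p) ->
  is_derive s 1 (fun r : R => f (r *: v + p)) ('D_v f (s *: v + p)).
Proof.
move=> /(@diff_derivable _ _ _ _ _ v) df.
have E : (fun h : R => h^-1 *: (((fun r : R => f (r *: v + p)) \o shift s) (h *: 1)
             - f (s *: v + p))) =
         (fun h : R => h^-1 *: ((f \o shift (s *: v + p)) (h *: v) - f (s *: v + p))).
  apply/funext => h /=; congr (_ *: (f _ - _)).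
  by rewrite /GRing.scale /= mulr1 -/(GRing.scale _ _) scalerDl addrA.
by apply: DeriveDef; rewrite /derivable /derive E.
Qed.

(* The second difference of [f] over a square of side [t] is symmetric in [i] and
   [j] and equals [t ^+ 2 * partial j (partial i f) x] up to o(t^2). *)
Lemma second_difference (U : set 'rV[R]_7) i j f x (e : R) : open U -> U x ->
  (forall y, U y -> differentiable f y) -> differentiable (partial i f) x ->
  0 < e -> exists2 d : R, 0 < d & forall t, 0 < t < d ->
  let ei : 'rV[R]_7 := delta_mx ord0 i in let ej := delta_mx ord0 j in
  `|f (t *: ei + (t *: ej + x)) - f (t *: ei + x) - (f (t *: ej + x) - f x)
    - t ^+ 2 * partial j (partial i f) x| <= e * t ^+ 2.
Proof.
move=> oU Ux df da e0; set a := partial i f.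
set ei : 'rV[R]_7 := delta_mx ord0 i; set ej : 'rV[R]_7 := delta_mx ord0 j.
(* Increments used below have norm at most [t * c]; the summand 1 makes [c] positive. Two
   remainders, each with tolerance [e / (2 * c)], then add up to [e * t], and the mean value theorem
   supplies the other factor [t]. *)
pose c := `|ei| + `|ej| + 1.
have c0 : 0 < c by rewrite /c ltr_wpDl ?addr_ge0.
have [d d0 dP] : exists2 d : R, 0 < d & forall h : 'rV[R]_7, `|h| < d ->
    U (h + x) /\ `|a (h + x) - a x - 'd a x h| <= e / (2 * c) * `|h|.
  have ec0 : 0 < e / (2 * c) by rewrite divr_gt0 // mulr_gt0.
  have /eqaddoP/(_ _ ec0) H1 := diff_locally da.
  have H2 : \forall h \near (0 : 'rV[R]_7), U (h + x).
    have := open_nbhs_nbhs (conj oU Ux).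
    by rewrite -[nbhs x U]/(\near x, U x) (near_shift 0) subr0.
  have [d /= d0 dP] := (nbhs_ballP _ _).1 (filterI H1 H2).
  exists d => // h hd.
  have /dP[h1 h2] : ball 0 d h by rewrite -ball_normE /= sub0r normrN.
  split => //; move: h1; rewrite !fctE /= opprD addrA; exact.
exists (d / c); first by rewrite divr_gt0.
move=> t /andP[t0 td] /=.
have tc : t * c < d by rewrite -ltr_pdivlMr.
have small (s : R) : 0 <= s <= t ->
    `|s *: ei| <= t * c /\ `|s *: ei + t *: ej| <= t * c.
  move=> /andP[s0 st].
  have Hi : `|s *: ei| <= t * `|ei| by rewrite normrZ ger0_norm // ler_wpM2r.
  have Hj : `|t *: ej| <= t * `|ej| by rewrite normrZ ger0_norm // ltW.
  split.
    apply: (le_trans Hi); rewrite ler_wpM2l ?(ltW t0) // /c -addrA lerDl.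
    by rewrite addr_ge0.
  apply: (le_trans (ler_normD _ _)); apply: (le_trans (lerD Hi Hj)).
  by rewrite -mulrDr ler_wpM2l ?(ltW t0) // /c lerDl.
have inU s : 0 <= s <= t -> U (s *: ei + x) /\ U (s *: ei + (t *: ej + x)).
  move=> /small[s1 s2]; rewrite addrA; split; apply: (dP _ _).1;
    exact: le_lt_trans tc.
(* The second difference is [F t - F 0]. The mean value theorem replaces it by [F' s * t], where
   [F' s] is a first difference of [partial i f] in direction [j], so a single expansion of that
   partial at [x] suffices. *)
pose F (s : R) := f (s *: ei + (t *: ej + x)) - f (s *: ei + x).
pose F' (s : R) := a (s *: ei + (t *: ej + x)) - a (s *: ei + x).
have dF s : 0 <= s <= t -> is_derive s 1 F (F' s).
  by move=> /inU[U1 U2]; apply: is_deriveB; apply: derive_line; exact: df.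
have [||s sI] := @MVT R F F' 0 t t0.
- by move=> s; rewrite in_itv /= => /andP[s0 st]; apply: dF; rewrite !ltW.
- apply: derivable_within_continuous => s; rewrite in_itv /= => sI.
  by have [] := dF _ sI.
rewrite subr0 /F !scale0r !add0r => ->.
have {}sI : 0 <= s <= t by move: sI; rewrite in_itv /= => /andP[s0 st]; rewrite !ltW.
have [n1 n2] := small _ sI.
have [_ /= e1] := dP _ (le_lt_trans n1 tc); have [_ /= e2] := dP _ (le_lt_trans n2 tc).
have -> : partial j a x = 'd a x ej by rewrite /partial deriveE.
have E : F' s * t - t ^+ 2 * 'd a x ej =
  t * ((a (s *: ei + t *: ej + x) - a x - 'd a x (s *: ei + t *: ej))
       - (a (s *: ei + x) - a x - 'd a x (s *: ei))).
  have L : 'd a x (t *: ej) = t * 'd a x ej by rewrite linearZ.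
  by rewrite /F' addrA linearD L; ring.
rewrite E normrM gtr0_norm // expr2 mulrCA ler_pM2l //.
apply: (le_trans (ler_normB _ _)).
have b1 : e / (2 * c) * `|s *: ei + t *: ej| <= e / 2 * t.
  rewrite (_ : e / 2 * t = e / (2 * c) * (t * c)); last by field; rewrite gt_eqF.
  by rewrite ler_wpM2l // ltW // divr_gt0 // mulr_gt0.
have b2 : e / (2 * c) * `|s *: ei| <= e / 2 * t.
  rewrite (_ : e / 2 * t = e / (2 * c) * (t * c)); last by field; rewrite gt_eqF.
  by rewrite ler_wpM2l // ltW // divr_gt0 // mulr_gt0.
by lra.
Qed.

(** The second difference over a square does not depend on the order of the two directions, so both
    mixed derivatives, scaled by [t ^+ 2], lie within [e / 2 * t ^+ 2] of the same number. *)
Theorem partialC (U : set 'rV[R]_7) i j f x : open U -> U x ->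
  (forall y, U y -> differentiable f y) ->
  differentiable (partial i f) x -> differentiable (partial j f) x ->
  partial i (partial j f) x = partial j (partial i f) x.
Proof.
move=> oU Ux df di dj; apply/eqP; rewrite -subr_eq0 -normr_le0.
apply/ler_addgt0Pl => e e0; rewrite addr0.
have e20 : 0 < e / 2 by rewrite divr_gt0.
have [d1 d10 H1] := second_difference j oU Ux df di e20.
have [d2 d20 H2] := second_difference i oU Ux df dj e20.
pose t := Num.min d1 d2 / 2.
have t0 : 0 < t by rewrite divr_gt0 // lt_min d10.
have tm : t < Num.min d1 d2 by rewrite /t; move: t0; rewrite /t; lra.
have td1 : 0 < t < d1 by rewrite t0 (lt_le_trans tm) // ge_min lexx.
have td2 : 0 < t < d2 by rewrite t0 (lt_le_trans tm) // ge_min lexx orbT.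
have {}H1 := H1 t td1; have {}H2 := H2 t td2.
have t20 : 0 < t ^+ 2 by rewrite exprn_gt0.
rewrite -(ler_pM2l t20) -[X in X * `|_|](gtr0_norm t20) -normrM mulrBr.
move: H1 H2 => /=; rewrite addrCA.
set A := f _; set B := f _; set C := f _; set D := f _.
set X := partial j _ _; set Y := partial i _ _ => H1 H2.
have -> : t ^+ 2 * Y - t ^+ 2 * X =
  (A - B - (C - D) - t ^+ 2 * X) - (A - C - (B - D) - t ^+ 2 * Y) by ring.
rewrite (_ : t ^+ 2 * e = e / 2 * t ^+ 2 + e / 2 * t ^+ 2); last by field.
by apply: (le_trans (ler_normB _ _)); exact: (lerD H1 H2).
Qed.

End PartialDerivatives.

(** * Antisymmetrisation *)

Section Antisymmetrization.
Variables (R : realType) (V : lmodType R).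

Lemma perm_idxM n (s t : 'S_n) (b : mindex n) :
  perm_idx s (perm_idx t b) = perm_idx (s * t)%g b.
Proof. by apply: eq_from_tnth => k; rewrite !tnth_mktuple permM. Qed.

Lemma eq_antisym n (F G : mindex n -> V) b :
  (forall b', F b' = G b') -> antisym F b = antisym G b.
Proof. by move=> FG; rewrite /antisym; under eq_bigr do rewrite FG. Qed.

Lemma antisymD n (F G : mindex n -> V) b :
  antisym (fun b' => F b' + G b') b = antisym F b + antisym G b.
Proof.
rewrite /antisym -scalerDr -big_split /=; congr (_ *: _).
by apply: eq_bigr => s _; rewrite scalerDr.
Qed.

Lemma antisymZ n (a : R) (F : mindex n -> V) b :
  antisym (fun b' => a *: F b') b = a *: antisym F b.
Proof.
rewrite /antisym scalerA mulrC -scalerA; congr (_ *: _); rewrite scaler_sumr.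
by apply: eq_bigr => s _; rewrite !scalerA mulrC.
Qed.

Lemma antisymN n (F : mindex n -> V) b :
  antisym (fun b' => - F b') b = - antisym F b.
Proof.
rewrite -scaleN1r -antisymZ; apply: eq_antisym => b'; by rewrite scaleN1r.
Qed.

Lemma antisymB n (F G : mindex n -> V) b :
  antisym (fun b' => F b' - G b') b = antisym F b - antisym G b.
Proof. by rewrite antisymD antisymN. Qed.

Lemma antisym_sum n m (F : 'I_m -> mindex n -> V) b :
  antisym (fun b' => \sum_(k < m) F k b') b = \sum_(k < m) antisym (F k) b.
Proof.
rewrite /antisym -scaler_sumr exchange_big /=; congr (_ *: _).
by apply: eq_bigr => s _; rewrite scaler_sumr.
Qed.

Lemma antisym_perm n (F : mindex n -> V) (t : 'S_n) b :
  antisym (fun b' => F (perm_idx t b')) b = (-1) ^+ t *: antisym F b.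
Proof.
rewrite /antisym scalerA mulrC -scalerA; congr (_ *: _).
rewrite scaler_sumr [RHS](reindex_inj (mulgI t)) /=; apply: eq_bigr => s _.
rewrite perm_idxM scalerA odd_permM; congr (_ *: _).
by rewrite signr_addb mulrA -signr_addb addbb mul1r.
Qed.

Lemma antisym_sym n (F : mindex n -> V) (t : 'S_n) b :
  odd_perm t -> (forall b', F (perm_idx t b') = F b') -> antisym F b = 0.
Proof.
move=> to FE; have := antisym_perm F t b; rewrite to expr1 scaleN1r.
rewrite (eq_antisym _ FE) => /eqP; rewrite -addr_eq0 -mulr2n -scaler_nat.
by rewrite scaler_eq0 pnatr_eq0 /= => /eqP.
Qed.

(** Used with the transposition of the first two indices, it turns second derivatives into
    commutators. *)
Lemma antisym_half n (F : mindex n -> V) (t : 'S_n) b : odd_perm t ->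
  antisym F b = 2^-1 *: antisym (fun b' => F b' - F (perm_idx t b')) b.
Proof.
move=> to; rewrite antisymB antisym_perm to expr1 scaleN1r opprK -mulr2n.
by rewrite -(scaler_nat 2 (antisym F b)) scalerA mulVf ?scale1r // pnatr_eq0.
Qed.

Lemma antisym_cast m n (e : m = n) (F : mindex m -> V) (b : mindex n) :
  antisym F (tcast (esym e) b) = antisym (fun b' => F (tcast (esym e) b')) b.
Proof. by case: _ / e b => b; apply: eq_antisym => b'; rewrite tcast_id. Qed.

Lemma card_perms n : \sum_(s : 'S_n) (1 : R) = n`!%:R.
Proof.
by rewrite sumr_const card_Sn.
Qed.

(** Each [t] contributes its sign twice, once from the inner sum and once from [antisym_perm], so
    all [m]! terms equal the outer antisymmetrisation. *)
Lemma antisym_nested n m (K : mindex n -> V) (h : 'S_m -> 'S_n) b :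
  (forall t, odd_perm (h t) = odd_perm t) ->
  antisym (fun b' => m`!%:R^-1 *: \sum_(t : 'S_m) (-1) ^+ t *: K (perm_idx (h t) b')) b
  = antisym K b.
Proof.
move=> hodd; rewrite antisymZ.
have -> : antisym (fun b' => \sum_(t : 'S_m) (-1) ^+ t *: K (perm_idx (h t) b')) b
    = \sum_(t : 'S_m) (1 : R) *: antisym K b.
  have -> : antisym (fun b' => \sum_(t : 'S_m) (-1) ^+ t *: K (perm_idx (h t) b')) b
    = \sum_(t : 'S_m) antisym (fun b' => (-1) ^+ t *: K (perm_idx (h t) b')) b.
    rewrite /antisym -scaler_sumr exchange_big /=; congr (_ *: _).
    by apply: eq_bigr => s _; rewrite scaler_sumr.
  apply: eq_bigr => t _; rewrite antisymZ antisym_perm hodd scalerA.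
  by rewrite -signr_addb addbb.
by rewrite -scaler_suml card_perms scalerA mulVf ?scale1r // pnatr_eq0 -lt0n fact_gt0.
Qed.

Lemma tnth_tail n (b : mindex n.+1) (k : 'I_n) :
  tnth (tail_idx b) k = tnth b (lift ord0 k).
Proof. by rewrite !(tnth_nth ord0) /= nth_behead. Qed.

(** Permutations of the tail are embedded as permutations fixing position 0. Needed when a
    derivative is applied to a form that is itself an antisymmetrisation. *)
Lemma antisym_tail n (F : 'I_7 -> mindex n -> V) b :
  antisym (fun b' : mindex n.+1 => antisym (F (thead b')) (tail_idx b')) b
  = antisym (fun b' => F (thead b') (tail_idx b')) b.
Proof.
rewrite -[RHS](@antisym_nested _ n _ (fun t => lift_perm ord0 ord0 t)); last first.
  by move=> t; rewrite odd_lift_perm addbb.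
apply: eq_antisym => b'; rewrite {1}/antisym.  congr (_ *: _) => /=.
apply: eq_bigr => t _; congr (_ *: _); congr F.
  by rewrite /thead tnth_mktuple lift_perm_id.
apply: eq_from_tnth => k.
by rewrite tnth_tail !tnth_mktuple tnth_tail lift_perm_lift.
Qed.

Definition block_fun p q (t : 'S_p) (k : 'I_(p + q)) : 'I_(p + q) :=
  match fintype.split k with
  | inl i => lshift q (t i)
  | inr j => rshift p j
  end.

Lemma block_fun_inj p q (t : 'S_p) : injective (@block_fun p q t).
Proof.
apply: (can_inj (g := @block_fun p q t^-1%g)) => k.
rewrite -[k]splitK; case: (fintype.split k) => j; rewrite /block_fun unsplitK.
  by rewrite (unsplitK (inl (t j))) permK.
by rewrite (unsplitK (inr j)).
Qed.

Definition block_perm p q (t : 'S_p) : 'S_(p + q) := perm (@block_fun_inj p q t).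

Lemma block_perm_lshift p q (t : 'S_p) i :
  block_perm q t (lshift q i) = lshift q (t i).
Proof. by rewrite permE /block_fun (unsplitK (inl i)). Qed.

Lemma block_perm_rshift p q (t : 'S_p) j :
  block_perm q t (rshift p j) = rshift p j.
Proof. by rewrite permE /block_fun (unsplitK (inr j)). Qed.

(** The sign is the determinant of the permutation matrix, which is block triangular with diagonal
    blocks [perm_mx t] and the identity. *)
Lemma odd_block_perm p q (t : 'S_p) : odd_perm (block_perm q t) = odd_perm t.
Proof.
have: \det (perm_mx (block_perm q t) : 'M[R]_(p + q)) = \det (perm_mx t : 'M[R]_p).
  rewrite -[perm_mx (block_perm q t)]submxK.
  have -> : ulsubmx (perm_mx (block_perm q t)) = perm_mx t :> 'M[R]_p.
    apply/matrixP => i j; rewrite !mxE block_perm_lshift.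
    by rewrite (inj_eq (@lshift_inj _ _)).
  have -> : dlsubmx (perm_mx (block_perm q t)) = 0 :> 'M[R]_(q, p).
    by apply/matrixP => i j; rewrite !mxE block_perm_rshift eq_rlshift.
  have -> : drsubmx (perm_mx (block_perm q t)) = 1%:M :> 'M[R]_q.
    by apply/matrixP => i j; rewrite !mxE block_perm_rshift eq_rshift.
  by rewrite det_ublock det1 mulr1.
rewrite !det_perm => /eqP.
case: (odd_perm _); case: (odd_perm _) => //; rewrite expr0 expr1 1?[_ == 1]eq_sym;
  by rewrite -addr_eq0 -mulr2n pnatr_eq0.
Qed.

(** Removes the inner antisymmetrisation of an iterated wedge product. *)
Lemma antisym_left p q (F : mindex p -> mindex q -> V) b :
  antisym (fun b' : mindex (p + q) =>
    antisym (fun a => F a (right_idx b')) (left_idx b')) b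
  = antisym (fun b' => F (left_idx b') (right_idx b')) b.
Proof.
rewrite -[RHS](@antisym_nested _ p _ (block_perm q)); last exact: odd_block_perm.
apply: eq_antisym => b'; rewrite {1}/antisym; congr (_ *: _) => /=.
apply: eq_bigr => t _; congr (_ *: _); congr F; apply: eq_from_tnth => k;
  by rewrite !tnth_mktuple ?block_perm_lshift ?block_perm_rshift.
Qed.

Lemma left_idx_tcast p q n (e : (p + q)%N = n) (b : mindex n) (k : 'I_p) :
  tnth (left_idx (tcast (esym e) b)) k = nth ord0 b k.
Proof. by rewrite tnth_mktuple tcastE (tnth_nth ord0). Qed.

Lemma right_idx_tcast p q n (e : (p + q)%N = n) (b : mindex n) (k : 'I_q) :
  tnth (right_idx (tcast (esym e) b)) k = nth ord0 b (p + k).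
Proof. by rewrite tnth_mktuple tcastE (tnth_nth ord0). Qed.

(** The cycle that moves the first index of a multi-index to the last place; it has sign (-1)^n. *)
Definition rot_perm n : 'S_n.+1 := lift_perm ord_max ord0 1%g.

Lemma odd_rot_perm n : odd_perm (rot_perm n) = odd n.
Proof. by rewrite odd_lift_perm /= odd_perm1 !addbF. Qed.

Lemma nth_rot_perm n (b : mindex n.+1) k : (k <= n)%N ->
  nth ord0 (perm_idx (rot_perm n) b) k =
  if k == n then nth ord0 b 0 else nth ord0 b k.+1.
Proof.
move=> kn; rewrite -[in LHS](@inordK n k) ?ltnS // -tnth_nth tnth_mktuple.
rewrite (tnth_nth ord0); case: eqP => [->|/eqP kn'].
  rewrite (_ : inord n = ord_max) ?lift_perm_id //.
  by apply: val_inj; rewrite /= inordK.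
have kn2 : (k < n)%N by rewrite ltn_neqAle kn'.
rewrite (_ : inord k = lift ord_max (Ordinal kn2)).
  by rewrite lift_perm_lift perm1.
by apply: val_inj; rewrite /= inordK // /bump leqNgt kn2.
Qed.

(** Moving the last index in front of [p] others costs (-1)^p, exactly the sign that [d_D] puts
    before its torsion term. *)
Lemma antisym_rot1 p (F : mindex p -> mindex 1 -> V) (b : mindex p.+1) :
  antisym (fun b' => F (left_idx b') (right_idx b')) (tcast (esym (addn1 p)) b) =
  (-1) ^+ p *: antisym (fun b' => F (tail_idx b') [tuple thead b']) b.
Proof.
rewrite antisym_cast; pose K b' := F (left_idx (tcast (esym (addn1 p)) b'))
  (right_idx (tcast (esym (addn1 p)) b')).
rewrite [in RHS](@eq_antisym _ _ (fun b' => K (perm_idx (rot_perm p) b'))).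
  rewrite antisym_perm odd_rot_perm signr_odd scalerA -expr2 sqrr_sign scale1r.
  by [].
move=> b'; rewrite /K; congr F; apply: eq_from_tnth => k.
  rewrite left_idx_tcast nth_rot_perm 1?ltnW // ltn_eqF //.
  by rewrite (tnth_nth ord0) /= nth_behead.
rewrite right_idx_tcast nth_rot_perm ?ord1 ?addn0 // eqxx.
by rewrite (tnth_nth ord0) /= /thead (tnth_nth ord0).
Qed.

(** Two indices are moved past the same block by two equal rotations, whose signs cancel. *)
Lemma antisym_rot2 p (F : mindex p -> mindex 2 -> V) (b : mindex p.+2) :
  antisym (fun b' => F (left_idx b') (right_idx b')) (tcast (esym (addn2 p)) b) =
  antisym (fun b' => F (tail_idx (tail_idx b'))
                       [tuple thead b'; thead (tail_idx b')]) b.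
Proof.
rewrite antisym_cast; pose K b' := F (left_idx (tcast (esym (addn2 p)) b'))
  (right_idx (tcast (esym (addn2 p)) b')).
pose r := rot_perm p.+1.
rewrite [RHS](@eq_antisym _ _
  (fun b' => K (perm_idx r (perm_idx r b')))).
  rewrite (antisym_perm (fun b' => K (perm_idx r b'))) antisym_perm scalerA.
  by rewrite -expr2 sqrr_sign scale1r.
move=> b'; rewrite /K; congr F; apply: eq_from_tnth => k.
  have kp := ltn_ord k.
  rewrite left_idx_tcast nth_rot_perm; last by rewrite ltnW // ltnW.
  rewrite ltn_eqF ?nth_rot_perm; [|by rewrite ltnS ltnW|by rewrite ltnS ltnW].
  by rewrite eqSS ltn_eqF // (tnth_nth ord0) /= !nth_behead.
rewrite right_idx_tcast nth_rot_perm; last first.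
  by case: k => [[|[|]]] //= _; rewrite ?addn0 ?addn1.
rewrite (tnth_nth ord0).
case: k => [[|[|]]] // kk; rewrite [nat_of_ord _]/= ?addn0 ?addn1.
  rewrite (ltn_eqF (ltnSn p)) nth_rot_perm // eqxx.
  by rewrite /= /thead (tnth_nth ord0).
rewrite eqxx nth_rot_perm // /= /thead (tnth_nth ord0) /=.
by rewrite nth_behead.
Qed.

End Antisymmetrization.

(** * The Levi-Civita symbol *)

Section Orientation.

Definition sgn_nat (a b : nat) : int :=
  if (a < b)%N then 1 else if (b < a)%N then - 1 else 0.

Fixpoint eps_seq (s : seq nat) : int :=
  if s is a :: s' then foldr (fun b z => sgn_nat a b * z) 1 s' * eps_seq s' else 1.

Definition eps n (b : mindex n) : int := eps_seq [seq val i | i <- b].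

Lemma sgn_natE a b : sgn_nat a b = sgz (b%:Z - a%:Z).
Proof.
rewrite /sgn_nat; case: ltngtP => ab.
- by rewrite gtr0_sgz // subr_gt0 ltz_nat.
- by rewrite ltr0_sgz // subr_lt0 ltz_nat.
- by rewrite ab subrr sgz0.
Qed.

Lemma sgz_prod (I : Type) (r : seq I) (P : pred I) (F : I -> int) :
  sgz (\prod_(i <- r | P i) F i) = \prod_(i <- r | P i) sgz (F i).
Proof. by elim/big_rec2: _ => [|i x y _ <-]; rewrite (sgz1, sgzM). Qed.

(* [eps b] is the sign of this product, which makes it alternating; as [eps_seq]
   it is computable. *)
Definition vandermonde n (b : mindex n) : int :=
  \prod_(i < n) \prod_(j < n | (i < j)%N) ((tnth b j)%:Z - (tnth b i)%:Z).

Lemma eps_cons n i (b : mindex n) :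
  eps [tuple of i :: b] = (\prod_(j < n) sgn_nat i (tnth b j)) * eps b.
Proof.
rewrite /eps /=; congr (_ * _); rewrite -(big_tuple _ _ b predT (fun j : 'I_7 => sgn_nat i j)).
by elim: (tval b) => [|j s IH] /=; rewrite ?big_nil // big_cons IH.
Qed.

Lemma eps_vandermonde n (b : mindex n) : eps b = sgz (vandermonde b).
Proof.
elim: n b => [|n IH] b; first by rewrite tuple0 /vandermonde big_ord0.
case/tupleP: b => i b; rewrite eps_cons IH /vandermonde big_ord_recl sgzM.
congr (_ * _).
  rewrite [in RHS]big_mkcond big_ord_recl /= mul1r sgz_prod; apply: eq_bigr => j _.
  by rewrite sgn_natE tnth0 tnthS.
congr sgz; apply: eq_bigr => k _; rewrite [in RHS]big_mkcond big_ord_recl /= mul1r.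
rewrite [in LHS]big_mkcond; apply: eq_bigr => j _.
by rewrite !tnthS /bump !leq0n !add1n ltnS.
Qed.

Lemma vandermonde_det n (b : mindex n) : vandermonde b =
  \det (Vandermonde n (\row_i ((tnth b i)%:Z : int))).
Proof.
rewrite det_Vandermonde; apply: eq_bigr => i _; apply: eq_bigr => j _.
by rewrite !mxE.
Qed.

(** Permuting the indices permutes the columns of a Vandermonde matrix. *)
Lemma vandermonde_perm n (s : 'S_n) (b : mindex n) :
  vandermonde (perm_idx s b) = (-1) ^+ s * vandermonde b.
Proof.
rewrite !vandermonde_det.
have -> : Vandermonde n (\row_i ((tnth (perm_idx s b) i)%:Z : int)) =
   col_perm s (Vandermonde n (\row_i ((tnth b i)%:Z : int))).
  by apply/matrixP => i j; rewrite !mxE tnth_mktuple.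
by rewrite col_permE det_mulmx det_perm mulrC odd_permV.
Qed.

Lemma eps_perm n (s : 'S_n) (b : mindex n) :
  eps (perm_idx s b) = (-1) ^+ s * eps b.
Proof.
rewrite !eps_vandermonde vandermonde_perm sgzM; congr (_ * _).
by case: (odd_perm s).
Qed.

Lemma perm_idx_uniq (b : mindex 7) : uniq b ->
  exists s : 'S_7, b = perm_idx s (ord_tuple 7).
Proof.
move=> /tuple_uniqP bI; exists (perm bI); apply: eq_from_tnth => k.
by rewrite tnth_mktuple tnth_ord_tuple permE.
Qed.

Lemma perm_idx_inj : injective (fun s : 'S_7 => perm_idx s (ord_tuple 7)).
Proof.
move=> s t /(congr1 (fun b => tnth b)) E; apply/permP => k.
by have := congr1 (@^~ k) E; rewrite !tnth_mktuple !tnth_ord_tuple.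
Qed.

Lemma eps_ord : eps (ord_tuple 7) = 1.
Proof. by rewrite /eps val_ord_tuple val_enum_ord. Qed.

Lemma eps_nuniq n (b : mindex n) : ~~ uniq b -> eps b = 0.
Proof.
rewrite /eps; elim: (tval b) => //= i s IH; rewrite negb_and negbK => /orP[|/IH->].
  move=> si; rewrite (_ : foldr _ _ _ = 0) ?mul0r //.
  elim: s si {IH} => //= j s IH; rewrite inE => /orP[/eqP <-|/IH ->].
    by rewrite /sgn_nat ltnn mul0r.
  by rewrite mulr0.
by rewrite mulr0.
Qed.

Lemma alternating_nuniq (R : realType) (V : lmodType R) n (F : mindex n -> V)
    (b : mindex n) :
  Defs.alternating F -> ~~ uniq b -> F b = 0.
Proof.
move=> altF /tuple_uniqP/injectiveP/injectivePn[i [j ij bij]].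
have := altF (tperm i j) b; rewrite odd_tperm ij expr1 scaleN1r.
have -> : perm_idx (tperm i j) b = b.
  by apply: eq_from_tnth => k; rewrite tnth_mktuple; case: tpermP => [->|->|].
move=> /eqP; rewrite -addr_eq0 -mulr2n -scaler_nat scaler_eq0 pnatr_eq0 /=.
by move/eqP.
Qed.

Lemma alternating_eps (R : realType) (V : lmodType R) (F : mindex 7 -> V)
    (b : mindex 7) :
  Defs.alternating F -> F b = (eps b)%:~R *: F (ord_tuple 7).
Proof.
move=> altF; have [|nb] := boolP (uniq b); last first.
  by rewrite eps_nuniq // scale0r alternating_nuniq.
move=> /perm_idx_uniq[s ->]; rewrite altF eps_perm eps_ord mulr1.
by congr (_ *: _); case: (odd_perm s); rewrite ?expr0 ?expr1 ?mulrN1z.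
Qed.

(** Multi-indices without repetition are the permutations, and [eps] vanishes on the others. Sums
    over all multi-indices split into independent sums over single indices, which sums over ['S_7]
    do not. *)
Lemma sum_eps (R : realType) (V : lmodType R) (F : mindex 7 -> V) :
  \sum_(s : 'S_7) (-1) ^+ s *: F (perm_idx s (ord_tuple 7)) =
  \sum_(b : mindex 7) (eps b)%:~R *: F b.
Proof.
rewrite [RHS](bigID (fun b : mindex 7 => uniq b)) /= [X in _ + X]big1 ?addr0;
  last by move=> b /eps_nuniq ->; rewrite scale0r.
rewrite (reindex (fun s : 'S_7 => perm_idx s (ord_tuple 7))); last first.
  (* The default [1%g] is never reached, since the reindexed sum is restricted to multi-indices
     without repetition. *)
  exists (fun b => odflt 1%g [pick s | perm_idx s (ord_tuple 7) == b]).
    move=> s _; case: pickP => [t /eqP /perm_idx_inj //|/(_ s)].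
    by rewrite eqxx.
  move=> b; rewrite inE => /perm_idx_uniq[s ->]; case: pickP => [t /eqP //|/(_ s)].
  by rewrite eqxx.
apply: eq_big => [s|s _].
  apply/esym/tuple_uniqP => i j; rewrite !tnth_mktuple !tnth_ord_tuple.
  exact: perm_inj.
rewrite eps_perm eps_ord mulr1.
by congr (_ *: _); case: (odd_perm s); rewrite ?expr0 ?expr1 ?mulrN1z.
Qed.

End Orientation.

(** * The standard G2-form and its dual, as integer tables *)

Section StandardForm.

(* The coefficient of [e^a /\ e^b /\ e^c] (0-based) in [e^{xyz}] (1-based). *)
Definition e3_int (x y z a b c : nat) : int :=
  let d (r s : nat) : int := (r == s.+1)%:Z in
  d x a * (d y b * d z c - d y c * d z b)
  - d x b * (d y a * d z c - d y c * d z a)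
  + d x c * (d y a * d z b - d y b * d z a).

Definition phi_int (a b c : nat) : int :=
  e3_int 1 2 3 a b c + e3_int 1 4 5 a b c + e3_int 1 6 7 a b c
  + e3_int 2 4 6 a b c - e3_int 2 5 7 a b c - e3_int 3 4 7 a b c
  - e3_int 3 5 6 a b c.

(** Stored in evaluated form so that the exhaustive checks below look coefficients up instead of
    expanding 3 x 3 determinants each time. *)
Definition phi_table : seq (seq (seq int)) := Eval vm_compute in
  mkseq (fun a => mkseq (fun b => mkseq (phi_int a b) 7) 7) 7.

Definition phiZ (a b c : nat) : int :=
  nth 0 (nth [::] (nth [::] phi_table a) b) c.

Definition deltaZ (a b : nat) : int := (a == b)%:Z.

Definition sum7 (F : nat -> int) : int :=
  foldr (fun i z => F i + z) 0 (iota 0 7).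

(* A notation rather than a function, so that call-by-value evaluation skips [y]
   when [x] is 0. *)
Local Notation smul x y := (let z : int := x in if z == 0 then 0 else z * y).

Lemma smulE (x y : int) : smul x y = x * y.
Proof. by rewrite /=; case: eqP => // ->; rewrite mul0r. Qed.

Lemma sum7E (F : nat -> int) : \sum_(i < 7) F i = sum7 F.
Proof. by rewrite !big_ord_recl big_ord0. Qed.

Definition all7 (p : nat -> bool) : bool := all p (iota 0 7).

Lemma all7P (p : nat -> bool) : all7 p -> forall i : 'I_7, p i.
Proof. by move=> /allP pP i; apply: pP; rewrite mem_iota /=. Qed.

(** Component [k] of the associator (e_i e_j) e_t - e_i (e_j e_t) of imaginary units; the delta
    terms come from the real parts of the inner products. *)
Definition assocZ (t i j k : nat) : int :=
  sum7 (fun l => smul (phiZ i j l) (phiZ l t k)) + deltaZ j t * deltaZ i k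
  - deltaZ i j * deltaZ t k - sum7 (fun l => smul (phiZ j t l) (phiZ i l k)).

(** The associator is 2 psi and psi has entries -1, 0, 1, so taking signs yields psi. That this
    table is the Hodge dual of phi is checked separately in [psi_ok]. *)
Definition psi_table : seq (seq (seq (seq int))) := Eval vm_compute in
  mkseq (fun a => mkseq (fun b => mkseq (fun c =>
    mkseq (fun d => sgz (assocZ a b c d)) 7) 7) 7) 7.

Definition psiZ (a b c d : nat) : int :=
  nth 0 (nth [::] (nth [::] (nth [::] psi_table a) b) c) d.

Ltac by_table := vm_compute; reflexivity.

Lemma phi_table_ok : all7 (fun i => all7 (fun j => all7 (fun k =>
  phi_int i j k == phiZ i j k))).
Proof. by_table. Qed.

Lemma phi_cycle_ok : all7 (fun i => all7 (fun j => all7 (fun k =>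
  (phiZ i j k == phiZ j k i) && (phiZ i j k == - phiZ j i k)))).
Proof. by_table. Qed.

Lemma assoc_ok : all7 (fun t => all7 (fun i => all7 (fun j => all7 (fun k =>
  assocZ t i j k == 2 * psiZ t i j k)))).
Proof. by_table. Qed.

(** Hodge duality; the factor 6 = 3! arises because the sum runs over ordered triples. *)
Lemma psi_ok : all7 (fun b => all7 (fun c => all7 (fun d => all7 (fun e =>
  sum7 (fun i => sum7 (fun j => sum7 (fun k =>
    smul (phiZ i j k) (eps_seq [:: i; j; k; b; c; d; e]))))
  == 6 * psiZ b c d e)))).
Proof. by_table. Qed.

(** Here 24 = 4 * 6, from psi_abcd phi_jcd = 4 phi_jab and phi_iab phi_jab = 6 delta_ij. This fixes
    the normalisation of the metric. *)
Lemma metric_ok : all7 (fun i => all7 (fun j =>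
  sum7 (fun a => sum7 (fun b => smul (phiZ i a b)
    (sum7 (fun c => sum7 (fun d => smul (phiZ j c d) (psiZ a b c d))))))
  == 24 * deltaZ i j)).
Proof. by_table. Qed.

Lemma psi_psi_ok : all7 (fun i => all7 (fun j =>
  sum7 (fun a => sum7 (fun b => sum7 (fun c =>
    smul (psiZ i a b c) (psiZ j a b c))))
  == 24 * deltaZ i j)).
Proof. by_table. Qed.

(** One identity for each of the three terms of the derivation defect of a matrix, which leave
    different pairs of slots of psi contracted with phi. *)
Lemma psi_phi_ok : all7 (fun i => all7 (fun j => all7 (fun k =>
  (sum7 (fun a => sum7 (fun b => smul (psiZ i a b j) (phiZ a b k)))
   == 4 * phiZ i j k) &&
  (sum7 (fun a => sum7 (fun b => smul (psiZ i j a b) (phiZ k a b)))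
   == 4 * phiZ i j k) &&
  (sum7 (fun a => sum7 (fun b => smul (psiZ i a j b) (phiZ a k b)))
   == 4 * phiZ i j k)))).
Proof. by_table. Qed.


Variable R : realType.
Local Notation ph i j k := ((phiZ i j k)%:~R : R).
Local Notation ps i j k l := ((psiZ i j k l)%:~R : R).
Local Notation delta i j := ((i == j)%:R : R).

Lemma sum7R (F : nat -> int) : (sum7 F)%:~R = \sum_(i < 7) (F i)%:~R :> R.
Proof. by rewrite -sum7E rmorph_sum. Qed.

Lemma smulR (x y : int) : (smul x y)%:~R = x%:~R * y%:~R :> R.
Proof. by rewrite smulE intrM. Qed.

Lemma deltaR (i j : 'I_7) : (deltaZ i j)%:~R = delta i j.
Proof. by rewrite /deltaZ -(inj_eq val_inj); case: (_ == _). Qed.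

Lemma e3E (x y z : nat) (a b c : 'I_7) :
  e3 R x y z [tuple a; b; c] = (e3_int x y z a b c)%:~R.
Proof.
rewrite /e3 (expand_det_row _ ord0) !big_ord_recl big_ord0 /cofactor.
rewrite !(expand_det_row _ ord0) !big_ord_recl !big_ord0 /cofactor !det_mx11 !mxE /=.
rewrite !(tnth_nth 0%N) !(tnth_nth ord0) /= /e3_int.
rewrite -[(0 + 0)%N]/0%N -[(0 + bump 0 0)%N]/1%N.
rewrite -[(0 + bump 0 (bump 0 0))%N]/2%N expr0 expr1 sqrrN expr1n.
do 3!rewrite ?(rmorphB, rmorphD, rmorphN, rmorphM) /=.
rewrite -!pmulrn.
by ring.
Qed.

Lemma phi0E (i j k : 'I_7) : phi0 R [tuple i; j; k] = ph i j k.
Proof.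
have /all7P/(_ i)/all7P/(_ j)/all7P/(_ k)/eqP <- := phi_table_ok.
by rewrite /phi0 !e3E /phi_int !(rmorphB, rmorphD).
Qed.

Lemma phi_cycle (i j k : 'I_7) : ph i j k = ph j k i.
Proof.
by have /all7P/(_ i)/all7P/(_ j)/all7P/(_ k)/andP[/eqP -> _] := phi_cycle_ok.
Qed.

Lemma phi_swap (i j k : 'I_7) : ph i j k = - ph j i k.
Proof.
have /all7P/(_ i)/all7P/(_ j)/all7P/(_ k)/andP[_ /eqP ->] := phi_cycle_ok.
by rewrite rmorphN.
Qed.

Lemma phi_assoc (t i j k : 'I_7) :
  \sum_(l < 7) ph i j l * ph l t k + delta j t * delta i k
  - delta i j * delta t k - \sum_(l < 7) ph j t l * ph i l k
  = 2 * ps t i j k.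
Proof.
have /all7P/(_ t)/all7P/(_ i)/all7P/(_ j)/all7P/(_ k)/eqP := assoc_ok.
move=> /(congr1 (intmul (1 : R))); rewrite intrM => <-.
rewrite /assocZ 2!intrB intrD !sum7R !intrM !deltaR.
by congr (_ + _ - _ - _); apply: eq_bigr => l _; rewrite smulR.
Qed.

Lemma psi_dual (b c d e : 'I_7) :
  \sum_(i < 7) \sum_(j < 7) \sum_(k < 7)
     ph i j k * (eps [tuple i; j; k; b; c; d; e])%:~R = 6 * ps b c d e.
Proof.
have /all7P/(_ b)/all7P/(_ c)/all7P/(_ d)/all7P/(_ e)/eqP := psi_ok.
move=> /(congr1 (intmul (1 : R))); rewrite intrM => <-.
rewrite sum7R; apply: eq_bigr => i _; rewrite sum7R; apply: eq_bigr => j _.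
by rewrite sum7R; apply: eq_bigr => k _; rewrite smulR.
Qed.

Lemma phi_phi_psi (i j : 'I_7) :
  \sum_(a < 7) \sum_(b < 7) \sum_(c < 7) \sum_(d < 7)
    ph i a b * ph j c d * ps a b c d = 24 * delta i j.
Proof.
have /all7P/(_ i)/all7P/(_ j)/eqP := metric_ok.
move=> /(congr1 (intmul (1 : R))); rewrite intrM deltaR => <-.
rewrite sum7R; apply: eq_bigr => a _; rewrite sum7R; apply: eq_bigr => b _.
rewrite smulR sum7R mulr_sumr; apply: eq_bigr => c _.
rewrite sum7R mulr_sumr; apply: eq_bigr => d _.
by rewrite smulR mulrA.
Qed.

Lemma psi_psi (i j : 'I_7) :
  \sum_(a < 7) \sum_(b < 7) \sum_(c < 7) ps i a b c * ps j a b c = 24 * delta i j.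
Proof.
have /all7P/(_ i)/all7P/(_ j)/eqP := psi_psi_ok.
move=> /(congr1 (intmul (1 : R))); rewrite intrM deltaR => <-.
rewrite sum7R; apply: eq_bigr => a _; rewrite sum7R; apply: eq_bigr => b _.
by rewrite sum7R; apply: eq_bigr => c _; rewrite smulR.
Qed.

Lemma psi_phi (i j k : 'I_7) :
  [/\ \sum_(a < 7) \sum_(b < 7) ps i a b j * ph a b k = 4 * ph i j k,
      \sum_(a < 7) \sum_(b < 7) ps i j a b * ph k a b = 4 * ph i j k &
      \sum_(a < 7) \sum_(b < 7) ps i a j b * ph a k b = 4 * ph i j k].
Proof.
have /all7P/(_ i)/all7P/(_ j)/all7P/(_ k)/andP[/andP[] ] := psi_phi_ok.
move=> /eqP/(congr1 (intmul (1 : R))) e1 /eqP/(congr1 (intmul (1 : R))) e2.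
move=> /eqP/(congr1 (intmul (1 : R))) e3.
split; [move: e1|move: e2|move: e3]; rewrite intrM => <-;
  rewrite sum7R; apply: eq_bigr => a _; rewrite sum7R; apply: eq_bigr => b _;
  by rewrite smulR.
Qed.

End StandardForm.

(** * Pullback of multilinear forms *)

Section Multilinear.
Variable R : realType.
Implicit Types (n p q : nat) (J K : 'M[R]_7).

Lemma sum_mindex0 (V : nmodType) (F : mindex 0 -> V) :
  \sum_(a : mindex 0) F a = F [tuple].
Proof.
by rewrite (bigD1 [tuple]) //= big1 ?addr0 // => a; rewrite (tuple0 a) => /eqP.
Qed.

Lemma sum_mindexS (V : nmodType) n (F : mindex n.+1 -> V) :
  \sum_(a : mindex n.+1) F a =
  \sum_(i < 7) \sum_(a : mindex n) F [tuple of i :: a].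
Proof.
rewrite pair_big /= (reindex (fun u : 'I_7 * mindex n => [tuple of u.1 :: u.2])) //.
exists (fun a : mindex n.+1 => (thead a, tail_idx a)) => [[i a]|a] _ /=.
  by congr (_, _); apply: val_inj.
by case/tupleP: a => i a; apply: val_inj.
Qed.

Lemma left_idx_cat p q (a : mindex p) (b : mindex q) :
  left_idx [tuple of a ++ b] = a.
Proof. by apply: eq_from_tnth => k; rewrite tnth_mktuple tnth_lshift. Qed.

Lemma right_idx_cat p q (a : mindex p) (b : mindex q) :
  right_idx [tuple of a ++ b] = b.
Proof. by apply: eq_from_tnth => k; rewrite tnth_mktuple tnth_rshift. Qed.

Lemma cat_left_right p q (b : mindex (p + q)) :
  [tuple of left_idx b ++ right_idx b] = b.
Proof.
apply: eq_from_tnth => k; rewrite -[k]splitK; case: (fintype.split k) => j /=.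
  by rewrite tnth_lshift tnth_mktuple.
by rewrite tnth_rshift tnth_mktuple.
Qed.

Lemma sum_mindexD (V : nmodType) p q (F : mindex (p + q) -> V) :
  \sum_(a : mindex (p + q)) F a =
  \sum_(a : mindex p) \sum_(b : mindex q) F [tuple of a ++ b].
Proof.
rewrite pair_big /=.
rewrite (reindex (fun u : mindex p * mindex q => [tuple of u.1 ++ u.2])) //.
exists (fun a : mindex (p + q) => (left_idx a, right_idx a)) => [[a b]|a] _ /=.
  by rewrite left_idx_cat right_idx_cat.
exact: cat_left_right.
Qed.

Lemma prod_sum_mindex n (G : 'I_n -> 'I_7 -> R) :
  \prod_(k < n) \sum_(j < 7) G k j =
  \sum_(a : mindex n) \prod_(k < n) G k (tnth a k).
Proof.
rewrite bigA_distr_bigA (reindex (fun a : mindex n => [ffun k => tnth a k])) /=.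
  by apply: eq_bigr => a _; apply: eq_bigr => k _; rewrite ffunE.
exists (fun f : {ffun 'I_n -> 'I_7} => [tuple f k | k < n]) => [a|f] _.
  by apply: eq_from_tnth => k; rewrite tnth_mktuple ffunE.
by apply/ffunP => k; rewrite ffunE tnth_mktuple.
Qed.

Definition form_eval n (U : 'I_n -> 'rV[R]_7) (F : mindex n -> R) : R :=
  \sum_(a : mindex n) (\prod_(k < n) U k ord0 (tnth a k)) * F a.

Lemma form_eval_pullback n J (U : 'I_n -> 'rV[R]_7) (F : mindex n -> R^o) :
  form_eval U (pullback J F) = form_eval (fun k => U k *m J) F.
Proof.
rewrite /form_eval /pullback.
under eq_bigr do rewrite mulr_sumr.
rewrite exchange_big /=; apply: eq_bigr => a _.
under [in RHS]eq_bigr do rewrite mxE.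
rewrite prod_sum_mindex mulr_suml; apply: eq_bigr => b _.
by rewrite /GRing.scale /= mulrA -big_split.
Qed.

Lemma pullbackE n J (F : mindex n -> R^o) b :
  pullback J F b = form_eval (fun k => row (tnth b k) J) F.
Proof.
apply: eq_bigr => a _; rewrite /GRing.scale /=; congr (_ * _).
by apply: eq_bigr => k _; rewrite mxE.
Qed.

Lemma pullbackM n J K (F : mindex n -> R^o) b :
  pullback J (pullback K F) b = pullback (J *m K) F b.
Proof.
rewrite !pullbackE form_eval_pullback; apply: eq_bigr => a _; congr (_ * _).
by apply: eq_bigr => k _; rewrite row_mul.
Qed.

Lemma pullback1 n (F : mindex n -> R^o) b : pullback 1%:M F b = F b.
Proof.
rewrite /pullback (bigD1 b) //= [X in _ + X]big1 => [|a ab].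
  by rewrite big1 => [|k _]; rewrite ?mxE ?eqxx // scale1r addr0.
have [k abk] : exists k, tnth b k != tnth a k.
  apply/existsP; apply: contraNT ab => /existsPn E; apply/eqP.
  by apply: eq_from_tnth => k; apply/eqP; rewrite eq_sym -[_ == _]negbK E.
by rewrite (bigD1 k) //= mxE (negbTE abk) mul0r scale0r.
Qed.

Lemma pullback_alternating n J (F : mindex n -> R^o) :
  Defs.alternating F -> Defs.alternating (pullback J F).
Proof.
move=> altF s b; rewrite /pullback scaler_sumr.
rewrite (reindex (perm_idx s)) /=; last first.
  exists (perm_idx s^-1%g) => a _; rewrite perm_idxM ?mulVg ?mulgV;
    by apply: eq_from_tnth => k; rewrite tnth_mktuple perm1.
apply: eq_bigr => a _; rewrite altF [RHS]scalerA mulrC -scalerA; congr (_ *: _).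
rewrite [RHS](reindex_inj (@perm_inj _ s)); apply: eq_bigr => k _.
by rewrite !tnth_mktuple.
Qed.

Definition epsR n (b : mindex n) : R^o := (eps b)%:~R.

Lemma epsR_alternating n : Defs.alternating (@epsR n).
Proof.
move=> s b; rewrite /epsR eps_perm /GRing.scale /= intrM; congr (_ * _).
by case: (odd_perm s); rewrite ?expr0 ?expr1 ?mulrN1z.
Qed.

(** By alternation the value at the increasing multi-index decides, and there the sum is the Leibniz
    formula for the determinant. *)
Lemma pullback_eps J (b : mindex 7) : pullback J (@epsR 7) b = \det J * epsR b.
Proof.
rewrite (alternating_eps _ (pullback_alternating J (@epsR_alternating 7))).
rewrite /GRing.scale /= mulrC; congr (_ * _).
transitivity (\sum_(a : mindex 7) (eps a)%:~R *:
    ((\prod_(k < 7) J k (tnth a k)) : R^o)).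
  apply: eq_bigr => a _; rewrite /GRing.scale /= mulrC; congr (_ * _).
  by apply: eq_bigr => k _; rewrite tnth_ord_tuple.
rewrite -sum_eps /determinant; apply: eq_bigr => s _; congr (_ * _).
by apply: eq_bigr => k _; rewrite tnth_mktuple tnth_ord_tuple.
Qed.

(** Moving the matrix from [F] onto [epsR] transposes it, after which [pullback_eps] applies. *)
Lemma sum_eps_pullback J (F : mindex 7 -> R^o) :
  \sum_(b : mindex 7) epsR b * pullback J F b =
  \det J * \sum_(a : mindex 7) epsR a * F a.
Proof.
under eq_bigr do rewrite /pullback mulr_sumr.
rewrite exchange_big /= mulr_sumr; apply: eq_bigr => a _.
rewrite mulrA -[\det J]det_tr -pullback_eps /pullback mulr_suml.
apply: eq_bigr => b _; rewrite /GRing.scale /= mulrA [epsR b * _]mulrC.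
by congr (_ * _ * _); apply: eq_bigr => k _; rewrite mxE.
Qed.

Lemma pullbackX p q J (F : mindex p -> R^o) (G : mindex q -> R^o)
    (b : mindex (p + q)) :
  pullback J F (left_idx b) * pullback J G (right_idx b) =
  pullback J (fun a => F (left_idx a) * G (right_idx a) : R^o) b.
Proof.
rewrite /pullback sum_mindexD mulr_suml; apply: eq_bigr => a1 _.
rewrite mulr_sumr; apply: eq_bigr => a2 _.
rewrite left_idx_cat right_idx_cat /GRing.scale /= big_split_ord /=.
rewrite mulrACA; congr (_ * _ * _); apply: eq_bigr => k _;
  by rewrite ?tnth_lshift ?tnth_rshift !tnth_mktuple.
Qed.

Lemma pullback_contract n J (F : mindex n.+1 -> R^o) (u : 'rV[R]_7)
    (b : mindex n) :
  \sum_(i < 7) u ord0 i * pullback J F [tuple of i :: b] =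
  pullback J (fun a => \sum_(l < 7) (u *m J) ord0 l * F [tuple of l :: a] : R^o) b.
Proof.
rewrite /pullback; under eq_bigr do rewrite sum_mindexS mulr_sumr.
under eq_bigr do under eq_bigr do rewrite mulr_sumr.
under [in RHS]eq_bigr do rewrite scaler_sumr.
rewrite exchange_big [in RHS]exchange_big /=; apply: eq_bigr => l _.
rewrite exchange_big /=; apply: eq_bigr => a _.
rewrite /GRing.scale /= mxE mulr_suml mulr_sumr; apply: eq_bigr => i _.
rewrite big_ord_recl !tnth0.
have -> : \prod_(k < n) J (tnth [tuple of i :: b] (lift ord0 k))
    (tnth [tuple of l :: a] (lift ord0 k)) = \prod_(k < n) J (tnth b k) (tnth a k).
  by apply: eq_bigr => k _; rewrite !tnthS.
by ring.
Qed.

End Multilinear.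

(** * Index sums of the standard forms and the metric they induce *)

Section Frames.
Variable R : realType.

Local Notation ph i j k := ((phiZ i j k)%:~R : R).
Local Notation ps i j k l := ((psiZ i j k l)%:~R : R).

Lemma sum_mindex2 (V : nmodType) (F : mindex 2 -> V) :
  \sum_(a : mindex 2) F a = \sum_(i < 7) \sum_(j < 7) F [tuple i; j].
Proof.
rewrite sum_mindexS; apply: eq_bigr => i _; rewrite sum_mindexS.
by apply: eq_bigr => j _; rewrite sum_mindex0; congr F; apply: val_inj.
Qed.

Lemma sum_mindex3 (V : nmodType) (F : mindex 3 -> V) :
  \sum_(a : mindex 3) F a =
  \sum_(i < 7) \sum_(j < 7) \sum_(k < 7) F [tuple i; j; k].
Proof.
rewrite sum_mindexS; apply: eq_bigr => i _; rewrite sum_mindex2.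
apply: eq_bigr => j _; apply: eq_bigr => k _; congr F; exact: val_inj.
Qed.

Lemma sum_mindex4 (V : nmodType) (F : mindex 4 -> V) :
  \sum_(a : mindex 4) F a =
  \sum_(i < 7) \sum_(j < 7) \sum_(k < 7) \sum_(l < 7) F [tuple i; j; k; l].
Proof.
rewrite sum_mindexS; apply: eq_bigr => i _; rewrite sum_mindex3.
apply: eq_bigr => j _; apply: eq_bigr => k _; apply: eq_bigr => l _.
by congr F; apply: val_inj.
Qed.

Lemma mindex4_eta (b : mindex 4) :
  exists i j k l, b = [tuple i; j; k; l].
Proof.
case/tupleP: b => i b; case/tupleP: b => j b; case/tupleP: b => k b.
case/tupleP: b => l b; rewrite (tuple0 b).
by exists i, j, k, l; apply: val_inj.
Qed.

Definition psi0 (b : mindex 4) : R^o :=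
  ps (nth ord0 b 0) (nth ord0 b 1) (nth ord0 b 2) (nth ord0 b 3).

Lemma phi_dual (b : mindex 4) :
  \sum_(a : mindex 3) phi0 R a * epsR R [tuple of a ++ b] = 6 * psi0 b.
Proof.
have [i [j [k [l ->]]]] := mindex4_eta b.
rewrite sum_mindex3 -psi_dual; apply: eq_bigr => a _; apply: eq_bigr => a' _.
by apply: eq_bigr => a'' _; rewrite phi0E; congr (_ * _); rewrite /epsR /eps.
Qed.

Lemma sgn_natN a b : sgn_nat a b = - sgn_nat b a.
Proof. by rewrite !sgn_natE -sgzN opprB. Qed.

(** Exchanging blocks of lengths 3 and 4 takes 12 transpositions, an even number. *)
Lemma eps_catC (a : mindex 3) (b : mindex 4) :
  epsR R [tuple of b ++ a] = epsR R [tuple of a ++ b].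
Proof.
have [i [j [k [l ->]]]] := mindex4_eta b.
have [i' [j' [k' ->]]] : exists i j k, a = [tuple i; j; k].
  case/tupleP: a => i' a; case/tupleP: a => j' a; case/tupleP: a => k' a.
  by rewrite (tuple0 a); exists i', j', k'; apply: val_inj.
rewrite /epsR /eps /= !mulr1; congr (_%:~R).
rewrite (sgn_natN i i') (sgn_natN i j') (sgn_natN i k').
rewrite (sgn_natN j i') (sgn_natN j j') (sgn_natN j k').
rewrite (sgn_natN k i') (sgn_natN k j') (sgn_natN k k').
rewrite (sgn_natN l i') (sgn_natN l j') (sgn_natN l k').
by ring.
Qed.

Definition contract0 (u : 'rV[R]_7) (a : mindex 2) : R^o :=
  \sum_(l < 7) u ord0 l * phi0 R [tuple of l :: a].

(** The constant is 144 = 6 * 24, from [phi_dual] and [phi_phi_psi]. It is cancelled by the 1/6 in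
    the definition of the metric and the 1/24 of [rwedge3_eps]. *)
Lemma metric0 (u v : 'rV[R]_7) :
  \sum_(a : mindex (2 + 2 + 3)) epsR R a *
    (contract0 u (left_idx (left_idx a)) * contract0 v (right_idx (left_idx a))
     * phi0 R (right_idx a))
  = 144 * \sum_(i < 7) u ord0 i * v ord0 i.
Proof.
rewrite (@sum_mindexD _ 4 3).
under eq_bigr => a _.
  under eq_bigr => b _.
    rewrite left_idx_cat right_idx_cat eps_catC mulrCA [epsR _ _ * _]mulrC.
    over.
  rewrite -mulr_sumr phi_dual.
  over.
rewrite sum_mindex4 mulr_sumr.
transitivity (\sum_(i < 7) \sum_(j < 7) 6 * (u ord0 i * v ord0 j) *
   (\sum_(a < 7) \sum_(b < 7) \sum_(c < 7) \sum_(d < 7)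
    ph i a b * ph j c d * ps a b c d)); last first.
  apply: eq_bigr => i _; rewrite (bigD1 i) //= [X in _ + X]big1 => [|j ji].
    by rewrite phi_phi_psi eqxx mulr1 addr0; ring.
  by rewrite phi_phi_psi eq_sym (negbTE ji) !mulr0.
(* The sums over [a], [b], [c], [d] are moved outside those over [i] and [j], one at a time. *)
under [RHS]eq_bigr do under eq_bigr do rewrite mulr_sumr.
under [RHS]eq_bigr do rewrite exchange_big /=.
rewrite [RHS]exchange_big /=; apply: eq_bigr => a _.
under [RHS]eq_bigr do under eq_bigr do rewrite mulr_sumr.
under [RHS]eq_bigr do rewrite exchange_big /=.
rewrite [RHS]exchange_big /=; apply: eq_bigr => b _.
under [RHS]eq_bigr do under eq_bigr do rewrite mulr_sumr.
under [RHS]eq_bigr do rewrite exchange_big /=.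
rewrite [RHS]exchange_big /=; apply: eq_bigr => c _.
under [RHS]eq_bigr do under eq_bigr do rewrite mulr_sumr.
under [RHS]eq_bigr do rewrite exchange_big /=.
rewrite [RHS]exchange_big /=; apply: eq_bigr => d _.
have -> : left_idx ([tuple a; b; c; d] : mindex (2 + 2)) = [tuple a; b].
  by apply: eq_from_tnth => -[[|[|]] //= kk]; rewrite tnth_mktuple.
have -> : right_idx ([tuple a; b; c; d] : mindex (2 + 2)) = [tuple c; d].
  by apply: eq_from_tnth => -[[|[|]] //= kk]; rewrite tnth_mktuple.
rewrite /contract0 /psi0 /= !mulr_suml; apply: eq_bigr => i _.
rewrite mulr_sumr mulr_suml; apply: eq_bigr => j _.
by rewrite -!phi0E; ring.
Qed.

End Frames.

(** * Frames adapted to a G2-structure *)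

Section FrameOfG2.
Variables (R : realType) (M : manifold7 R).
Implicit Types (c : atlas M) (x u v : 'rV[R]_7).

Lemma antisym_mulr n (F : mindex n -> R^o) (z : R) b :
  antisym F b * z = antisym (fun a => F a * z : R^o) b.
Proof.
rewrite /antisym /GRing.scale /= -mulrA mulr_suml; congr (_ * _).
by apply: eq_bigr => s _; rewrite mulrA.
Qed.

(** With the inner antisymmetrisation absorbed, the binomial factors and 1/7! leave 1 / (2! 2! 3!) =
    1/24. *)
Lemma rwedge3_eps (F G : tensor M R^o 2) (H : tensor M R^o 3) c x :
  rwedge (rwedge F G) H c x (ord_tuple 7) = 24^-1 *
  \sum_(a : mindex (2 + 2 + 3)) epsR R a *
    (F c x (left_idx (left_idx a)) * G c x (right_idx (left_idx a))
     * H c x (right_idx a)).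
Proof.
pose K (a : mindex (2 + 2)) (b : mindex 3) : R^o :=
  F c x (left_idx a) * G c x (right_idx a) * H c x b.
rewrite /rwedge /wedge.
rewrite (@eq_antisym _ _ _ _ (fun a => ((2 + 2)`!%:R / (2`!%:R * 2`!%:R)) *:
   antisym (fun a' => K a' (right_idx a)) (left_idx a))); last first.
  by move=> a; rewrite /GRing.scale /= -mulrA antisym_mulr.
rewrite antisymZ antisym_left /antisym (@sum_eps _ _ (fun a : mindex (2 + 2 + 3) =>
  K (left_idx a) (right_idx a))) /GRing.scale /= !mulrA; congr (_ * _).
rewrite -[(2 + 2 + 3)`!]/5040%N -[(2 + 2)`!]/24%N -[2`!]/2%N -[3`!]/6%N.
by field.
Qed.

Lemma inner_delta (g : tensor M R^o 2) c x i j :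
  inner g c x (delta_mx ord0 i) (delta_mx ord0 j) = g c x [tuple i; j].
Proof.
rewrite /inner (bigD1 i) //= [X in _ + X]big1 => [|k ki]; last first.
  rewrite big1 // => l _; rewrite !mxE (negbTE ki) andbF mulr0 mul0r //.
rewrite (bigD1 j) //= big1 => [|k kj]; last by rewrite !mxE (negbTE kj) andbF mulr0.
by rewrite !mxE (eqxx i) (eqxx j) /= !mulr1 !addr0.
Qed.

(** The columns of [A] are the coordinate components of a coframe, so [u *m A] lists the frame
    components of a vector [u]. The conditions say that the coframe is adapted to phi, orthonormal
    and oriented. *)
Definition frame (phi : tensor M R^o 3) (g : tensor M R^o 2)
    (vol : tensor M R^o 7) c x (A : 'M[R]_7) :=
  [/\ A \in unitmx, forall b, phi c x b = pullback A (phi0 R) b,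
      gmat g c x = A *m A^T &
      forall b, vol c x b = pullback A (@epsR R 7) b].

(* Evaluating the relation that defines the metric in the basis [A] gives
   g = l A A^T with l = det A / vol, and then vol^2 = det g forces l^9 = 1. *)
Lemma G2_frame phi g vol c x : G2_structure phi -> G2_metric phi g vol ->
  img c x -> exists A, frame phi g vol c x A.
Proof.
move=> [_ /(_ c x) H] [[_ _ gpos] [[_ altvol] vol2] gvol] Ux.
have [A Au phiA] := H Ux; exists A.
pose d := \det A; pose v0 := vol c x (ord_tuple 7).
have d0 : d != 0 by rewrite -unitfE -unitmxE.
have E u v : inner g c x u v * v0 = d * \sum_(i < 7) (u *m A) ord0 i * (v *m A) ord0 i.
  rewrite (gvol c x Ux u v (ord_tuple 7)) rwedge3_eps.
  pose F (a : mindex (2 + 2)) : R^o :=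
    contract0 (u *m A) (left_idx a) * contract0 (v *m A) (right_idx a).
  have contractE w (a : mindex 2) :
      Defs.contract w phi c x a = pullback A (contract0 (w *m A)) a.
    rewrite -pullback_contract.
    by apply: eq_bigr => i _; rewrite phiA.
  under eq_bigr => a _.
    rewrite !contractE phiA (pullbackX A (contract0 (u *m A)) (contract0 (v *m A))).
    rewrite (pullbackX A F (phi0 R)).
    over.
  by rewrite (@sum_eps_pullback _ A) metric0 -/d; field.
have v00 : v0 != 0.
  have := vol2 c x Ux; rewrite -/v0 => v02.
  (* On the vector whose frame components are the first unit vector, the right-hand side of [E] is
     [d], which is nonzero. *)
  apply/eqP => v00; have := E (delta_mx ord0 ord0 *m invmx A) (delta_mx ord0 ord0 *m invmx A).
  rewrite v00 mulr0 mulmxKV // => /esym/eqP; rewrite mulf_eq0 (negbTE d0) /=.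
  rewrite (bigD1 ord0) //= big1 => [|i i0]; last by rewrite !mxE (negbTE i0) mul0r.
  by rewrite !mxE !eqxx mulr1 addr0 oner_eq0.
pose l := d / v0.
have gE : gmat g c x = l *: (A *m A^T).
  apply/matrixP => i j; rewrite !mxE -(inner_delta g c x i j).
  have := E (delta_mx ord0 i) (delta_mx ord0 j) => /(canRL (mulfK v00)) ->.
  rewrite /l mulrAC; congr (_ * _); apply: eq_bigr => k _.
  by rewrite -!rowE !mxE.
have l0 : 0 < l.
  have := gpos c x Ux (delta_mx ord0 ord0 *m invmx A).
  have := E (delta_mx ord0 ord0 *m invmx A) (delta_mx ord0 ord0 *m invmx A).
  move=> /(canRL (mulfK v00)) ->; rewrite mulmxKV //.
  rewrite (bigD1 ord0) //= big1 => [|i i0]; last by rewrite !mxE (negbTE i0) mul0r.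
  rewrite !mxE !eqxx mulr1 addr0 mulr1; apply.
  apply/eqP => /(congr1 (mulmx^~ A)); rewrite mulmxKV // mul0mx.
  by move/matrixP/(_ ord0 ord0)/eqP; rewrite !mxE oner_eq0.
have l1 : l = 1.
  have := vol2 c x Ux; rewrite -/v0 gE detZ det_mulmx det_tr -/d => E2.
  have : l ^+ 9 = 1.
    (* The numerator is the determinant of [l *: (A *m A^T)] in dimension 7, which [E2] equates with
       [v0 ^+ 2]. *)
    rewrite /l in E2 *; have -> : (d / v0) ^+ 9 = (d / v0) ^+ 7 * (d * d) / v0 ^+ 2 by field.
    by rewrite -E2 divff // expf_neq0.
  by move/eqP; rewrite pexpr_eq1 ?ltW // => /eqP.
split => //; first by rewrite gE l1 scale1r.
move=> b; rewrite pullback_eps (alternating_eps b (altvol c x Ux)).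
rewrite /GRing.scale /= mulrC -/v0; congr (_ * _).
by move: l1; rewrite /l => /(canRL (mulfVK v00)); rewrite mul1r.
Qed.

Section Frame.
Variables (phi : tensor M R^o 3) (g : tensor M R^o 2) (vol : tensor M R^o 7).
Variables (c : atlas M) (x : 'rV[R]_7) (A : 'M[R]_7).
Hypothesis fA : frame phi g vol c x A.

Lemma frame_ginv : ginv g c x = (invmx A)^T *m invmx A.
Proof.
have [Au _ gA _] := fA; rewrite /ginv gA.
set X := (invmx A)^T *m invmx A; set G := A *m A^T.
have XG : X *m G = 1%:M.
  by rewrite /X /G mulmxA mulmxKV // -trmx_mul mulmxV // trmx1.
have Gu : G \in unitmx by case/mulmx1_unit: XG.
by rewrite -[LHS]mul1mx -XG mulmxK.
Qed.

(** Raising the indices of phi turns the pullback by [A] into one by the inverse transpose. This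
    cancels the factors of [A] that the volume form carries on the contracted indices and leaves the
    duality of [phi0] and [psi0]. *)
Lemma frame_psi (b : mindex 4) : G2_psi phi g vol c x b = pullback A (psi0 R) b.
Proof.
have [Au phiA gA volA] := fA.
rewrite /G2_psi /hodge /=.
have phiE (a : mindex 3) :
    pullback (ginv g c x) (phi c x) a = pullback (invmx A)^T (phi0 R) a.
  transitivity (pullback (ginv g c x) (pullback A (phi0 R)) a).
    by apply: eq_bigr => a' _; rewrite phiA.
  by rewrite pullbackM frame_ginv -mulmxA mulVmx // mulmx1.
have volE (a : mindex 3) : vol c x [tuple of a ++ b] =
    \sum_(e : mindex 3) \sum_(d : mindex 4)
      (\prod_(k < 7) A (tnth [tuple of a ++ b] k) (tnth [tuple of e ++ d] k))
      *: epsR R [tuple of e ++ d].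
  by rewrite volA; exact: (@sum_mindexD _ 3 4).
under eq_bigr do rewrite phiE volE mulr_sumr.
rewrite exchange_big mulr_sumr /=.
under eq_bigr do under eq_bigr do rewrite mulr_sumr.
under eq_bigr do rewrite exchange_big /=.
rewrite [RHS](_ : _ = \sum_(d : mindex 4) \sum_(e : mindex 3)
  (\prod_(k < 4) A (tnth b k) (tnth d k)) *
  (6^-1 * (phi0 R e * epsR R [tuple of e ++ d]))); last first.
  apply: eq_bigr => d _; rewrite -mulr_sumr -mulr_sumr phi_dual /GRing.scale /=.
  by congr (_ * _); field.
rewrite [RHS]exchange_big /=.
(* The cancellation on the three contracted indices: pulling back by [A^T] undoes the pullback by
   the transpose of its inverse. *)
have phi0E' (e : mindex 3) : \sum_(a : mindex 3) pullback (invmx A)^T (phi0 R) a *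
    \prod_(k < 3) A (tnth a k) (tnth e k) = phi0 R e.
  rewrite -[RHS](pullback1 (phi0 R)) -(trmx1 _ 7) -(mulVmx Au) trmx_mul -pullbackM.
  apply: eq_bigr => a _; rewrite /GRing.scale /= mulrC; congr (_ * _).
  by apply: eq_bigr => k _; rewrite mxE.
apply: eq_bigr => e _; rewrite mulr_sumr; apply: eq_bigr => d _.
rewrite -[phi0 R e]phi0E' mulr_suml !mulr_sumr; apply: eq_bigr => a _.
rewrite -[3`!]/6%N /GRing.scale /= (@big_split_ord _ _ _ 3 4) /=.
have -> : \prod_(k < 3) A (tnth [tuple of a ++ b] (lshift 4 k))
                          (tnth [tuple of e ++ d] (lshift 4 k))
   = \prod_(k < 3) A (tnth a k) (tnth e k).
  by apply: eq_bigr => k _; rewrite !tnth_lshift.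
have -> : \prod_(k < 4) A (tnth [tuple of a ++ b] (rshift 3 k))
                          (tnth [tuple of e ++ d] (rshift 3 k))
   = \prod_(k < 4) A (tnth b k) (tnth d k).
  by apply: eq_bigr => k _; rewrite !tnth_rshift.
by ring.
Qed.

End Frame.
End FrameOfG2.

(** * The standard octonions *)

Section StandardOctonions.
Variable R : realType.
Implicit Types (u v w t : 'rV[R]_7).

Local Notation ph i j k := ((phiZ i j k)%:~R : R).
Local Notation ps i j k l := ((psiZ i j k l)%:~R : R).
Local Notation delta i j := ((i == j)%:R : R).

Definition dot0 u v : R := \sum_(i < 7) u ord0 i * v ord0 i.

Definition cross0 u v : 'rV[R]_7 :=
  \row_k \sum_(i < 7) \sum_(j < 7) ph i j k * u ord0 i * v ord0 j.

(** The vector metrically dual to the 1-form psi0(t, u, v, .). *)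
Definition quad0 t u v : 'rV[R]_7 :=
  \row_k \sum_(e < 7) \sum_(i < 7) \sum_(j < 7)
    ps e i j k * t ord0 e * u ord0 i * v ord0 j.

Definition omul0 (X Y : octo R) : octo R :=
  (X.1 * Y.1 - dot0 X.2 Y.2,
   X.1 *: Y.2 + Y.1 *: X.2 + cross0 X.2 Y.2).

Lemma dot0C u v : dot0 u v = dot0 v u.
Proof. by apply: eq_bigr => i _; rewrite mulrC. Qed.

Lemma dot0Pl a u v w : dot0 (a *: u + v) w = a * dot0 u w + dot0 v w.
Proof.
by rewrite mulr_sumr -big_split; apply: eq_bigr => i _ /=; rewrite !mxE; ring.
Qed.

Lemma dot0Pr a u v w : dot0 w (a *: u + v) = a * dot0 w u + dot0 w v.
Proof. by rewrite dot0C dot0Pl !(dot0C w). Qed.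

Lemma cross0Pl a u v w : cross0 (a *: u + v) w = a *: cross0 u w + cross0 v w.
Proof.
apply/rowP => k; rewrite !mxE mulr_sumr -big_split; apply: eq_bigr => i _ /=.
rewrite mulr_sumr -big_split; apply: eq_bigr => j _ /=.
by rewrite !mxE; ring.
Qed.

Lemma cross0Pr a u v w : cross0 w (a *: u + v) = a *: cross0 w u + cross0 w v.
Proof.
apply/rowP => k; rewrite !mxE mulr_sumr -big_split; apply: eq_bigr => i _ /=.
rewrite mulr_sumr -big_split; apply: eq_bigr => j _ /=.
by rewrite !mxE; ring.
Qed.

Lemma dot0_cross u v w : dot0 (cross0 u v) w = dot0 u (cross0 v w).
Proof.
rewrite /dot0; under eq_bigr do rewrite mxE mulr_suml.
rewrite exchange_big; apply: eq_bigr => i _; rewrite mxE mulr_sumr /=.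
under eq_bigr do rewrite mulr_suml.
rewrite exchange_big; apply: eq_bigr => j _; rewrite mulr_sumr.
by apply: eq_bigr => k _; rewrite phi_cycle; ring.
Qed.

(** The left-hand side is the imaginary part of the associator of three imaginary octonions, so this
    is [phi_assoc] contracted with the three vectors. *)
Lemma cross0_assoc u v t :
  cross0 (cross0 u v) t + dot0 v t *: u - dot0 u v *: t - cross0 u (cross0 v t)
  = 2 *: quad0 t u v.
Proof.
apply/rowP => k; rewrite !mxE.
pose m e i j : R := t ord0 e * u ord0 i * v ord0 j.
transitivity (\sum_(e < 7) \sum_(i < 7) \sum_(j < 7)
   (\sum_(l < 7) ph i j l * ph l e k + delta j e * delta i k
    - delta i j * delta e k - \sum_(l < 7) ph j e l * ph i l k) * m e i j);
  last first.
  rewrite mulr_sumr; apply: eq_bigr => e _.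
  rewrite mulr_sumr; apply: eq_bigr => i _.
  rewrite mulr_sumr; apply: eq_bigr => j _.
  by rewrite phi_assoc /m; ring.
under [RHS]eq_bigr do under eq_bigr do under eq_bigr do
  rewrite !mulrDl !mulNr.
under [RHS]eq_bigr do under eq_bigr do rewrite !big_split !sumrN /=.
under [RHS]eq_bigr do rewrite !big_split !sumrN /=.
rewrite !big_split !sumrN /=; congr (_ + _ - _ - _).
- under eq_bigr do under eq_bigr do rewrite mxE mulr_sumr mulr_suml.
  rewrite exchange_big; apply: eq_bigr => e _ /=.
  rewrite exchange_big; apply: eq_bigr => i _ /=.
  under eq_bigr do rewrite mulr_sumr mulr_suml.
  rewrite exchange_big; apply: eq_bigr => j _ /=.
  by rewrite mulr_suml; apply: eq_bigr => l _; rewrite /m; ring.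
- rewrite /dot0 mulr_suml; under [RHS]eq_bigr do rewrite exchange_big /=.
  rewrite [RHS]exchange_big; apply: eq_bigr => e _ /=.
  rewrite (bigD1 e) //= [X in _ + X]big1 => [|j je]; last first.
    by rewrite big1 // => i _; rewrite eq_sym (negbTE je) !mul0r.
  rewrite (bigD1 k) //= [X in _ + X + _]big1 => [|i ik]; last first.
    by rewrite (negbTE ik) mulr0 mul0r.
  by rewrite !eqxx /m !mulr1n; ring.
- rewrite /dot0 mulr_suml exchange_big; apply: eq_bigr => i _ /=.
  rewrite (bigD1 k) //= [X in _ + X]big1 => [|j je]; last first.
    by rewrite big1 // => l _; rewrite (negbTE je) mulr0 mul0r.
  rewrite (bigD1 i) //= [X in _ + X + _]big1 => [|j ji]; last first.
    by rewrite eq_sym (negbTE ji) !mul0r.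
  by rewrite !eqxx /m !mulr1n; ring.
rewrite [RHS]exchange_big; apply: eq_bigr => i _ /=.
under eq_bigr do rewrite mxE mulr_sumr.
rewrite exchange_big [RHS]exchange_big; apply: eq_bigr => j _ /=.
under eq_bigr do rewrite mulr_sumr.
rewrite exchange_big; apply: eq_bigr => e _ /=.
by rewrite mulr_suml; apply: eq_bigr => l _; rewrite /m; ring.
Qed.

(** Real scalars associate with everything, so only imaginary parts matter. The real part of the
    result vanishes by the cyclic symmetry expressed in [dot0_cross]. *)
Lemma omul0_assoc (X Y : octo R) t :
  omul0 (omul0 X Y) (0, t) - omul0 X (omul0 Y (0, t)) =
  (0, 2 *: quad0 t X.2 Y.2).
Proof.
case: X Y => [a u] [b v]; rewrite -cross0_assoc /omul0 /=; congr (_, _).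
  rewrite -(addrA (a *: v)) !dot0Pl !scale0r !addr0 /= dot0Pr dot0_cross; ring.
rewrite /= !scale0r !addr0 -(addrA (a *: v)) !cross0Pl cross0Pr.
by apply/rowP => k; rewrite !mxE; ring.
Qed.

(* Contraction with psi0 turns the hypothesis into
   48 f = 3 * 4 * (W contracted with phi0). *)
Lemma cross0_defect (W : 'M[R]_7) (f : 'rV[R]_7) :
  (forall u v, cross0 u v *m W - cross0 (u *m W) v - cross0 u (v *m W)
               = 2 *: quad0 f u v) ->
  forall m, f ord0 m = 4^-1 * \sum_(k < 7) \sum_(l < 7) W l k * ph m k l.
Proof.
move=> H m.
(* The hypothesis at the basis vectors [i], [j] in component [k], ready to be contracted with
   [ps m i j k]. *)
have E (i j k : 'I_7) : \sum_(l < 7) ph i j l * W l k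
    - \sum_(l < 7) ph l j k * W i l - \sum_(l < 7) ph i l k * W j l
    = 2 * \sum_(e < 7) ps e i j k * f ord0 e.
  have c0E u v (n : 'I_7) : cross0 u v ord0 n =
      \sum_(a < 7) (\sum_(b < 7) ph a b n * v ord0 b) * u ord0 a.
    rewrite mxE; apply: eq_bigr => a _; rewrite mulr_suml.
    by apply: eq_bigr => b _; ring.
  have sumd (F : 'I_7 -> R) (n : 'I_7) :
      \sum_(a < 7) F a * (delta_mx ord0 n : 'rV[R]_7) ord0 a = F n.
    rewrite (bigD1 n) //= big1 => [|a an]; last by rewrite mxE (negbTE an) mulr0.
    by rewrite mxE !eqxx mulr1 addr0.
  have subE (u v w : 'rV[R]_7) (n : 'I_7) :
      (u - v - w) ord0 n = u ord0 n - v ord0 n - w ord0 n by rewrite !mxE.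
  have /(congr1 (fun w : 'rV[R]_7 => w ord0 k)) :=
    H (delta_mx ord0 i) (delta_mx ord0 j).
  rewrite subE !c0E -!rowE !sumd [_ ord0 k]mxE [X in _ = X]mxE [quad0 _ _ _ _ _]mxE.
  move=> Hk.
  transitivity (\sum_(l < 7) cross0 (delta_mx ord0 i) (delta_mx ord0 j) ord0 l * W l k
    - \sum_(a < 7) (\sum_(b < 7) ph a b k * (delta_mx ord0 j : 'rV[R]_7) ord0 b)
        * row i W ord0 a
    - \sum_(b < 7) ph i b k * row j W ord0 b).
    congr (_ - _ - _); apply: eq_bigr => l _.
    - by rewrite c0E !sumd.
    - by rewrite sumd mxE.
    - by rewrite mxE.
  rewrite Hk; congr (_ * _); apply: eq_bigr => e _.
  rewrite (bigD1 i) //= [X in _ + X]big1 => [|a ai]; last first.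
    by rewrite big1 // => b _; rewrite [_ ord0 a]mxE (negbTE ai) andbF mulr0 mul0r.
  rewrite (bigD1 j) //= [X in _ + X + _]big1 => [|b bj]; last first.
    by rewrite [_ ord0 b]mxE (negbTE bj) andbF mulr0.
  by rewrite !mxE !eqxx !mulr1 !addr0.
pose S := \sum_(k < 7) \sum_(l < 7) W l k * ph m k l.
(* 48 = 2 * 24: the 2 is that of the associator, the 24 comes from [psi_psi]. *)
have F1 : 48 * f ord0 m =
    \sum_(i < 7) \sum_(j < 7) \sum_(k < 7) ps m i j k *
      (2 * \sum_(e < 7) ps e i j k * f ord0 e).
  transitivity (2 * \sum_(e < 7) (\sum_(i < 7) \sum_(j < 7) \sum_(k < 7)
     ps m i j k * ps e i j k) * f ord0 e).
    rewrite (bigD1 m) //= [X in _ * (_ + X)]big1 => [|e em]; last first.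
      by rewrite psi_psi eq_sym (negbTE em) mulr0 mul0r.
    by rewrite psi_psi eqxx mulr1 addr0; ring.
  rewrite mulr_sumr; under eq_bigr do rewrite mulr_suml mulr_sumr.
  rewrite exchange_big; apply: eq_bigr => i _ /=.
  under eq_bigr do rewrite mulr_suml mulr_sumr.
  rewrite exchange_big; apply: eq_bigr => j _ /=.
  under eq_bigr do rewrite mulr_suml mulr_sumr.
  rewrite exchange_big; apply: eq_bigr => k _ /=.
  by rewrite !mulr_sumr; apply: eq_bigr => e _; ring.
have S1 : \sum_(i < 7) \sum_(j < 7) \sum_(k < 7) ps m i j k *
    (\sum_(l < 7) ph i j l * W l k) = 4 * S.
  rewrite /S mulr_sumr; under eq_bigr do rewrite exchange_big /=.
  rewrite exchange_big; apply: eq_bigr => k _ /=.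
  under eq_bigr do under eq_bigr do rewrite mulr_sumr.
  under eq_bigr do rewrite exchange_big /=.
  rewrite exchange_big mulr_sumr; apply: eq_bigr => l _ /=.
  rewrite mulrCA; have [<- _ _] := psi_phi R m k l.
  rewrite mulr_sumr; apply: eq_bigr => i _; rewrite mulr_sumr.
  by apply: eq_bigr => j _; ring.
(* The two terms where [W] acts on a factor produce the indices of [W] in the opposite order;
   antisymmetry of phi turns this into a sign. *)
have SN : - S = \sum_(i < 7) \sum_(l < 7) W i l * ph m i l.
  rewrite /S exchange_big -sumrN; apply: eq_bigr => i _ /=; rewrite -sumrN.
  by apply: eq_bigr => l _; rewrite [ph m l i]phi_swap phi_cycle; ring.
have S2 : \sum_(i < 7) \sum_(j < 7) \sum_(k < 7) ps m i j k *
    (\sum_(l < 7) ph l j k * W i l) = 4 * - S.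
  rewrite SN mulr_sumr; apply: eq_bigr => i _ /=.
  under eq_bigr do under eq_bigr do rewrite mulr_sumr.
  under eq_bigr do rewrite exchange_big /=.
  rewrite exchange_big mulr_sumr; apply: eq_bigr => l _ /=.
  rewrite mulrCA; have [_ <- _] := psi_phi R m i l.
  rewrite mulr_sumr; apply: eq_bigr => j _; rewrite mulr_sumr.
  by apply: eq_bigr => k _; ring.
have S3 : \sum_(i < 7) \sum_(j < 7) \sum_(k < 7) ps m i j k *
    (\sum_(l < 7) ph i l k * W j l) = 4 * - S.
  rewrite SN mulr_sumr exchange_big; apply: eq_bigr => j _ /=.
  under eq_bigr do under eq_bigr do rewrite mulr_sumr.
  under eq_bigr do rewrite exchange_big /=.
  rewrite exchange_big mulr_sumr; apply: eq_bigr => l _ /=.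
  rewrite mulrCA; have [_ _ <-] := psi_phi R m j l.
  rewrite mulr_sumr; apply: eq_bigr => i _; rewrite mulr_sumr.
  by apply: eq_bigr => k _; ring.
(* 12 S = 4 S - (-4 S) - (-4 S), one summand for each term of the defect. *)
suff : 48 * f ord0 m = 12 * S by rewrite -/S; lra.
rewrite F1.
under eq_bigr do under eq_bigr do under eq_bigr do rewrite -E !mulrBr.
under eq_bigr do under eq_bigr do rewrite !sumrB.
under eq_bigr do rewrite !sumrB.
by rewrite !sumrB S1 S2 S3; ring.
Qed.

End StandardOctonions.

(** * The octonion product at a point, read in a frame *)

Section FrameOctonions.
Variables (R : realType) (M : manifold7 R).
Variables (phi : tensor M R^o 3) (g : tensor M R^o 2) (vol : tensor M R^o 7).
Variables (c : atlas M) (x : 'rV[R]_7) (A : 'M[R]_7).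
Hypothesis fA : frame phi g vol c x A.
Implicit Types (u v t : 'rV[R]_7) (X Y : octo R).

Local Notation ph i j k := ((phiZ i j k)%:~R : R).
Local Notation ps i j k l := ((psiZ i j k l)%:~R : R).

Let Au : A \in unitmx. Proof. by have [] := fA. Qed.

Lemma pullback_mindex1 (F : mindex 1 -> R^o) (l : 'I_7) :
  pullback A F [tuple l] = \sum_(k < 7) F [tuple k] * A l k.
Proof.
rewrite /pullback sum_mindexS; apply: eq_bigr => k _; rewrite sum_mindex0.
by rewrite big_ord1 !(tnth_nth ord0) /GRing.scale /= mulrC; congr (F _ * _); apply: val_inj.
Qed.

Lemma frame_inner u v : inner g c x u v = dot0 (u *m A) (v *m A).
Proof.
have [_ _ gA _] := fA.
have -> : inner g c x u v = (u *m gmat g c x *m v^T) ord0 ord0.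
  rewrite mxE /inner exchange_big; apply: eq_bigr => j _ /=.
  by rewrite !mxE mulr_suml; apply: eq_bigr => i _; rewrite !mxE; ring.
rewrite gA mulmxA -mulmxA -trmx_mul mxE; apply: eq_bigr => i _.
by rewrite [_^T _ _]mxE.
Qed.

Lemma frame_phi u v (l : 'I_7) :
  \sum_(i < 7) \sum_(j < 7) phi c x [tuple i; j; l] * u ord0 i * v ord0 j =
  \sum_(k < 7) cross0 (u *m A) (v *m A) ord0 k * A l k.
Proof.
have [_ phiA _ _] := fA.
transitivity (pullback A (fun b : mindex 1 => \sum_(j < 7) (v *m A) ord0 j *
    (\sum_(i < 7) (u *m A) ord0 i * phi0 R [tuple of i :: [tuple of j :: b]]) : R^o)
    [tuple l]).
  rewrite -(pullback_contract A (fun b : mindex 2 =>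
     \sum_(i < 7) (u *m A) ord0 i * phi0 R [tuple of i :: b] : R^o)).
  rewrite exchange_big; apply: eq_bigr => j _ /=.
  rewrite -pullback_contract mulr_sumr; apply: eq_bigr => i _.
  rewrite -phiA (_ : [tuple of i :: _] = [tuple i; j; l]); last exact: val_inj.
  by ring.
rewrite pullback_mindex1; apply: eq_bigr => k _; congr (_ * _); rewrite [RHS]mxE.
rewrite exchange_big; apply: eq_bigr => j _ /=; rewrite mulr_sumr.
apply: eq_bigr => i _; rewrite -phi0E.
rewrite (_ : [tuple of i :: _] = [tuple i; j; k]); last exact: val_inj.
by ring.
Qed.

Lemma frame_quad t u v (l : 'I_7) :
  \sum_(e < 7) \sum_(i < 7) \sum_(j < 7)
    G2_psi phi g vol c x [tuple e; i; j; l] * t ord0 e * u ord0 i * v ord0 j =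
  \sum_(k < 7) quad0 (t *m A) (u *m A) (v *m A) ord0 k * A l k.
Proof.
transitivity (pullback A (fun b : mindex 1 => \sum_(j < 7) (v *m A) ord0 j *
    (\sum_(i < 7) (u *m A) ord0 i * (\sum_(e < 7) (t *m A) ord0 e *
       psi0 R [tuple of e :: [tuple of i :: [tuple of j :: b]]])) : R^o) [tuple l]).
  rewrite -(pullback_contract A (fun b : mindex 2 =>
     \sum_(i < 7) (u *m A) ord0 i * (\sum_(e < 7) (t *m A) ord0 e *
        psi0 R [tuple of e :: [tuple of i :: b]]) : R^o)).
  under eq_bigr do rewrite exchange_big /=.
  rewrite exchange_big; apply: eq_bigr => j _ /=.
  rewrite -(pullback_contract A (fun b : mindex 3 => \sum_(e < 7) (t *m A) ord0 e *
        psi0 R [tuple of e :: b] : R^o)).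
  rewrite exchange_big mulr_sumr; apply: eq_bigr => i _ /=.
  rewrite -pullback_contract !mulr_sumr; apply: eq_bigr => e _.
  rewrite -(frame_psi fA) (_ : [tuple of e :: _] = [tuple e; i; j; l]); last exact: val_inj.
  by ring.
rewrite pullback_mindex1; apply: eq_bigr => k _; congr (_ * _); rewrite [RHS]mxE.
under [RHS]eq_bigr do rewrite exchange_big /=.
rewrite [RHS]exchange_big; apply: eq_bigr => j _ /=; rewrite mulr_sumr.
rewrite [RHS]exchange_big; apply: eq_bigr => i _ /=; rewrite !mulr_sumr.
apply: eq_bigr => e _; rewrite /psi0 /=.
by ring.
Qed.

Definition raise (F : 'I_7 -> R) : 'rV[R]_7 :=
  \row_k \sum_(l < 7) ginv g c x k l * F l.

(** In an orthonormal frame raising an index changes nothing: the vector has the same frame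
    components [w] as the covector. *)
Lemma frame_raise (w : 'rV[R]_7) (F : 'I_7 -> R) :
  (forall l, F l = \sum_(k < 7) w ord0 k * A l k) -> raise F *m A = w.
Proof.
move=> FE.
have -> : raise F = w *m A^T *m (ginv g c x)^T.
  apply/rowP => k; rewrite !mxE; apply: eq_bigr => l _.
  rewrite FE !mxE mulrC; congr (_ * _); apply: eq_bigr => m _.
  by rewrite [_^T _ _]mxE.
rewrite (frame_ginv fA) trmx_mul trmxK !mulmxA.
rewrite -(mulmxA w) -trmx_mul mulVmx // trmx1 mulmx1.
by rewrite -mulmxA mulVmx // mulmx1.
Qed.

(** Passage to frame components, an isomorphism onto the standard octonions by [frame_omul] and
    [push_inj]. *)
Definition push (X : octo R) : octo R := (X.1, X.2 *m A).

Lemma push_inj : injective push.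
Proof.
move=> [a u] [b v] [-> /(congr1 (mulmx^~ (invmx A)))].
by rewrite !mulmxK // => ->.
Qed.

Lemma frame_omul X Y : push (omul phi g c x X Y) = omul0 (push X) (push Y).
Proof.
rewrite /push /omul /omul0 /= frame_inner; congr (_, _).
rewrite !mulmxDl !scalemxAl; congr (_ + _).
by apply: frame_raise => l; rewrite frame_phi.
Qed.

Lemma pushB X Y : push (X - Y) = push X - push Y.
Proof. by rewrite /push /= mulmxBl. Qed.

Lemma omul_assoc X Y t :
  omul phi g c x (omul phi g c x X Y) (0, t)
  - omul phi g c x X (omul phi g c x Y (0, t)) =
  (0, 2 *: raise (fun l => \sum_(e < 7) \sum_(i < 7) \sum_(j < 7)
    G2_psi phi g vol c x [tuple e; i; j; l] * t ord0 e * X.2 ord0 i * Y.2 ord0 j)).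
Proof.
apply: push_inj; rewrite pushB !frame_omul.
rewrite [push (0, t)]/push omul0_assoc /push /= -scalemxAl; congr (_, _ *: _).
by rewrite (@frame_raise (quad0 (t *m A) (X.2 *m A) (Y.2 *m A))) // => l; exact: frame_quad.
Qed.

End FrameOctonions.

(** * Functions differentiable on an open set *)

Section TwiceDifferentiable.
Variables (R : realType) (U : set 'rV[R]_7).
Hypothesis oU : open U.
Implicit Types (f h : 'rV[R]_7 -> R^o) (x : 'rV[R]_7).

Definition diff_on f := forall x, U x -> differentiable f x.

(** Just the regularity needed to commute two derivatives. Stability under products takes a single
    use of the Leibniz rule, with no induction over iterated partials. *)
Definition diff2_on f := diff_on f /\ forall i, diff_on (partial i f).

Lemma near_open x (P : 'rV[R]_7 -> Prop) : U x -> (forall y, U y -> P y) ->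
  \forall y \near x, P y.
Proof.
by move=> Ux UP; apply: filterS UP _; exact: (open_nbhs_nbhs (conj oU Ux)).
Qed.

Lemma partial_eqU i f h x : U x -> (forall y, U y -> f y = h y) ->
  partial i f x = partial i h x.
Proof. by move=> Ux fh; apply: partial_near; exact: near_open. Qed.

Lemma diff_on_eq f h : (forall y, U y -> f y = h y) -> diff_on f -> diff_on h.
Proof.
move=> fh df x Ux; apply: (differentiable_near _ (df x Ux)); exact: near_open.
Qed.

Lemma diff_onD f h : diff_on f -> diff_on h -> diff_on (fun y => f y + h y).
Proof. by move=> df dh x Ux; apply: differentiable_add; [exact: df|exact: dh]. Qed.

Lemma diff_onN f : diff_on f -> diff_on (fun y => - f y).
Proof. by move=> df x Ux; apply: differentiable_opp; exact: df. Qed.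

Lemma diff_onB f h : diff_on f -> diff_on h -> diff_on (fun y => f y - h y).
Proof. by move=> df dh x Ux; apply: differentiable_sub; [exact: df|exact: dh]. Qed.

Lemma diff_onM f h : diff_on f -> diff_on h -> diff_on (fun y => f y * h y).
Proof. by move=> df dh x Ux; apply: differentiable_mul; [exact: df|exact: dh]. Qed.

Lemma diff_onc (a : R) : diff_on (fun=> a).
Proof. by move=> x _; exact: differentiable_const. Qed.

Lemma diff_onsum n (F : 'I_n -> 'rV[R]_7 -> R^o) :
  (forall k, diff_on (F k)) -> diff_on (fun y => \sum_(k < n) F k y).
Proof. by move=> dF x Ux; apply: differentiable_bigsum => k; exact: dF. Qed.

Lemma diff_onprod n (F : 'I_n -> 'rV[R]_7 -> R^o) :
  (forall k, diff_on (F k)) -> diff_on (fun y => \prod_(k < n) F k y : R).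
Proof.
elim: n F => [|n IH] F dF.
  by apply: (@diff_on_eq (fun=> 1)) (diff_onc 1) => y _; rewrite big_ord0.
apply: (@diff_on_eq (fun y => F ord0 y * \prod_(k < n) F (lift ord0 k) y)).
  by move=> y _; rewrite big_ord_recl.
by apply: diff_onM => //; apply: IH => k; exact: dF.
Qed.

Lemma diff_ondet n (N : 'rV[R]_7 -> 'M[R]_n) :
  (forall i j, diff_on (fun y => N y i j)) -> diff_on (fun y => \det (N y)).
Proof.
move=> dN; rewrite /determinant; elim: (index_enum _) => [|s r IH].
  by apply: (@diff_on_eq (fun=> 0)) (diff_onc 0) => y _; exact/esym/big_nil.
apply: (@diff_on_eq (fun y => (-1) ^+ s * \prod_(i < n) N y i (s i) +
    \sum_(t <- r) (-1) ^+ t * \prod_(i < n) N y i (t i))).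
  by move=> y _; rewrite big_cons.
by apply: diff_onD => //; apply: diff_onM; [exact: diff_onc|apply: diff_onprod].
Qed.

Lemma diff_onV f : (forall x, U x -> f x != 0) -> diff_on f -> diff_on (fun y => (f y)^-1 : R).
Proof. by move=> f0 df x Ux; apply: differentiableV; [exact: df|exact: f0]. Qed.

(** By Cramer's rule the entries of the inverse are polynomials in the entries divided by the
    determinant. *)
Lemma diff_oninvmx (N : 'rV[R]_7 -> 'M[R]_7) :
  (forall x, U x -> N x \in unitmx) ->
  (forall i j, diff_on (fun y => N y i j)) ->
  forall i j, diff_on (fun y => invmx (N y) i j).
Proof.
move=> uN dN i j.
apply: (@diff_on_eq (fun y => (\det (N y))^-1 * \adj (N y) i j)).
  by move=> y Uy; rewrite /invmx uN // [RHS]mxE.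
apply: diff_onM.
  apply: diff_onV; last exact: diff_ondet.
  by move=> x Ux; rewrite -unitfE -unitmxE uN.
apply: (@diff_on_eq (fun y => (-1) ^+ (j + i) * \det (row' j (col' i (N y))))).
  by move=> y _; rewrite mxE.
apply: diff_onM; first exact: diff_onc.
apply: diff_ondet => k l; apply: (@diff_on_eq (fun y => N y (lift j k) (lift i l))) => //.
by move=> y _; rewrite !mxE.
Qed.

Lemma smooth_diff2_on f : smooth_on U f -> diff2_on f.
Proof. by move=> sf; split=> [x Ux|i x Ux]; [exact: (sf [::])|exact: (sf [:: i])]. Qed.

Lemma diff2_on_eq f h : (forall y, U y -> f y = h y) -> diff2_on f -> diff2_on h.
Proof.
move=> fh [df ddf]; split=> [|i]; first exact: diff_on_eq df.
by apply: diff_on_eq (ddf i) => y Uy; exact: partial_eqU.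
Qed.

Lemma diff2_onc (a : R) : diff2_on (fun=> a).
Proof.
split=> [|i]; first exact: diff_onc.
by apply: (@diff_on_eq (fun=> 0)) (diff_onc 0) => y _; rewrite partial_cst.
Qed.

Lemma diff2_onD f h : diff2_on f -> diff2_on h -> diff2_on (fun y => f y + h y).
Proof.
move=> [df ddf] [dh ddh]; split=> [|i]; first exact: diff_onD.
apply: (@diff_on_eq (fun y => partial i f y + partial i h y)).
  by move=> y Uy; rewrite partialD //; [exact: df|exact: dh].
exact: diff_onD.
Qed.

Lemma diff2_onM f h : diff2_on f -> diff2_on h -> diff2_on (fun y => f y * h y).
Proof.
move=> [df ddf] [dh ddh]; split=> [|i]; first exact: diff_onM.
apply: (@diff_on_eq (fun y => partial i f y * h y + f y * partial i h y)).
  by move=> y Uy; rewrite partialM //; [exact: df|exact: dh].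
by apply: diff_onD; apply: diff_onM.
Qed.

Lemma diff2_onsum n (F : 'I_n -> 'rV[R]_7 -> R^o) :
  (forall k, diff2_on (F k)) -> diff2_on (fun y => \sum_(k < n) F k y).
Proof.
move=> dF; split=> [|i]; first by apply: diff_onsum => k; exact: (dF k).1.
apply: (@diff_on_eq (fun y => \sum_(k < n) partial i (F k) y)).
  by move=> y Uy; rewrite partial_sum // => k; exact: (dF k).1.
by apply: diff_onsum => k; exact: (dF k).2.
Qed.

Lemma partial_sum2M i n m (F : 'I_n -> 'I_m -> 'rV[R]_7 -> R^o)
    (p : 'I_n -> 'rV[R]_7 -> R^o) (q : 'I_m -> 'rV[R]_7 -> R^o) x :
  (forall k l, differentiable (F k l) x) -> (forall k, differentiable (p k) x) ->
  (forall l, differentiable (q l) x) ->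
  partial i (fun y => \sum_(k < n) \sum_(l < m) F k l y * p k y * q l y) x =
  \sum_(k < n) \sum_(l < m) (partial i (F k l) x * p k x * q l x
    + F k l x * partial i (p k) x * q l x + F k l x * p k x * partial i (q l) x).
Proof.
move=> dF dp dq; rewrite partial_sum; last first.
  by move=> k; apply: differentiable_bigsum => l; do !apply: differentiable_mul.
apply: eq_bigr => k _; rewrite partial_sum; last by move=> l; do !apply: differentiable_mul.
apply: eq_bigr => l _; rewrite partialM //; last exact: differentiable_mul.
by rewrite partialM //; ring.
Qed.

Lemma partial_sumM i n (p q : 'I_n -> 'rV[R]_7 -> R^o) x :
  (forall k, differentiable (p k) x) -> (forall k, differentiable (q k) x) ->
  partial i (fun y => \sum_(k < n) p k y * q k y) x =
  \sum_(k < n) (partial i (p k) x * q k x + p k x * partial i (q k) x).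
Proof.
move=> dp dq; rewrite partial_sum => [|k]; last exact: differentiable_mul.
by apply: eq_bigr => k _; rewrite partialM.
Qed.

End TwiceDifferentiable.

(** * The Levi-Civita connection in a chart *)

Section ChartGeometry.
Variables (R : realType) (M : manifold7 R).
Variables (phi : tensor M R^o 3) (g : tensor M R^o 2) (vol : tensor M R^o 7).
Variable T : tensor M R^o 2.
Hypotheses (hphi : G2_structure phi) (hg : G2_metric phi g vol)
  (hT : is_torsion phi g vol T).
Variable c : atlas M.
Implicit Types (x y : 'rV[R]_7) (i j k l m n : 'I_7).

Local Notation U := (img c).
Local Notation G i j := (fun y : 'rV[R]_7 => g c y [tuple i; j]).
Local Notation Gi k l := (fun y : 'rV[R]_7 => ginv g c y k l).
Local Notation Ga k i j := (fun y : 'rV[R]_7 => christoffel g c y k i j).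
Local Notation Ph i j k := (fun y : 'rV[R]_7 => phi c y [tuple i; j; k]).

Lemma open_img : open U. Proof. exact: img_open. Qed.

Lemma frame_exists x : U x -> exists A, frame phi g vol c x A.
Proof. exact: G2_frame. Qed.

Lemma gmat_unit x : U x -> gmat g c x \in unitmx.
Proof.
by move=> /frame_exists[A [Au _ -> _]]; rewrite unitmx_mul unitmx_tr Au.
Qed.

Lemma metric_sym x i j : U x -> g c x [tuple i; j] = g c x [tuple j; i].
Proof.
by move=> Ux; case: hg => -[_ gs _] _ _; rewrite -!inner_delta gs.
Qed.

Lemma metric_ginv x i k : U x ->
  \sum_(j < 7) g c x [tuple i; j] * ginv g c x j k = (i == k)%:R.
Proof.
move=> Ux; have /matrixP/(_ i k) := mulmxV (gmat_unit Ux); rewrite !mxE => <-.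
by apply: eq_bigr => j _; rewrite mxE.
Qed.

Lemma ginv_metric x i k : U x ->
  \sum_(j < 7) ginv g c x i j * g c x [tuple j; k] = (i == k)%:R.
Proof.
move=> Ux; have /matrixP/(_ i k) := mulVmx (gmat_unit Ux); rewrite !mxE => <-.
by apply: eq_bigr => j _; rewrite mxE.
Qed.

Lemma sum_delta (F : 'I_7 -> R) i : \sum_(k < 7) (i == k)%:R * F k = F i.
Proof.
rewrite (bigD1 i) //= big1 => [|k ki]; last by rewrite eq_sym (negbTE ki) mul0r.
by rewrite eqxx mul1r addr0.
Qed.

Lemma metric_raise x (a : 'I_7 -> R) n : U x ->
  \sum_(k < 7) g c x [tuple n; k] * (\sum_(l < 7) ginv g c x k l * a l) = a n.
Proof.
move=> Ux; under eq_bigr do rewrite mulr_sumr.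
rewrite exchange_big /= -[RHS]sum_delta; apply: eq_bigr => l _.
rewrite -(metric_ginv _ _ Ux) mulr_suml; apply: eq_bigr => k _; exact: mulrA.
Qed.

(** Allows an identity to be proved after lowering an index, where differentiation meets [g] instead
    of its inverse. *)
Lemma metric_inj x (a b : 'I_7 -> R) : U x ->
  (forall n, \sum_(k < 7) g c x [tuple n; k] * a k =
             \sum_(k < 7) g c x [tuple n; k] * b k) -> forall k, a k = b k.
Proof.
move=> Ux ab k; suff E (d : 'I_7 -> R) :
    \sum_(n < 7) ginv g c x k n * (\sum_(l < 7) g c x [tuple n; l] * d l) = d k.
  by rewrite -[LHS]E -[RHS]E; apply: eq_bigr => n _; rewrite ab.
under eq_bigr do rewrite mulr_sumr.
rewrite exchange_big /= -[RHS]sum_delta; apply: eq_bigr => l _.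
rewrite -(ginv_metric _ _ Ux) mulr_suml; apply: eq_bigr => n _; exact: mulrA.
Qed.

Lemma diff2_on_metric i j : diff2_on U (G i j).
Proof. by case: hg => -[[sg _] _ _] _ _; apply: smooth_diff2_on; exact: sg. Qed.

Lemma diff2_on_phi i j k : diff2_on U (Ph i j k).
Proof. by case: hphi => -[[sp _] _] _; apply: smooth_diff2_on; exact: sp. Qed.

Lemma diff_on_ginv k l : diff_on U (Gi k l).
Proof.
apply: (diff_oninvmx open_img) => [x|i j]; first exact: gmat_unit.
apply: (diff_on_eq open_img _ (diff2_on_metric i j).1) => y _; by rewrite mxE.
Qed.

(** Differentiate the product of the metric and its inverse, which is constant. *)
Lemma partial_ginv m k l x : U x -> partial m (Gi k l) x =
  - \sum_(a < 7) \sum_(b < 7)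
      Gi k a x * partial m (G a b) x * Gi b l x.
Proof.
move=> Ux; have dGi a b := diff_on_ginv a b Ux; have dG a b := (diff2_on_metric a b).1 _ Ux.
move: k; apply: (metric_inj Ux) => n.
have : partial m (fun y => \sum_(k < 7) G n k y * Gi k l y) x = 0.
  rewrite (@partial_eqU _ _ open_img _ _ (fun=> (n == l)%:R)) ?partial_cst // => y Uy.
  exact: metric_ginv.
rewrite (partial_sumM _ (fun k => dG n k) (fun k => dGi k l)) big_split /=.
move=> /(canRL (addKr _)) ->; rewrite addr0.
under [RHS]eq_bigr do rewrite mulrN.
rewrite [RHS]sumrN; congr (- _).
pose h a := \sum_(b < 7) partial m (G a b) x * Gi b l x.
transitivity (h n) => //.
rewrite -[LHS](metric_raise _ _ Ux); apply: eq_bigr => k _; congr (_ * _).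
apply: eq_bigr => a _; rewrite /h mulr_sumr; apply: eq_bigr => b _.
exact: mulrA.
Qed.

(** [partial_ginv] expresses the partials through functions already known to be differentiable. *)
Lemma diff2_on_ginv k l : diff2_on U (Gi k l).
Proof.
split=> [|m]; first exact: diff_on_ginv.
apply: (@diff_on_eq _ _ open_img (fun x => - \sum_(a < 7) \sum_(b < 7)
      Gi k a x * partial m (G a b) x * Gi b l x)).
  by move=> x Ux; rewrite partial_ginv.
apply: diff_onN; apply: diff_onsum => a; apply: diff_onsum => b.
apply: diff_onM; last exact: diff_on_ginv.
by apply: diff_onM; [exact: diff_on_ginv|exact: (diff2_on_metric a b).2].
Qed.

Lemma christoffel_sym k i j x : U x -> Ga k i j x = Ga k j i x.
Proof.
move=> Ux; congr (_ * _); apply: eq_bigr => l _; congr (_ * _).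
rewrite [partial l _ _](@partial_eqU _ _ open_img _ _ (G j i)) //.
  by congr (_ - _); rewrite addrC.
by move=> y Uy; exact: metric_sym.
Qed.

Lemma diff_on_christoffel k i j : diff_on U (Ga k i j).
Proof.
apply: diff_onM; first exact: diff_onc.
apply: diff_onsum => l; apply: diff_onM; first exact: diff_on_ginv.
apply: diff_onB; last exact: (diff2_on_metric i j).2.
by apply: diff_onD; [exact: (diff2_on_metric j l).2|exact: (diff2_on_metric i l).2].
Qed.

Lemma christoffel_low n i j x : U x ->
  \sum_(k < 7) g c x [tuple n; k] * Ga k i j x =
  2^-1 * (partial i (G j n) x + partial j (G i n) x - partial n (G i j) x).
Proof.
move=> Ux; under eq_bigr do rewrite /christoffel mulrCA.
by rewrite -mulr_sumr metric_raise.
Qed.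

(** This is nabla g = 0: in the sum of the two lowered Christoffel symbols the other partial
    derivatives cancel. *)
Lemma metric_compat m i j x : U x -> partial m (G i j) x =
  \sum_(l < 7) (Ga l m i x * G l j x + Ga l m j x * G i l x).
Proof.
move=> Ux.
have Es a b : partial m (G a b) x = partial m (G b a) x.
  by apply: (partial_eqU open_img _ Ux) => y Uy; exact: metric_sym.
rewrite big_split /=.
have -> : \sum_(l < 7) Ga l m i x * G l j x = \sum_(l < 7) G j l x * Ga l m i x.
  by apply: eq_bigr => l _; rewrite mulrC metric_sym.
have -> : \sum_(l < 7) Ga l m j x * G i l x = \sum_(l < 7) G i l x * Ga l m j x.
  by apply: eq_bigr => l _; rewrite mulrC.
rewrite !christoffel_low // (Es j i).
by field.
Qed.

Lemma nabla3 (w : tensor M R^o 3) m i j k x :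
  nabla g w c x [tuple m; i; j; k] =
  partial m (fun y => w c y [tuple i; j; k]) x
  - \sum_(e < 7) (Ga e m i x * w c x [tuple e; j; k]
      + Ga e m j x * w c x [tuple i; e; k]
      + Ga e m k x * w c x [tuple i; j; e]).
Proof.
have tE : tail_idx [tuple m; i; j; k] = [tuple i; j; k] by exact: val_inj.
have sum3 (F : 'I_3 -> R) : \sum_(k < 3) F k =
    F ord0 + F (lift ord0 ord0) + F (lift ord0 (lift ord0 ord0)).
  by rewrite !big_ord_recl big_ord0 addr0 addrA.
rewrite /nabla !tE sum3 !big_split /=.
congr (_ - (_ + _ + _)); apply: eq_bigr => e _; congr (_ * w c x _);
  by apply: eq_from_tnth => -[[|[|[|]]] //= ?]; rewrite tnth_mktuple.
Qed.

End ChartGeometry.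

(** * The Leibniz rule for the octonion product *)

Section Bilinear.
Variable R : realType.
Implicit Types (F : 'I_7 -> 'I_7 -> R) (u v : 'I_7 -> R).

Definition bil F u v : R := \sum_(i < 7) \sum_(j < 7) F i j * u i * v j.

Lemma eq_bil F F' u u' v v' : (forall i j, F i j = F' i j) ->
  u =1 u' -> v =1 v' -> bil F u v = bil F' u' v'.
Proof.
move=> FE uE vE; apply: eq_bigr => i _; apply: eq_bigr => j _.
by rewrite FE uE vE.
Qed.

Lemma bilD F F' u v :
  bil (fun i j => F i j + F' i j) u v = bil F u v + bil F' u v.
Proof.
rewrite /bil -big_split; apply: eq_bigr => i _ /=; rewrite -big_split.
by apply: eq_bigr => j _ /=; rewrite !mulrDl.
Qed.

Lemma bilN F u v : bil (fun i j => - F i j) u v = - bil F u v.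
Proof.
rewrite /bil -sumrN; apply: eq_bigr => i _; rewrite -sumrN.
by apply: eq_bigr => j _; rewrite !mulNr.
Qed.

Lemma bilDl F u u' v : bil F (fun i => u i + u' i) v = bil F u v + bil F u' v.
Proof.
rewrite /bil -big_split; apply: eq_bigr => i _ /=; rewrite -big_split.
by apply: eq_bigr => j _ /=; rewrite mulrDr mulrDl.
Qed.

Lemma bilDr F u v v' : bil F u (fun i => v i + v' i) = bil F u v + bil F u v'.
Proof.
rewrite /bil -big_split; apply: eq_bigr => i _ /=; rewrite -big_split.
by apply: eq_bigr => j _ /=; rewrite mulrDr.
Qed.

Lemma bil_actl F (D : 'I_7 -> 'I_7 -> R) u v :
  bil (fun i j => \sum_(l < 7) D l i * F l j) u v =
  bil F (fun l => \sum_(i < 7) D l i * u i) v.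
Proof.
rewrite /bil; under eq_bigr do under eq_bigr do rewrite !mulr_suml.
under eq_bigr do rewrite exchange_big /=.
rewrite exchange_big; apply: eq_bigr => l _ /=.
rewrite exchange_big; apply: eq_bigr => j _ /=.
by rewrite mulr_sumr mulr_suml; apply: eq_bigr => i _; ring.
Qed.

Lemma bil_actr F (D : 'I_7 -> 'I_7 -> R) u v :
  bil (fun i j => \sum_(l < 7) D l j * F i l) u v =
  bil F u (fun l => \sum_(j < 7) D l j * v j).
Proof.
rewrite /bil; apply: eq_bigr => i _; under eq_bigr do rewrite !mulr_suml.
rewrite exchange_big; apply: eq_bigr => l _ /=.
by rewrite mulr_sumr; apply: eq_bigr => j _; ring.
Qed.

Lemma bil_sum n (D : 'I_n -> R) (F : 'I_n -> 'I_7 -> 'I_7 -> R) u v :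
  bil (fun i j => \sum_(l < n) D l * F l i j) u v =
  \sum_(l < n) D l * bil (F l) u v.
Proof.
rewrite /bil; under eq_bigr do under eq_bigr do rewrite !mulr_suml.
under eq_bigr do rewrite exchange_big /=.
rewrite exchange_big; apply: eq_bigr => l _ /=.
rewrite mulr_sumr; apply: eq_bigr => i _ /=.
by rewrite mulr_sumr; apply: eq_bigr => j _; ring.
Qed.

End Bilinear.

(** * The covariant derivative of the octonion product *)

Section OctonionConnection.
Variables (R : realType) (M : manifold7 R).
Variables (phi : tensor M R^o 3) (g : tensor M R^o 2) (vol : tensor M R^o 7).
Variable T : tensor M R^o 2.
Hypotheses (hphi : G2_structure phi) (hg : G2_metric phi g vol)
  (hT : is_torsion phi g vol T).
Variable c : atlas M.
Implicit Types (x y : 'rV[R]_7) (i j k l m n : 'I_7).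

Local Notation U := (img c).
Local Notation G i j := (fun y : 'rV[R]_7 => g c y [tuple i; j]).
Local Notation Gi k l := (fun y : 'rV[R]_7 => ginv g c y k l).
Local Notation Ga k i j := (fun y : 'rV[R]_7 => christoffel g c y k i j).
Local Notation Ph i j k := (fun y : 'rV[R]_7 => phi c y [tuple i; j; k]).
Local Notation Tu m e := (fun y : 'rV[R]_7 => torsion_up g T c y m e).
Local Notation Ps e i j l := (fun y : 'rV[R]_7 => G2_psi phi g vol c y [tuple e; i; j; l]).
Local Notation mul := (omul phi g c).

Definition cross_coef k i j y : R := \sum_(l < 7) Gi k l y * Ph i j l y.

(** The covariant derivative of phi in direction [m] as the torsion identity gives it, with its last
    index raised. *)
Definition torsion_coef m k i j y : R :=
  \sum_(l < 7) Gi k l y * (2 * \sum_(e < 7) Tu m e y * Ps e i j l y).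

Lemma diff2_on_cross_coef k i j : diff2_on U (cross_coef k i j).
Proof.
apply: (diff2_onsum (@open_img _ _ c)) => l; apply: (diff2_onM (@open_img _ _ c)).
  exact: (diff2_on_ginv hphi hg).
exact: diff2_on_phi.
Qed.

Lemma diff2_on_torsion m e : diff2_on U (Tu m e).
Proof.
apply: (diff2_onsum (@open_img _ _ c)) => l; apply: (diff2_onM (@open_img _ _ c)).
  exact: (diff2_on_ginv hphi hg).
by case: hT => -[sT _] _; apply: smooth_diff2_on; exact: sT.
Qed.

Lemma metric_cross_coef n i j x : U x ->
  \sum_(k < 7) G n k x * cross_coef k i j x = Ph i j n x.
Proof. by move=> Ux; exact: (metric_raise hphi hg). Qed.

(** The covariant derivative of the cross product is [torsion_coef], written out in coordinates.
    With [k] lowered it becomes the torsion identity for phi together with nabla g = 0. *)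
Lemma partial_cross_coef m k i j x : U x -> partial m (cross_coef k i j) x =
  - (\sum_(l < 7) Ga k m l x * cross_coef l i j x)
  + \sum_(l < 7) Ga l m i x * cross_coef k l j x
  + \sum_(l < 7) Ga l m j x * cross_coef k i l x
  + torsion_coef m k i j x.
Proof.
move=> Ux; have oU := @open_img _ _ c.
move: k; apply: (metric_inj hphi hg Ux) => n.
have : partial m (fun y => \sum_(k < 7) G n k y * cross_coef k i j y) x =
       partial m (Ph i j n) x.
  by apply: (partial_eqU oU _ Ux) => y Uy; exact: metric_cross_coef.
rewrite (partial_sumM _ (fun k => (diff2_on_metric hg c n k).1 _ Ux)
  (fun k => (diff2_on_cross_coef k i j).1 _ Ux)) big_split /=.
move=> /(canRL (addKr _)) ->.
have [_ /(_ c x Ux m [tuple i; j; n])] := hT.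
have -> : [tuple of m :: [tuple i; j; n]] = [tuple m; i; j; n] by exact: val_inj.
rewrite nabla3 => /(canRL (subrK _)) ->.
have -> : \sum_(e < 7) torsion_up g T c x m e *
     G2_psi phi g vol c x [tuple of e :: [tuple i; j; n]] =
   \sum_(e < 7) Tu m e x * Ps e i j n x.
  by apply: eq_bigr => e _; congr (_ * G2_psi _ _ _ _ _ _); exact: val_inj.
under eq_bigr do rewrite (metric_compat hphi hg) // mulr_suml.
under [RHS]eq_bigr do rewrite !mulrDr mulrN.
rewrite !big_split /= sumrN (metric_raise hphi hg) //.
(* Of the two Christoffel terms in the derivative of the metric, one cancels that of the third index
   of phi and the other becomes the term on the upper index [k]. *)
have E1 : \sum_(k < 7) \sum_(l < 7)
    (Ga l m n x * G l k x + Ga l m k x * G n l x) * cross_coef k i j x =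
  \sum_(l < 7) Ga l m n x * Ph i j l x +
  \sum_(k < 7) G n k x * (\sum_(l < 7) Ga k m l x * cross_coef l i j x).
  under eq_bigr do under eq_bigr do rewrite mulrDl.
  under eq_bigr do rewrite big_split.
  rewrite big_split /=; congr (_ + _); rewrite exchange_big; apply: eq_bigr => l _ /=.
    by rewrite -metric_cross_coef // mulr_sumr; apply: eq_bigr => k _; ring.
  by rewrite mulr_sumr; apply: eq_bigr => k _; ring.
have E2 : \sum_(k < 7) G n k x * (\sum_(l < 7) Ga l m i x * cross_coef k l j x) =
   \sum_(l < 7) Ga l m i x * Ph l j n x.
  under eq_bigr do rewrite mulr_sumr.
  rewrite exchange_big; apply: eq_bigr => l _ /=.
  by rewrite -metric_cross_coef // mulr_sumr; apply: eq_bigr => k _; ring.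
have E3 : \sum_(k < 7) G n k x * (\sum_(l < 7) Ga l m j x * cross_coef k i l x) =
   \sum_(l < 7) Ga l m j x * Ph i l n x.
  under eq_bigr do rewrite mulr_sumr.
  rewrite exchange_big; apply: eq_bigr => l _ /=.
  by rewrite -metric_cross_coef // mulr_sumr; apply: eq_bigr => k _; ring.
by rewrite E1 E2 E3; ring.
Qed.

Lemma crossE x (u v : 'rV[R]_7) k :
  cross phi g c x u v ord0 k = bil (fun i j => cross_coef k i j x) (u ord0) (v ord0).
Proof.
rewrite mxE /bil.
under [RHS]eq_bigr do under eq_bigr do rewrite !mulr_suml.
under [RHS]eq_bigr do rewrite exchange_big /=.
rewrite [RHS]exchange_big; apply: eq_bigr => l _ /=; rewrite mulr_sumr.
apply: eq_bigr => i _; rewrite mulr_sumr; apply: eq_bigr => j _; ring.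
Qed.

Definition onabla i (A : 'rV[R]_7 -> octo R) x : octo R :=
  (partial i (fun y => (A y).1) x,
   \row_k (partial i (fun y => (A y).2 ord0 k) x
           + \sum_(l < 7) Ga k i l x * (A x).2 ord0 l)).

Definition odiff (A : 'rV[R]_7 -> octo R) :=
  diff_on U (fun y => (A y).1) /\ forall k, diff_on U (fun y => (A y).2 ord0 k).

Definition odiff2 (A : 'rV[R]_7 -> octo R) :=
  diff2_on U (fun y => (A y).1) /\ forall k, diff2_on U (fun y => (A y).2 ord0 k).

Definition tors i x : octo R := (0, \row_a torsion_up g T c x i a).

Definition D_op i (A : 'rV[R]_7 -> octo R) x : octo R :=
  onabla i A x - mul x (A x) (tors i x).

Lemma omul1E x (X Y : octo R) :
  (mul x X Y).1 = X.1 * Y.1 - bil (fun i j => G i j x) (X.2 ord0) (Y.2 ord0).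
Proof. by []. Qed.

Lemma omul2E x (X Y : octo R) k :
  (mul x X Y).2 ord0 k = X.1 * Y.2 ord0 k + Y.1 * X.2 ord0 k
    + bil (fun i j => cross_coef k i j x) (X.2 ord0) (Y.2 ord0).
Proof. by rewrite /omul /= mxE [in LHS]mxE crossE !mxE. Qed.

Lemma partial_bil m (F : 'I_7 -> 'I_7 -> 'rV[R]_7 -> R^o)
    (p q : 'I_7 -> 'rV[R]_7 -> R^o) x :
  (forall k l, differentiable (F k l) x) -> (forall k, differentiable (p k) x) ->
  (forall l, differentiable (q l) x) ->
  partial m (fun y => bil (fun i j => F i j y) (p^~ y) (q^~ y)) x =
  bil (fun i j => partial m (F i j) x) (p^~ x) (q^~ x)
  + bil (fun i j => F i j x) (fun i => partial m (p i) x) (q^~ x)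
  + bil (fun i j => F i j x) (p^~ x) (fun j => partial m (q j) x).
Proof.
move=> dF dp dq; rewrite partial_sum2M // /bil.
rewrite -!big_split; apply: eq_bigr => i _ /=; rewrite -!big_split.
by apply: eq_bigr.
Qed.

Lemma differentiable_bil (F : 'I_7 -> 'I_7 -> 'rV[R]_7 -> R^o)
    (p q : 'I_7 -> 'rV[R]_7 -> R^o) x :
  (forall k l, differentiable (F k l) x) -> (forall k, differentiable (p k) x) ->
  (forall l, differentiable (q l) x) ->
  differentiable (fun y => bil (fun i j => F i j y) (p^~ y) (q^~ y) : R^o) x.
Proof.
move=> dF dp dq; apply: differentiable_bigsum => k.
by apply: differentiable_bigsum => l; do !apply: differentiable_mul.
Qed.

(** The 2 of the torsion identity matches the 2 of the associator, so nabla phi is exactly the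
    associator with [tors m]. *)
Lemma torsion_assoc m x (X Y : octo R) : U x ->
  mul x (mul x X Y) (tors m x) - mul x X (mul x Y (tors m x)) =
  (0, \row_k bil (fun i j => torsion_coef m k i j x) (X.2 ord0) (Y.2 ord0)).
Proof.
move=> /(frame_exists hphi hg)[A fA]; rewrite (omul_assoc fA); congr (_, _).
apply/rowP => k; rewrite !mxE bil_sum mulr_sumr; apply: eq_bigr => l _.
rewrite mulrCA; congr (_ * _).
rewrite (eq_bil (F' := fun i j => \sum_(e < 7) (2 * Tu m e x) * Ps e i j l x)
  (u' := X.2 ord0) (v' := Y.2 ord0)) //; last first.
  by move=> i j; rewrite mulr_sumr; apply: eq_bigr => e _; ring.
rewrite bil_sum mulr_sumr; apply: eq_bigr => e _.
rewrite -mulrA; congr (_ * _); rewrite mxE mulr_sumr; apply: eq_bigr => i _.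
by rewrite mulr_sumr; apply: eq_bigr => j _; ring.
Qed.

(** The real part obeys the plain product rule because nabla g = 0. The cross product adds the
    derivative of phi, which [torsion_assoc] identifies as an associator. *)
Lemma onabla_omul m (A B : 'rV[R]_7 -> octo R) x : U x -> odiff A -> odiff B ->
  onabla m (fun y => mul y (A y) (B y)) x =
  mul x (onabla m A x) (B x) + mul x (A x) (onabla m B x)
  + (mul x (mul x (A x) (B x)) (tors m x) - mul x (A x) (mul x (B x) (tors m x))).
Proof.
move=> Ux [dA dA'] [dB dB']; rewrite torsion_assoc //.
have dAx := dA _ Ux; have dBx := dB _ Ux.
have dAk k := dA' k _ Ux; have dBk k := dB' k _ Ux.
have dG i j : differentiable (G i j) x := (diff2_on_metric hg c i j).1 _ Ux.
have dC k i j : differentiable (cross_coef k i j) x := (diff2_on_cross_coef k i j).1 _ Ux.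
(* [dal] and [dbe] are the plain derivatives of the imaginary parts, [gal] and [gbe] their
   Christoffel corrections. *)
pose dal k := partial m (fun y => (A y).2 ord0 k) x.
pose dbe k := partial m (fun y => (B y).2 ord0 k) x.
pose gal k := \sum_(l < 7) Ga k m l x * (A x).2 ord0 l.
pose gbe k := \sum_(l < 7) Ga k m l x * (B x).2 ord0 l.
pose al := (A x).2 ord0; pose be := (B x).2 ord0.
have nA F v : bil F ((onabla m A x).2 ord0) v = bil F dal v + bil F gal v.
  by rewrite -bilDl; apply: eq_bil => // i; rewrite mxE.
have nB F u : bil F u ((onabla m B x).2 ord0) = bil F u dbe + bil F u gbe.
  by rewrite -bilDr; apply: eq_bil => // i; rewrite mxE.
rewrite [LHS]surjective_pairing [RHS]surjective_pairing; congr (_, _).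
  rewrite -[RHS]/((mul x (onabla m A x) (B x)).1 +
    (mul x (A x) (onabla m B x)).1 + 0) addr0 !omul1E nA nB.
  rewrite -[LHS]/(partial m (fun y => (A y).1 * (B y).1 -
    bil (fun i j => G i j y) ((A y).2 ord0) ((B y).2 ord0)) x).
  rewrite partialB; [|exact: differentiable_mul|exact: differentiable_bil].
  rewrite partialM // partial_bil //.
  have -> : bil (fun i j => partial m (G i j) x) al be =
      bil (fun i j => G i j x) gal be + bil (fun i j => G i j x) al gbe.
    rewrite -bil_actl -bil_actr -bilD; apply: eq_bil => // i j.
    by rewrite (metric_compat hphi hg) // big_split.
  by rewrite /=; ring.
apply/rowP => k; rewrite [LHS]mxE.
rewrite -[RHS]/(((mul x (onabla m A x) (B x)).2 + (mul x (A x) (onabla m B x)).2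
  + \row_k bil (fun i j => torsion_coef m k i j x) al be) ord0 k).
rewrite [RHS]mxE [X in _ = X + _]mxE [X in _ = _ + X]mxE !omul2E nA nB.
have -> : (fun y => (mul y (A y) (B y)).2 ord0 k) =
  (fun y => (A y).1 * (B y).2 ord0 k + (B y).1 * (A y).2 ord0 k
    + bil (fun i j => cross_coef k i j y) ((A y).2 ord0) ((B y).2 ord0)).
  by apply/funext => y; rewrite omul2E.
rewrite partialD; [|by apply: differentiable_add; apply: differentiable_mul
                   |exact: differentiable_bil].
rewrite partialD; [|exact: differentiable_mul|exact: differentiable_mul].
rewrite !partialM //.
have -> : partial m (fun y =>
      bil (fun i j => cross_coef k i j y) ((A y).2 ord0) ((B y).2 ord0)) x =
    bil (fun i j => partial m (cross_coef k i j) x) al be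
    + bil (fun i j => cross_coef k i j x) dal be
    + bil (fun i j => cross_coef k i j x) al dbe.
  exact: partial_bil.
have -> : bil (fun i j => partial m (cross_coef k i j) x) al be =
    - (\sum_(l < 7) Ga k m l x * bil (fun i j => cross_coef l i j x) al be)
    + bil (fun i j => cross_coef k i j x) gal be
    + bil (fun i j => cross_coef k i j x) al gbe
    + bil (fun i j => torsion_coef m k i j x) al be.
  rewrite -bil_sum -bilN -bil_actl -bil_actr -!bilD; apply: eq_bil => // i j.
  by rewrite partial_cross_coef.
rewrite [X in _ + X = _](eq_bigr (fun l => Ga k m l x * ((A x).1 * be l)
  + Ga k m l x * ((B x).1 * al l)
  + Ga k m l x * bil (fun i j => cross_coef l i j x) al be)); last first.
  by move=> l _; rewrite omul2E !mulrDr.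
rewrite !big_split /=.
have E1 : \sum_(l < 7) Ga k m l x * ((A x).1 * be l) = (A x).1 * gbe k.
  by rewrite mulr_sumr; apply: eq_bigr => l _; rewrite /be; ring.
have E2 : \sum_(l < 7) Ga k m l x * ((B x).1 * al l) = (B x).1 * gal k.
  by rewrite mulr_sumr; apply: eq_bigr => l _; rewrite /al; ring.
rewrite -/al -/be E1 E2 [(onabla m A x).2 ord0 k]mxE [(onabla m B x).2 ord0 k]mxE.
rewrite -/(gal k) -/(gbe k) -/(dal k) -/(dbe k).
by ring.
Qed.

End OctonionConnection.

(** * Linearity, regularity and the Leibniz rule of the twisted derivative *)

Section Commutators.
Variables (R : realType) (M : manifold7 R).
Variables (phi : tensor M R^o 3) (g : tensor M R^o 2) (vol : tensor M R^o 7).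
Variables (T : tensor M R^o 2) (Riem : tensor M 'M[R]_7 2).
Hypotheses (hphi : G2_structure phi) (hg : G2_metric phi g vol)
  (hT : is_torsion phi g vol T) (hRiem : is_riemann g Riem).
Variable c : atlas M.
Implicit Types (x y : 'rV[R]_7) (i j k l m n : 'I_7).
Implicit Types (A B : 'rV[R]_7 -> octo R) (X Y Z : octo R).

Local Notation U := (img c).
Local Notation Ga k i j := (fun y : 'rV[R]_7 => christoffel g c y k i j).
Local Notation mul := (omul phi g c).
Local Notation tors := (tors g T c).
Local Notation onabla := (@onabla R M g c).
Local Notation D_op := (@D_op R M phi g T c).
Local Notation odiff := (@odiff R M c).
Local Notation odiff2 := (@odiff2 R M c).

Lemma omulDl x X Y Z : mul x (X + Y) Z = mul x X Z + mul x Y Z.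
Proof.
rewrite [LHS]surjective_pairing [RHS]surjective_pairing; congr (_, _).
  rewrite -[RHS]/((mul x X Z).1 + (mul x Y Z).1) !omul1E.
  rewrite (eq_bil (F' := fun i j => g c x [tuple i; j])
    (u' := fun i => X.2 ord0 i + Y.2 ord0 i) (v' := Z.2 ord0)) //.
    by rewrite bilDl /=; ring.
  by move=> i; rewrite mxE.
apply/rowP => k; rewrite -[RHS]/(((mul x X Z).2 + (mul x Y Z).2) ord0 k).
rewrite [RHS]mxE !omul2E.
rewrite (eq_bil (F' := fun i j => cross_coef phi g c k i j x)
    (u' := fun i => X.2 ord0 i + Y.2 ord0 i) (v' := Z.2 ord0)) //.
  by rewrite bilDl !mxE /=; ring.
by move=> i; rewrite mxE.
Qed.

Lemma omulDr x X Y Z : mul x Z (X + Y) = mul x Z X + mul x Z Y.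
Proof.
rewrite [LHS]surjective_pairing [RHS]surjective_pairing; congr (_, _).
  rewrite -[RHS]/((mul x Z X).1 + (mul x Z Y).1) !omul1E.
  rewrite (eq_bil (F' := fun i j => g c x [tuple i; j])
    (v' := fun i => X.2 ord0 i + Y.2 ord0 i) (u' := Z.2 ord0)) //.
    by rewrite bilDr /=; ring.
  by move=> i; rewrite mxE.
apply/rowP => k; rewrite -[RHS]/(((mul x Z X).2 + (mul x Z Y).2) ord0 k).
rewrite [RHS]mxE !omul2E.
rewrite (eq_bil (F' := fun i j => cross_coef phi g c k i j x)
    (v' := fun i => X.2 ord0 i + Y.2 ord0 i) (u' := Z.2 ord0)) //.
  by rewrite bilDr !mxE /=; ring.
by move=> i; rewrite mxE.
Qed.

Lemma omulBl x X Y Z : mul x (X - Y) Z = mul x X Z - mul x Y Z.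
Proof. by apply/eqP; rewrite eq_sym subr_eq -omulDl subrK. Qed.

Lemma omulBr x X Y Z : mul x Z (X - Y) = mul x Z X - mul x Z Y.
Proof. by apply/eqP; rewrite eq_sym subr_eq -omulDr subrK. Qed.

Lemma odiffB A B : odiff A -> odiff B -> odiff (fun y => A y - B y).
Proof.
move=> [dA dA'] [dB dB']; split=> [|k]; first exact: diff_onB.
apply: (diff_on_eq (@open_img _ _ c) _ (diff_onB (dA' k) (dB' k))) => y _.
by rewrite !mxE.
Qed.

Lemma odiff_omul A B : odiff A -> odiff B -> odiff (fun y => mul y (A y) (B y)).
Proof.
move=> [dA dA'] [dB dB']; have oU := @open_img _ _ c; split=> [|k].
  apply: diff_onB; first exact: diff_onM.
  apply: diff_onsum => i; apply: diff_onsum => j; apply: diff_onM => //; apply: diff_onM => //.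
  exact: (diff2_on_metric hg c i j).1.
apply: (diff_on_eq oU (f := fun y => (A y).1 * (B y).2 ord0 k + (B y).1 * (A y).2 ord0 k
    + bil (fun i j => cross_coef phi g c k i j y) ((A y).2 ord0) ((B y).2 ord0))).
  by move=> y _; rewrite omul2E.
apply: diff_onD; first by apply: diff_onD; exact: diff_onM.
apply: diff_onsum => i; apply: diff_onsum => j; apply: diff_onM => //; apply: diff_onM => //.
exact: (diff2_on_cross_coef hphi hg c k i j).1.
Qed.

Lemma odiff2_omul A B : odiff2 A -> odiff2 B -> odiff2 (fun y => mul y (A y) (B y)).
Proof.
move=> [dA dA'] [dB dB']; have oU := @open_img _ _ c.
have diff2_onN f : diff2_on U f -> diff2_on U (fun y => - f y).
  move=> df; apply: (diff2_on_eq oU _ (diff2_onM oU (diff2_onc oU (-1)) df)) => y _.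
  exact: mulN1r.
split=> [|k].
  apply: (diff2_onD oU); first exact: diff2_onM.
  apply: diff2_onN; apply: (diff2_onsum oU) => i; apply: (diff2_onsum oU) => j.
  apply: (diff2_onM oU) => //; apply: (diff2_onM oU) => //; exact: (diff2_on_metric hg).
apply: (diff2_on_eq oU (f := fun y => (A y).1 * (B y).2 ord0 k + (B y).1 * (A y).2 ord0 k
    + bil (fun i j => cross_coef phi g c k i j y) ((A y).2 ord0) ((B y).2 ord0))).
  by move=> y _; rewrite omul2E.
apply: (diff2_onD oU); first by apply: (diff2_onD oU); exact: (diff2_onM oU).
apply: (diff2_onsum oU) => i; apply: (diff2_onsum oU) => j.
apply: (diff2_onM oU) => //; apply: (diff2_onM oU) => //; exact: (diff2_on_cross_coef hphi hg).
Qed.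

Lemma odiff_onabla j A : odiff2 A -> odiff (onabla j A).
Proof.
move=> [dA dA']; split=> [|k]; first exact: (dA.2 j).
apply: (diff_on_eq (@open_img _ _ c) (f := fun y => partial j (fun y => (A y).2 ord0 k) y
           + \sum_(l < 7) Ga k j l y * (A y).2 ord0 l)).
  by move=> y _; rewrite mxE.
apply: diff_onD; first exact: (dA' k).2.
apply: diff_onsum => l; apply: diff_onM; first exact: (diff_on_christoffel hphi hg).
exact: (dA' l).1.
Qed.

Lemma odiff_tors i : odiff (tors i).
Proof.
split=> [|k]; first exact: diff_onc.
apply: (diff_on_eq (@open_img _ _ c) _ (diff2_on_torsion hphi hg hT c i k).1) => y _.
by rewrite mxE.
Qed.

Lemma odiff2_odiff A : odiff2 A -> odiff A.
Proof. by move=> [[dA _] dA']; split=> // k; exact: (dA' k).1. Qed.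

Lemma odiff2c X : odiff2 (fun=> X).
Proof. by split=> [|k]; exact: diff2_onc (@open_img _ _ c) _. Qed.

Lemma odiff_D_op j A : odiff2 A -> odiff (D_op j A).
Proof.
move=> dA; apply: odiffB; first exact: odiff_onabla.
by apply: odiff_omul; [exact: odiff2_odiff|exact: odiff_tors].
Qed.

Lemma onabla_eq i A B x : U x -> (forall y, U y -> A y = B y) ->
  onabla i A x = onabla i B x.
Proof.
move=> Ux AB; have oU := @open_img _ _ c; congr (_, _).
  by apply: (partial_eqU oU _ Ux) => y Uy; rewrite AB.
apply/rowP => k; rewrite !mxE AB //; congr (_ + _).
by apply: (partial_eqU oU _ Ux) => y Uy; rewrite AB.
Qed.

Lemma D_op_eq i A B x : U x -> (forall y, U y -> A y = B y) ->
  D_op i A x = D_op i B x.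
Proof. by move=> Ux AB; rewrite /D_op (onabla_eq _ Ux AB) AB. Qed.

Lemma onablaD i A B x : U x -> odiff A -> odiff B ->
  onabla i (fun y => A y + B y) x = onabla i A x + onabla i B x.
Proof.
move=> Ux [dA dA'] [dB dB']; congr (_, _).
  by rewrite -partialD //; [exact: dA|exact: dB].
apply/rowP => k; rewrite !mxE.
have -> : (fun y => (A y + B y).2 ord0 k) =
    (fun y => (A y).2 ord0 k + (B y).2 ord0 k).
  by apply/funext => y; rewrite mxE.
rewrite partialD; [|exact: dA'|exact: dB'].
rewrite addrACA -big_split; congr (_ + _); apply: eq_bigr => l _ /=.
by rewrite mxE mulrDr.
Qed.

Lemma onablaZ i (a : R) A x : U x -> odiff A ->
  onabla i (fun y => a *: A y) x = a *: onabla i A x.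
Proof.
move=> Ux [dA dA']; have pZ f : differentiable f x ->
    partial i (fun y => a * f y) x = a * partial i f x.
  by move=> df; rewrite partialM ?partial_cst ?mul0r ?add0r //; exact: differentiable_const.
congr (_, _); first exact: (pZ _ (dA _ Ux)).
apply/rowP => k; rewrite !mxE.
have -> : (fun y => (a *: A y).2 ord0 k) = (fun y => a * (A y).2 ord0 k).
  by apply/funext => y; rewrite mxE.
rewrite pZ; last exact: dA'.
rewrite mulrDr; congr (_ + _); rewrite mulr_sumr; apply: eq_bigr => l _.
by rewrite mxE mulrCA.
Qed.

Lemma omulZl x (a : R) X Z : mul x (a *: X) Z = a *: mul x X Z.
Proof.
rewrite [LHS]surjective_pairing [RHS]surjective_pairing; congr (_, _).
  rewrite -[RHS]/(a * (mul x X Z).1) !omul1E /bil mulrBr; congr (_ - _).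
    by rewrite mulrA.
  rewrite mulr_sumr; apply: eq_bigr => i _; rewrite mulr_sumr.
  by apply: eq_bigr => j _; rewrite mxE; ring.
apply/rowP => k; rewrite -[RHS]/((a *: (mul x X Z).2) ord0 k).
rewrite [RHS]mxE !omul2E mulrDr; congr (_ + _).
  rewrite -[(a *: X).1]/(a * X.1) -[(a *: X).2]/(a *: X.2) [(a *: X.2) _ _]mxE.
  by ring.
rewrite mulr_sumr; apply: eq_bigr => i _; rewrite mulr_sumr.
by apply: eq_bigr => j _; rewrite mxE; ring.
Qed.

Lemma odiffD A B : odiff A -> odiff B -> odiff (fun y => A y + B y).
Proof.
move=> [dA dA'] [dB dB']; split=> [|k]; first exact: diff_onD.
apply: (diff_on_eq (@open_img _ _ c) _ (diff_onD (dA' k) (dB' k))) => y _.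
by rewrite !mxE.
Qed.

Lemma odiffZ (a : R) A : odiff A -> odiff (fun y => a *: A y).
Proof.
move=> [dA dA']; split=> [|k]; first by apply: diff_onM => //; exact: diff_onc.
apply: (diff_on_eq (@open_img _ _ c) _ (diff_onM (@diff_onc _ U a) (dA' k))) => y _.
by rewrite !mxE.
Qed.

Lemma D_opD i A B x : U x -> odiff A -> odiff B ->
  D_op i (fun y => A y + B y) x = D_op i A x + D_op i B x.
Proof. by move=> Ux dA dB; rewrite /D_op onablaD // omulDl opprD addrACA. Qed.

Lemma D_opZ i (a : R) A x : U x -> odiff A ->
  D_op i (fun y => a *: A y) x = a *: D_op i A x.
Proof. by move=> Ux dA; rewrite /D_op onablaZ // omulZl scalerBr. Qed.

Lemma D_opB i A B x : U x -> odiff A -> odiff B ->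
  D_op i (fun y => A y - B y) x = D_op i A x - D_op i B x.
Proof.
move=> Ux dA dB; have -> : (fun y => A y - B y) = (fun y => A y + (-1) *: B y).
  by apply/funext => y; rewrite scaleN1r.
by rewrite D_opD // ?D_opZ ?scaleN1r //; exact: odiffZ.
Qed.

(** The term (AB)T_i subtracted by [D_op] cancels against the associator; what remains, A(BT_i),
    completes the derivative of [B]. *)
Lemma D_op_omul i A B x : U x -> odiff A -> odiff B ->
  D_op i (fun y => mul y (A y) (B y)) x =
  mul x (onabla i A x) (B x) + mul x (A x) (D_op i B x).
Proof.
move=> Ux dA dB; rewrite /D_op (onabla_omul hphi hg hT) // omulBr.
by rewrite addrAC addrA subrK -addrA.
Qed.

End Commutators.

(** * Curvature *)

Section Curvature.
Variables (R : realType) (M : manifold7 R).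
Variables (phi : tensor M R^o 3) (g : tensor M R^o 2) (vol : tensor M R^o 7).
Variables (T : tensor M R^o 2) (Riem : tensor M 'M[R]_7 2).
Hypotheses (hphi : G2_structure phi) (hg : G2_metric phi g vol)
  (hT : is_torsion phi g vol T) (hRiem : is_riemann g Riem).
Variable c : atlas M.
Implicit Types (x y : 'rV[R]_7) (i j k l m n : 'I_7).
Implicit Types (A B : 'rV[R]_7 -> octo R) (X Y Z : octo R).

Local Opaque christoffel.
Local Notation U := (img c).
Local Notation Ga k i j := (fun y : 'rV[R]_7 => christoffel g c y k i j).
Local Notation mul := (omul phi g c).
Local Notation tors := (tors g T c).
Local Notation onabla := (@onabla R M g c).
Local Notation D_op := (@D_op R M phi g T c).
Local Notation odiff := (@odiff R M c).
Local Notation odiff2 := (@odiff2 R M c).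

Definition curv k l i j x : R :=
  partial i (Ga k j l) x - partial j (Ga k i l) x
  + \sum_(n < 7) (Ga k i n x * Ga n j l x - Ga k j n x * Ga n i l x).

(* The Ricci identity evaluated on constant fields determines [Riem]. *)
Lemma Riem_curv i j k l x : U x -> Riem c x [tuple i; j] k l = curv k l i j x.
Proof.
move=> Ux; have oU := @open_img _ _ c.
pose v : tensor M 'rV[R]_7 0 := fun _ _ _ => delta_mx ord0 l.
have sv : smooth_tangent v.
  move=> c' b n; have sc (a : R) s : exists a', foldr (@partial R) (fun=> a) s = (fun=> a').
    elim: s => [|m s [a' /= ->]]; first by exists a.
    by exists 0; apply/funext => y; exact: partial_cst.
  move=> s y _; have [a' ->] := sc ((delta_mx ord0 l : 'rV[R]_7) ord0 n) s.
  exact: differentiable_const.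
have nvt c' y (b : mindex 1) n :
    nabla_tangent g v c' y b ord0 n = christoffel g c' y n (thead b) l.
  rewrite mxE /nabla partial_cst big_ord0 subr0 add0r.
  rewrite (bigD1 l) //= big1 => [|e el]; last by rewrite mxE (negbTE el) andbF mulr0.
  by rewrite mxE (eqxx l) /= mulr1 addr0.
have nnv m e n : nabla_tangent g (nabla_tangent g v) c x [tuple m; e] ord0 n =
    partial m (Ga n e l) x - \sum_(a < 7) Ga a m e x * Ga n a l x
    + \sum_(a < 7) Ga n m a x * Ga a e l x.
  rewrite mxE /nabla big_ord1; congr (_ - _ + _).
  - congr (partial _ _ x); apply/funext => y; rewrite nvt.
    by congr christoffel.
  - by apply: eq_bigr => a _; rewrite nvt /thead !tnth_mktuple.
  - by apply: eq_bigr => a _; rewrite nvt.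
have RE : \sum_(e < 7) Riem c x [tuple i; j] k e * v c x [tuple] ord0 e =
    Riem c x [tuple i; j] k l.
  rewrite (bigD1 l) //= big1 => [|e el]; last by rewrite /v mxE (negbTE el) andbF mulr0.
  by rewrite /v mxE (eqxx l) /= mulr1 addr0.
have H := etrans (esym (congr2 (fun a b => a - b) (nnv i j k) (nnv j i k)))
  (etrans (hRiem sv Ux i j k) RE).
(* [s1] and [s2] are the Christoffel terms on the index of the inner derivative; they agree because
   the connection is symmetric. *)
have gen (p1 p2 q1 q2 s1 s2 r : R) : s1 = s2 ->
    (p1 - s1 + q1) - (p2 - s2 + q2) = r -> r = p1 - p2 + (q1 - q2).
  by move=> -> <-; ring.
rewrite /curv sumrB; apply: gen H.
by apply: eq_bigr => a _; rewrite (christoffel_sym hg a i j Ux).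
Qed.

(** By symmetry of the lower Christoffel indices, the derivative terms and the quadratic terms each
    cancel in pairs around the cycle. *)
Lemma curv_bianchi k l i j x : U x ->
  curv k l i j x + curv k i j l x + curv k j l i x = 0.
Proof.
move=> Ux.
have E e a b : partial e (Ga k a b) x = partial e (Ga k b a) x.
  by apply: (partial_eqU (@open_img _ _ c) _ Ux) => y Uy; exact: (christoffel_sym hg k a b Uy).
have E' n a b := christoffel_sym hg n a b Ux.
pose S i j l := \sum_(n < 7) (Ga k i n x * Ga n j l x - Ga k j n x * Ga n i l x).
have S0 : S i j l + S j l i + S l i j = 0.
  rewrite /S -!big_split big1 // => n _ /=.
  have gen (a b d e f h : R) : a * b - d * e + (d * e - f * h) + (f * h - a * b) = 0.
    by ring.
  by rewrite (E' n l j) (E' n l i) (E' n j i); exact: gen.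
have gen (a b d s1 s2 s3 : R) : s1 + s2 + s3 = 0 ->
    (a - b + s1) + (b - d + s2) + (d - a + s3) = 0.
  by move=> E0; rewrite -[RHS]E0; ring.
have [e1 [e2 e3]] := (E i j l, (E j l i, E l i j)).
by rewrite /curv e1 e2 e3; exact: gen S0.
Qed.

(** In [onabla i (onabla j A)] the index [j] is a mere label, without a Christoffel term of its own;
    such a term would be symmetric in [i], [j] anyway. The real part is the equality of mixed
    partials. *)
Lemma onabla_comm i j A x : U x -> odiff2 A ->
  onabla i (onabla j A) x - onabla j (onabla i A) x =
  (0, (A x).2 *m (Riem c x [tuple i; j])^T).
Proof.
move=> Ux [dA dA']; have oU := @open_img _ _ c; congr (_, _).
  apply/eqP; rewrite subr_eq0; apply/eqP.
  by apply: (partialC oU Ux dA.1); exact: dA.2.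
apply/rowP => k; rewrite !mxE.
have dGa n a b : differentiable (Ga n a b) x := diff_on_christoffel hphi hg n a b Ux.
have dAl l : differentiable (fun y => (A y).2 ord0 l) x := (dA' l).1 _ Ux.
(* [S1] differentiates the Christoffel symbol and [S2] the field, and [Q] is quadratic in
   Christoffel symbols. [S2] occurs symmetrically and drops out; [S1] and [Q] make up the
   curvature. *)
pose S1 a b := \sum_(l < 7) partial a (Ga k b l) x * (A x).2 ord0 l.
pose S2 a b := \sum_(l < 7) Ga k b l x * partial a (fun y => (A y).2 ord0 l) x.
pose Q a b := \sum_(l < 7) \sum_(n < 7) Ga k a n x * Ga n b l x * (A x).2 ord0 l.
have E a b : partial a (fun y => (onabla b A y).2 ord0 k) x =
    partial a (partial b (fun y => (A y).2 ord0 k)) x + (S1 a b + S2 a b).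
  have -> : (fun y => (onabla b A y).2 ord0 k) = (fun y =>
      partial b (fun y => (A y).2 ord0 k) y
      + \sum_(l < 7) Ga k b l y * (A y).2 ord0 l).
    by apply/funext => y; rewrite mxE.
  rewrite partialD; [|exact: (dA' k).2|]; last first.
    by apply: differentiable_bigsum => l; exact: differentiable_mul.
  by rewrite partial_sumM // big_split.
have F a b : \sum_(l < 7) Ga k a l x * (onabla b A x).2 ord0 l = S2 b a + Q a b.
  rewrite /Q exchange_big -big_split; apply: eq_bigr => l _ /=.
  rewrite mxE mulrDr; congr (_ + _); rewrite mulr_sumr.
  by apply: eq_bigr => n _; rewrite mulrA.
have K : \sum_(l < 7) (A x).2 ord0 l * (Riem c x [tuple i; j])^T l k =
    S1 i j - S1 j i + (Q i j - Q j i).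
  rewrite /S1 /Q -!sumrB -big_split; apply: eq_bigr => l _ /=.
  rewrite mxE Riem_curv // mulrC /curv sumrB mulrDl !mulrBl.
  by rewrite !mulr_suml.
have gen (p s t s' t' q q' : R) :
    p + (s + t) + (t' + q) - (p + (s' + t') + (t + q')) = s - s' + (q - q').
  by ring.
apply: (etrans (etrans (congr2 (fun a b => a - b)
  (congr2 +%R (E i j) (F i j)) (congr2 +%R (E j i) (F j i))) _) (esym K)).
rewrite (partialC oU Ux (dA' k).1 ((dA' k).2 i _ Ux) ((dA' k).2 j _ Ux)).
exact: gen.
Qed.

(** The components of the form F = d_D T. *)
Definition tors_curv i j x : octo R :=
  onabla i (tors j) x - onabla j (tors i) x
  + (mul x (tors i x) (tors j x) - mul x (tors j x) (tors i x)).

Lemma subrACB (V : zmodType) (p q r s : V) : p - q - (r - s) = p - r - (q - s).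
Proof. by rewrite !opprB [s - r]addrC addrACA [- q + s]addrC. Qed.

Lemma addrACrot (V : zmodType) (p q r s : V) :
  p + q + (r + s) = p + s + (q + r).
Proof. by rewrite [r + s]addrC addrACA. Qed.

Lemma tors_curvE i j x :
  D_op i (tors j) x - D_op j (tors i) x = tors_curv i j x.
Proof. by rewrite /D_op /tors_curv subrACB [- (_ - _)]opprB. Qed.

Lemma D_op_comm i j A x : U x -> odiff2 A ->
  D_op i (D_op j A) x - D_op j (D_op i A) x =
  (0, (A x).2 *m (Riem c x [tuple i; j])^T) - mul x (A x) (tors_curv i j x).
Proof.
move=> Ux dA; rewrite -(onabla_comm _ _ Ux dA) -tors_curvE omulBr.
(* The product of [A] with [tors b] is differentiated by [D_op_omul], so no product of three factors
   has to be reassociated. The two terms with one derivative of [A] are exchanged by swapping [a]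
   and [b]. *)
have E a b : D_op a (D_op b A) x =
    onabla a (onabla b A) x - mul x (onabla b A x) (tors a x)
    - (mul x (onabla a A x) (tors b x) + mul x (A x) (D_op a (tors b) x)).
  transitivity (D_op a (fun y => onabla b A y - mul y (A y) (tors b y)) x) => //.
  rewrite D_opB //; last 2 first.
  - exact: (odiff_onabla hphi hg b dA).
  - by apply: (odiff_omul hphi hg); [exact: odiff2_odiff|exact: (odiff_tors hphi hg hT)].
  rewrite (D_op_omul hphi hg hT a Ux (odiff2_odiff dA) (odiff_tors hphi hg hT c b)).
  by [].
rewrite (E i j) (E j i).
have s1 (V : zmodType) (n m m' d : V) : n - m - (m' + d) = n - d - (m + m').
  by rewrite -!addrA -!opprD; congr (_ - _); rewrite addrA addrC.
have gen (V : zmodType) (n n' m m' d d' : V) :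
    n - m - (m' + d) - (n' - m' - (m + d')) = n - n' - (d - d').
  rewrite (s1 _ n) (s1 _ n') [m' + m]addrC [- (n' - d' - _)]opprB addrA subrK.
  exact: subrACB.
exact: gen.
Qed.

Lemma curvature_defect i j x X Y : U x ->
  let W := (Riem c x [tuple i; j])^T in let F := tors_curv i j x in
  (0, (mul x X Y).2 *m W) - mul x (0, X.2 *m W) Y - mul x X (0, Y.2 *m W) =
  mul x (mul x X Y) F - mul x X (mul x Y F).
Proof.
(* The claim concerns values at [x] only, so constant extensions in the chart suffice. *)
move=> Ux W F; pose A (y : 'rV[R]_7) := X; pose B (y : 'rV[R]_7) := Y.
have dA : odiff2 A by exact: odiff2c.
have dB : odiff2 B by exact: odiff2c.
have dA1 := odiff2_odiff dA; have dB1 := odiff2_odiff dB.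
have dDB k : odiff (D_op k B) := odiff_D_op hphi hg hT k dB.
have dnA k : odiff (onabla k A) := odiff_onabla hphi hg k dA.
(* The last bracket is symmetric in [a], [b] and disappears from the commutator. *)
have E a b : D_op a (D_op b (fun y => mul y (A y) (B y))) x =
    mul x (onabla a (onabla b A) x) Y + mul x X (D_op a (D_op b B) x)
    + (mul x (onabla b A x) (D_op a B x) + mul x (onabla a A x) (D_op b B x)).
  rewrite (@D_op_eq _ _ _ _ _ _ a _ (fun y => mul y (onabla b A y) (B y) +
     mul y (A y) (D_op b B y)) x Ux); last first.
    by move=> y Uy; rewrite (D_op_omul hphi hg hT).
  rewrite D_opD //; [|exact: (odiff_omul hphi hg)|exact: (odiff_omul hphi hg)].
  rewrite (D_op_omul hphi hg hT a Ux (dnA b) dB1).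
  rewrite (D_op_omul hphi hg hT a Ux dA1 (dDB b)).
  exact: addrACrot.
have := D_op_comm i j Ux (odiff2_omul hphi hg dA dB).
have hA : mul x (onabla i (onabla j A) x) Y - mul x (onabla j (onabla i A) x) Y =
    mul x (0, X.2 *m W) Y.
  by rewrite -omulBl (onabla_comm i j Ux dA).
have hB : mul x X (D_op i (D_op j B) x) - mul x X (D_op j (D_op i B) x) =
    mul x X (0, Y.2 *m W) - mul x X (mul x Y F).
  by rewrite -omulBr (D_op_comm i j Ux dB) omulBr.
have gen (V : zmodType) (a1 b1 a2 b2 p q z zf rx ry xyf : V) :
    a1 + b1 + (p + q) - (a2 + b2 + (q + p)) = z - zf ->
    a1 - a2 = rx -> b1 - b2 = ry - xyf -> z - rx - ry = zf - xyf.
  rewrite [q + p]addrC opprD addrACA subrr addr0 opprD addrACA => H ra rb.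
  have -> : z = rx + (ry - xyf + zf) by rewrite addrA -ra -rb H subrK.
  rewrite [_ - rx]addrC addrA addNr add0r [_ - ry]addrC !addrA addNr add0r.
  exact: addrC.
rewrite (E i j) (E j i) => H; exact: gen H hA hB.
Qed.

(** The real part of T_i T_j is minus an inner product, hence symmetric in [i], [j]. *)
Lemma tors_curv1 i j x : U x -> (tors_curv i j x).1 = 0.
Proof.
move=> Ux.
have -> : (tors_curv i j x).1 = partial i (fun=> 0) x - partial j (fun=> 0) x
   + ((mul x (tors i x) (tors j x)).1 - (mul x (tors j x) (tors i x)).1) by [].
rewrite !partial_cst subrr add0r !omul1E !mul0r !sub0r opprK addrC.
apply/eqP; rewrite subr_eq0; apply/eqP; rewrite /bil exchange_big.
apply: eq_bigr => a _; apply: eq_bigr => b _.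
by rewrite (metric_sym hg a b Ux) mulrAC.
Qed.

Lemma tors_curv_im i j x : U x -> tors_curv i j x = (0, (tors_curv i j x).2).
Proof. by move=> /(tors_curv1 i j) h; rewrite [LHS]surjective_pairing h. Qed.

(* Real part of [curvature_defect] for imaginary X and Y. *)
Lemma riem_low_anti a b i j x : U x ->
  riem_low g Riem c x a b i j = - riem_low g Riem c x b a i j.
Proof.
move=> Ux; have [A fA] := frame_exists hphi hg Ux.
pose X : octo R := (0, delta_mx ord0 b); pose Y : octo R := (0, delta_mx ord0 a).
set W := (Riem c x [tuple i; j])^T.
(* An associator with an imaginary last factor has no real part. *)
have R0 : (mul x (mul x X Y) (tors_curv i j x) - mul x X (mul x Y (tors_curv i j x))).1 = 0.
  by rewrite (tors_curv_im i j Ux) (omul_assoc fA).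
have H : 0 - (mul x (0, delta_mx ord0 b *m W) (0, delta_mx ord0 a)).1
  - (mul x (0, delta_mx ord0 b) (0, delta_mx ord0 a *m W)).1 = 0.
  exact: (etrans (congr1 fst (curvature_defect i j X Y Ux)) R0).
have E u v : (mul x (0, u) (0, v)).1 = - inner g c x u v.
  by rewrite omul1E mul0r sub0r.
move: H; rewrite !E !opprK add0r => /eqP; rewrite addrC addr_eq0 => /eqP.
have rowE' e : delta_mx ord0 e *m W = \row_m Riem c x [tuple i; j] m e.
  by apply/rowP => m; rewrite -rowE !mxE.
have inE e (u : 'rV[R]_7) : inner g c x (delta_mx ord0 e) u =
    \sum_(m < 7) g c x [tuple e; m] * u ord0 m.
  rewrite /inner (bigD1 e) //= [X in _ + X]big1 => [|k ke]; last first.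
    by rewrite big1 // => l _; rewrite mxE (negbTE ke) andbF mulr0 mul0r.
  by rewrite addr0; apply: eq_bigr => m _; rewrite mxE (eqxx e) /= mulr1.
have inC u v : inner g c x u v = inner g c x v u.
  by case: hg => -[_ gs _] _ _; exact: gs.
rewrite !rowE' [in RHS]inC !inE /riem_low => H.
transitivity (\sum_(m < 7) g c x [tuple a; m] * (\row_m Riem c x [tuple i; j] m b) ord0 m).
  by apply: eq_bigr => m _; rewrite mxE.
rewrite -[LHS]opprK -H; congr (- _); by apply: eq_bigr => m _; rewrite mxE.
Qed.

End Curvature.

(** * Symmetries of the curvature and its projection pi_7 *)

Section PiSeven.
Variables (R : realType) (M : manifold7 R).
Variables (phi : tensor M R^o 3) (g : tensor M R^o 2) (vol : tensor M R^o 7).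
Variables (T : tensor M R^o 2) (Riem : tensor M 'M[R]_7 2).
Hypotheses (hphi : G2_structure phi) (hg : G2_metric phi g vol)
  (hT : is_torsion phi g vol T) (hRiem : is_riemann g Riem).
Variable c : atlas M.
Implicit Types (x y : 'rV[R]_7) (i j k l m n : 'I_7).

Local Opaque christoffel.
Local Notation U := (img c).
Local Notation mul := (omul phi g c).
Local Notation tors := (tors g T c).
Local Notation ph i j k := ((phiZ i j k)%:~R : R).

(** Modulo the two antisymmetries, the combination [b1] - [b2] - [b3] + [b4] of four cyclic
    identities is twice the difference of the two sides. *)
Lemma pair_symmetry (r : 'I_7 -> 'I_7 -> 'I_7 -> 'I_7 -> R) :
  (forall i j k l, r i j k l = - r j i k l) ->
  (forall i j k l, r i j k l = - r i j l k) ->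
  (forall i j k l, r i j k l + r i k l j + r i l j k = 0) ->
  forall i j k l, r i j k l = r k l i j.
Proof.
move=> a1 a2 bi i j k l.
have b1 := bi i j k l; have b2 := bi j k l i.
have b3 := bi k l i j; have b4 := bi l i j k.
have e1 := a1 j i k l; have e3 := a1 l i j k.
have e5 := a1 l k i j; have e6 := a1 j k l i.
have e2 : r k i j l = r i k l j by rewrite a1 a2 opprK.
have e4 : r l j k i = r j l i k by rewrite a1 a2 opprK.
lra.
Qed.

Lemma riem_low_pair i j k l x : U x ->
  riem_low g Riem c x i j k l = riem_low g Riem c x k l i j.
Proof.
move=> Ux; move: i j k l.
apply: pair_symmetry => [i j k l|i j k l|i j k l].
- exact: (riem_low_anti hphi hg hT hRiem).
- rewrite /riem_low -sumrN; apply: eq_bigr => m _; rewrite -mulrN; congr (_ * _).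
  rewrite !(Riem_curv hg hRiem) // /curv !sumrB.
  by rewrite !opprD !opprK [- _ + partial _ _ _]addrC [- _ + \sum_(_ < _) _]addrC.
rewrite /riem_low -!big_split big1 // => m _ /=.
rewrite -!mulrDr !(Riem_curv hg hRiem) //.
rewrite (_ : _ + _ + _ = 0) ?mulr0 //.
exact: (curv_bianchi hg _ _ _ _ Ux).
Qed.

Lemma frame_phi3 A x (l b d : 'I_7) : frame phi g vol c x A ->
  phi c x [tuple l; b; d] =
  \sum_(m < 7) \sum_(k < 7) \sum_(q < 7) A l m * (A b k * A d q) * ph m k q.
Proof.
case=> _ -> _ _; rewrite /pullback sum_mindex3.
apply: eq_bigr => m _; apply: eq_bigr => k _; apply: eq_bigr => q _.
by rewrite phi0E !big_ord_recl big_ord0 mulr1.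
Qed.

(** [W] is the curvature endomorphism acting on frame components. The result has the shape in which
    [cross0_defect] delivers F. *)
Lemma pi7_frame A i j x : U x -> frame phi g vol c x A ->
  let W := invmx A *m (Riem c x [tuple i; j])^T *m A in
  (pi7_riem phi g Riem c x [tuple i; j]).2 *m A =
  \row_m \sum_(k < 7) \sum_(l < 7) W l k * ph m k l.
Proof.
move=> Ux fA W; have [Au _ _ _] := fA.
pose E := Riem c x [tuple i; j]; pose V := E *m (ginv g c x)^T.
(* Here pair symmetry trades the contracted form indices for endomorphism indices; one inverse
   metric then cancels the metric hidden in [riem_low]. *)
have VE b d : \sum_(k < 7) \sum_(l < 7) ginv g c x b k * ginv g c x d l
    * riem_low g Riem c x i j k l = V b d.
  rewrite exchange_big mxE; apply: eq_bigr => l _ /=; rewrite [_^T _ _]mxE.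
  transitivity (ginv g c x d l * \sum_(m < 7)
     (\sum_(k < 7) ginv g c x b k * g c x [tuple k; m]) * E m l).
    rewrite mulr_sumr; under [RHS]eq_bigr do rewrite mulr_suml mulr_sumr.
    rewrite exchange_big; apply: eq_bigr => k _ /=.
    rewrite riem_low_pair // /riem_low mulr_sumr; apply: eq_bigr => m _.
    by rewrite /E; ring.
  rewrite mulrC; congr (_ * _); rewrite -[RHS](sum_delta (fun m => E m l) b).
  by apply: eq_bigr => m _; rewrite (ginv_metric hphi hg).
have -> : (pi7_riem phi g Riem c x [tuple i; j]).2 =
    raise g c x (fun f => \sum_(b < 7) \sum_(d < 7) V b d * phi c x [tuple f; b; d]).
  apply/rowP => a; rewrite !mxE.
  under [RHS]eq_bigr do rewrite mulr_sumr.
  rewrite [RHS]exchange_big; apply: eq_bigr => b _ /=.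
  under [RHS]eq_bigr do rewrite mulr_sumr.
  rewrite [RHS]exchange_big; apply: eq_bigr => d _ /=.
  rewrite [X in X * _](VE b d) mulr_sumr; apply: eq_bigr => f _; exact: mulrCA.
apply: (frame_raise fA) => l.
have WE k q : W q k = \sum_(b < 7) \sum_(d < 7) V b d * (A b k * A d q).
  have -> : W = (A^T *m V *m A)^T.
    rewrite /V !trmx_mul !trmxK (frame_ginv fA) !mulmxA -trmx_mul mulVmx //.
    by rewrite trmx1 mul1mx.
  rewrite mxE mxE exchange_big; apply: eq_bigr => d _ /=.
  rewrite mxE mulr_suml; apply: eq_bigr => b _; rewrite mxE; ring.
under eq_bigr do under eq_bigr do rewrite (frame_phi3 _ _ _ fA) mulr_sumr.
under eq_bigr do rewrite exchange_big /=.
rewrite exchange_big; apply: eq_bigr => m _ /=.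
rewrite mxE mulr_suml.
under eq_bigr do under eq_bigr do rewrite mulr_sumr.
under eq_bigr do rewrite exchange_big /=.
rewrite exchange_big; apply: eq_bigr => k _ /=.
under eq_bigr do under eq_bigr do rewrite mulr_sumr.
under eq_bigr do rewrite exchange_big /=.
rewrite exchange_big mulr_suml; apply: eq_bigr => q _ /=.
rewrite WE !mulr_suml; apply: eq_bigr => b _ /=.
by rewrite !mulr_suml; apply: eq_bigr => d _; ring.
Qed.

Theorem tors_curv_pi7 i j x : U x ->
  tors_curv phi g T c i j x = 4^-1 *: pi7_riem phi g Riem c x [tuple i; j].
Proof.
move=> Ux; have [A fA] := frame_exists hphi hg Ux; have [Au _ _ _] := fA.
pose W := invmx A *m (Riem c x [tuple i; j])^T *m A.
pose F := tors_curv phi g T c i j x; pose f := F.2.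
have FE : F = (0, f) by exact: (tors_curv_im T hg i j Ux).
have mulA X Y : (mul x X Y).2 *m A = (omul0 (push A X) (push A Y)).2.
  by rewrite -(frame_omul fA).
have omul00 (u v : 'rV[R]_7) : (omul0 (0, u) (0, v)).2 = cross0 u v.
  by rewrite /omul0 /= !scale0r !add0r.
(* Imaginary part of [curvature_defect], taken at the vectors with frame components [u] and [v] and
   pushed to the frame. *)
have D u v : cross0 u v *m W - cross0 (u *m W) v - cross0 u (v *m W) =
    2 *: quad0 (f *m A) u v.
  pose X : octo R := (0, u *m invmx A); pose Y : octo R := (0, v *m invmx A).
  have pX : push A X = (0, u) by rewrite /push /= mulmxKV.
  have pY : push A Y = (0, v) by rewrite /push /= mulmxKV.
  have := congr1 (push A) (curvature_defect hphi hg hT hRiem i j X Y Ux).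
  rewrite /= -/F FE !pushB.
  rewrite !(frame_omul fA) [push A (0, f)]/push pX pY omul0_assoc.
  move=> /(congr1 snd) /= H.
  rewrite -[RHS]H; congr (_ - _ - _).
  - by rewrite -omul00 -{1}pX -{1}pY -mulA /W !mulmxA mulmxK.
  - by rewrite -omul00 /push /= /W !mulmxA.
  - by rewrite -omul00 /push /= /W !mulmxA.
have fE := cross0_defect D.
rewrite -/F FE [RHS]surjective_pairing; congr (_, _); first by rewrite /= scaler0.
apply: (can_inj (mulmxK Au)); apply/rowP => m.
by rewrite fE -scalemxAl (pi7_frame i j Ux fA) !mxE.
Qed.

End PiSeven.

(** * The exterior derivative twisted by the torsion *)

Section TwistedDerivative.
Variables (R : realType) (M : manifold7 R).
Variables (phi : tensor M R^o 3) (g : tensor M R^o 2) (vol : tensor M R^o 7).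
Variables (T : tensor M R^o 2) (Riem : tensor M 'M[R]_7 2).
Hypotheses (hphi : G2_structure phi) (hg : G2_metric phi g vol)
  (hT : is_torsion phi g vol T) (hRiem : is_riemann g Riem).
Variable c : atlas M.
Implicit Types (x y : 'rV[R]_7) (i j k l m : 'I_7).

Local Opaque christoffel.
Local Notation U := (img c).
Local Notation mul := (omul phi g c).
Local Notation tors := (tors g T c).
Local Notation onabla := (@onabla R M g c).
Local Notation D_op := (@D_op R M phi g T c).
Local Notation odiff := (@odiff R M c).
Local Notation odiff2 := (@odiff2 R M c).

Lemma fst_sum (I : Type) (r : seq I) (F : I -> octo R) :
  (\sum_(a <- r) F a).1 = \sum_(a <- r) (F a).1.
Proof. by elim: r => [|a r IH]; rewrite ?big_nil ?big_cons -?IH. Qed.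

Lemma snd_sum (I : Type) (r : seq I) (F : I -> octo R) :
  (\sum_(a <- r) F a).2 = \sum_(a <- r) (F a).2.
Proof. by elim: r => [|a r IH]; rewrite ?big_nil ?big_cons -?IH. Qed.

Lemma nabla_octoE p (Q : tensor M (octo R) p) x (b : mindex p.+1) :
  nabla_octo g Q c x b = onabla (thead b) (fun y => Q c y (tail_idx b)) x
  - \sum_(k < p) \sum_(e < 7) christoffel g c x e (thead b) (tnth (tail_idx b) k)
      *: Q c x (subst_idx (tail_idx b) k e).
Proof.
rewrite [LHS]surjective_pairing [RHS]surjective_pairing; congr (_, _).
  rewrite -[RHS]/((onabla (thead b) (fun y => Q c y (tail_idx b)) x).1
    - (\sum_(k < p) \sum_(e < 7) christoffel g c x e (thead b) (tnth (tail_idx b) k)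
      *: Q c x (subst_idx (tail_idx b) k e)).1) fst_sum.
  by congr (_ - _); apply: eq_bigr => k _; rewrite fst_sum.
rewrite -[RHS]/((onabla (thead b) (fun y => Q c y (tail_idx b)) x).2
    - (\sum_(k < p) \sum_(e < 7) christoffel g c x e (thead b) (tnth (tail_idx b) k)
      *: Q c x (subst_idx (tail_idx b) k e)).2) snd_sum.
apply/rowP => m; rewrite [RHS]mxE [LHS]mxE [X in _ = X + _]mxE [X in _ = _ + X]mxE.
rewrite summxE /nabla addrAC; congr (_ + _ - _); apply: eq_bigr => k _.
rewrite snd_sum summxE; apply: eq_bigr => e _.
by rewrite -[(_ *: Q _ _ _).2]/(_ *: (Q _ _ _).2) mxE.
Qed.

(* The Christoffel term on a form index is symmetric under the exchange of that
   index with the index of differentiation. *)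
Lemma antisym_nabla_octo p (Q : tensor M (octo R) p) x (b : mindex p.+1) : U x ->
  antisym (nabla_octo g Q c x) b =
  antisym (fun b' => onabla (thead b') (fun y => Q c y (tail_idx b')) x) b.
Proof.
move=> Ux; rewrite (eq_antisym _ (nabla_octoE Q x)) antisymB antisym_sum.
rewrite [X in _ - X]big1 ?subr0 // => k _.
apply: (@antisym_sym _ _ _ _ (tperm ord0 (lift ord0 k))).
  by rewrite odd_tperm.
move=> b'; apply: eq_bigr => e _.
set b'' := perm_idx _ b'.
have h0 : thead b'' = tnth (tail_idx b') k.
  by rewrite /thead tnth_mktuple tpermL tnth_tail.
have hk : tnth (tail_idx b'') k = thead b'.
  by rewrite tnth_tail tnth_mktuple tpermR.
have hs : subst_idx (tail_idx b'') k e = subst_idx (tail_idx b') k e.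
  apply: eq_from_tnth => l; rewrite !tnth_mktuple; case: eqP => // /eqP lk.
  rewrite !tnth_tail tnth_mktuple tpermD //.
  by rewrite (inj_eq lift_inj) eq_sym.
by rewrite h0 hk hs (christoffel_sym hg _ _ _ Ux).
Qed.

Lemma fact_ratio p q :
  ((p + q)`!%:R / (p`!%:R * q`!%:R) : R) = 'C(p + q, p)%:R.
Proof.
rewrite -(@bin_fact (p + q) p) ?leq_addr // addKn !natrM mulfK //.
Qed.

(** The sign (-1)^p of the torsion term is undone by rotating the index of T to the front, and its
    wedge factor (p+1)! / (p! 1!) equals the factor p + 1 of [d_nabla]. *)
Lemma d_D_antisym p (Q : tensor M (octo R) p) x (b : mindex p.+1) : U x ->
  d_D phi g T Q c x b =
  p.+1%:R *: antisym (fun b' => D_op (thead b') (fun y => Q c y (tail_idx b')) x) b.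
Proof.
move=> Ux; rewrite /d_D /d_nabla antisym_nabla_octo // /cast_deg /owedge /wedge.
rewrite (antisym_rot1 (fun a d => mul x (Q c x a) (torsion_octo g T c x d))).
rewrite fact_ratio addn1 binSn antisymB scalerBr; congr (_ - _).
rewrite !scalerA.
have -> : (-1) ^+ p * p.+1%:R * (-1) ^+ p = p.+1%:R :> R.
  by rewrite mulrAC -expr2 sqrr_sign mul1r.
by [].
Qed.

Lemma odiff_sum (I : Type) (r : seq I) (F : I -> 'rV[R]_7 -> octo R) :
  (forall a, odiff (F a)) -> odiff (fun y => \sum_(a <- r) F a y).
Proof.
move=> dF; elim: r => [|a r IH].
  by have -> : (fun y => \sum_(a <- [::]) F a y) = (fun=> 0);
    [apply/funext => y; rewrite big_nil|exact: odiff2_odiff (odiff2c c 0)].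
have -> : (fun y => \sum_(a <- a :: r) F a y) = (fun y => F a y + \sum_(a <- r) F a y).
  by apply/funext => y; rewrite big_cons.
exact: odiffD.
Qed.

Lemma D_op_sum m (I : Type) (r : seq I) (F : I -> 'rV[R]_7 -> octo R) x : U x ->
  (forall a, odiff (F a)) ->
  D_op m (fun y => \sum_(a <- r) F a y) x = \sum_(a <- r) D_op m (F a) x.
Proof.
move=> Ux dF; elim: r => [|a r IH].
  have -> : (fun y => \sum_(a <- [::]) F a y) = (fun y => 0 *: (0 : octo R)).
    by apply/funext => y; rewrite big_nil scaler0.
  rewrite big_nil (@D_opZ _ _ _ _ _ _ _ _ (fun=> 0)) ?scale0r //.
  exact: odiff2_odiff (odiff2c c 0).
have -> : (fun y => \sum_(a <- a :: r) F a y) = (fun y => F a y + \sum_(a <- r) F a y).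
  by apply/funext => y; rewrite big_cons.
by rewrite D_opD // ?IH ?big_cons //; exact: odiff_sum.
Qed.

Lemma D_op_antisym m n (F : mindex n -> 'rV[R]_7 -> octo R) x b : U x ->
  (forall b', odiff (F b')) ->
  D_op m (fun y => antisym (F^~ y) b) x = antisym (fun b' => D_op m (F b') x) b.
Proof.
move=> Ux dF; rewrite /antisym D_opZ //; last first.
  by apply: odiff_sum => s; exact: odiffZ.
rewrite D_op_sum //; last by move=> s; exact: odiffZ.
by congr (_ *: _); apply: eq_bigr => s _; rewrite D_opZ.
Qed.

Lemma odiff_antisym n (F : mindex n -> 'rV[R]_7 -> octo R) b :
  (forall b', odiff (F b')) -> odiff (fun y => antisym (F^~ y) b).
Proof. by move=> dF; apply: odiffZ; apply: odiff_sum => s; exact: odiffZ. Qed.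

End TwistedDerivative.

(** * The square of the twisted derivative *)

Section Final.
Variables (R : realType) (M : manifold7 R).
Variables (phi : tensor M R^o 3) (g : tensor M R^o 2) (vol : tensor M R^o 7).
Variables (T : tensor M R^o 2) (Riem : tensor M 'M[R]_7 2).
Hypotheses (hphi : G2_structure phi) (hg : G2_metric phi g vol)
  (hT : is_torsion phi g vol T) (hRiem : is_riemann g Riem).
Variable c : atlas M.
Implicit Types (x y : 'rV[R]_7) (i j k l m : 'I_7).

Local Opaque christoffel.
Local Notation U := (img c).
Local Notation mul := (omul phi g c).
Local Notation tors := (tors g T c).
Local Notation D_op := (@D_op R M phi g T c).
Local Notation odiff := (@odiff R M c).
Local Notation odiff2 := (@odiff2 R M c).

Lemma perm2P (s : 'S_2) : s = 1%g \/ s = tperm ord0 ord_max.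
Proof.
have two (k : 'I_2) : k = ord0 \/ k = ord_max.
  by case: k => [[|[|]]] // ?; [left|right]; exact: val_inj.
have inj : s ord_max <> s ord0 by move/perm_inj.
case: (two (s ord0)) => s0; [left|right]; apply/permP => k;
  case: (two k) => ->; rewrite ?perm1 ?tpermL ?tpermR //;
  by case: (two (s ord_max)) => // s1; case: inj; rewrite s0 s1.
Qed.

Lemma antisym2 (V : lmodType R) (F : mindex 2 -> V) (i j : 'I_7) :
  antisym F [tuple i; j] = 2^-1 *: (F [tuple i; j] - F [tuple j; i]).
Proof.
rewrite /antisym -[2`!]/2%N; congr (_ *: _).
have t1 : tperm ord0 ord_max != 1%g :> 'S_2.
  by apply/eqP => /permP/(_ ord0); rewrite tpermL perm1.
rewrite (bigD1 1%g) //= (bigD1 (tperm ord0 ord_max)) //= big1 ?addr0; last first.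
  by move=> s /andP[s1 s2]; case: (perm2P s) => E; rewrite E eqxx in s1 s2.
rewrite odd_perm1 odd_tperm /= expr0 expr1 scale1r scaleN1r.
congr (F _ - F _); apply: eq_from_tnth => -[[|[|]] //= k]; rewrite tnth_mktuple.
- by rewrite perm1.
- by rewrite perm1.
- by rewrite (_ : Ordinal k = ord0) ?tpermL //; exact: val_inj.
- by rewrite (_ : Ordinal k = ord_max) ?tpermR //; exact: val_inj.
Qed.

Lemma mindex2_eta (d : mindex 2) : d = [tuple thead d; thead (tail_idx d)].
Proof.
case/tupleP: d => i d; case/tupleP: d => j d; rewrite (tuple0 d).
exact: val_inj.
Qed.

Lemma d_D_torsion x (i j : 'I_7) : U x ->
  d_D phi g T (torsion_octo g T) c x [tuple i; j] = tors_curv phi g T c i j x.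
Proof.
move=> Ux; rewrite (d_D_antisym T hg _ _ Ux) antisym2 scalerA mulfV ?pnatr_eq0 //.
by rewrite scale1r -tors_curvE.
Qed.

Lemma omulZr x (a : R) (X Z : octo R) : mul x Z (a *: X) = a *: mul x Z X.
Proof.
rewrite [LHS]surjective_pairing [RHS]surjective_pairing; congr (_, _).
  rewrite -[RHS]/(a * (mul x Z X).1) !omul1E /bil mulrBr; congr (_ - _).
    by rewrite mulrCA.
  rewrite mulr_sumr; apply: eq_bigr => i _; rewrite mulr_sumr.
  by apply: eq_bigr => j _; rewrite mxE; ring.
apply/rowP => k; rewrite -[RHS]/((a *: (mul x Z X).2) ord0 k).
rewrite [RHS]mxE !omul2E mulrDr; congr (_ + _).
  rewrite -[(a *: X).1]/(a * X.1) -[(a *: X).2]/(a *: X.2) [(a *: X.2) _ _]mxE.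
  by ring.
rewrite mulr_sumr; apply: eq_bigr => i _; rewrite mulr_sumr.
by apply: eq_bigr => j _; rewrite mxE; ring.
Qed.

Lemma oform_odiff2 p (P : tensor M (octo R) p) b : oform P ->
  odiff2 (fun y => P c y b).
Proof.
case=> -[[sre _] _] sim _ _; split=> [|k]; apply: smooth_diff2_on.
  exact: sre.
exact: sim.
Qed.

Lemma antisym_pair0 (n : nat) (h : mindex n -> 'rV[R]_7) b :
  antisym (fun b' => (0, h b') : octo R) b = (0, antisym h b).
Proof.
rewrite /antisym [LHS]surjective_pairing; congr (_, _).
  rewrite -[LHS]/(_ *: (\sum_(s : 'S_n) (-1) ^+ s *: ((0, h (perm_idx s b)) : octo R)).1).
  rewrite fst_sum big1 ?scaler0 // => s _; exact: scaler0.
rewrite -[LHS]/(_ *: (\sum_(s : 'S_n) (-1) ^+ s *: ((0, h (perm_idx s b)) : octo R)).2).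
by rewrite snd_sum.
Qed.

Lemma fact_ratio2 p :
  (p.+2%:R * p.+1%:R / 2 : R) = (p + 2)`!%:R / (p`!%:R * 2`!%:R).
Proof.
rewrite -[2`!]/2%N addn2 (factS p.+1) (factS p) !natrM; field.
by rewrite pnatr_eq0 -lt0n fact_gt0.
Qed.

(** The factors p + 2 and p + 1 come from the two derivatives, the 1/2 from passing to the
    commutator. *)
Lemma d_D_d_D p (P : tensor M (octo R) p) x (b : mindex p.+2) : U x -> oform P ->
  d_D phi g T (d_D phi g T P) c x b =
  (p.+2%:R * p.+1%:R / 2) *: antisym (fun b' : mindex p.+2 =>
     let i := thead b' in let j := thead (tail_idx b') in
     let X := P c x (tail_idx (tail_idx b')) in
     (0, X.2 *m (Riem c x [tuple i; j])^T) - mul x X (tors_curv phi g T c i j x)) b.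
Proof.
move=> Ux oP; have dP d := oform_odiff2 d oP.
pose F i (d : mindex p.+1) : octo R :=
  D_op i (D_op (thead d) (fun y => P c y (tail_idx d))) x.
have dDP (d : mindex p.+1) : odiff (D_op (thead d) (fun y => P c y (tail_idx d))).
  exact: (odiff_D_op hphi hg hT).
have E (b' : mindex p.+2) :
    D_op (thead b') (fun y => d_D phi g T P c y (tail_idx b')) x =
    p.+1%:R *: antisym (F (thead b')) (tail_idx b').
  rewrite (@D_op_eq _ _ _ _ _ _ (thead b') _ (fun y => p.+1%:R *: antisym (fun d =>
    D_op (thead d) (fun z => P c z (tail_idx d)) y) (tail_idx b')) x Ux); last first.
    by move=> y Uy; rewrite (d_D_antisym T hg).
  pose G (d : mindex p.+1) := D_op (thead d) (fun z => P c z (tail_idx d)).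
  rewrite D_opZ //; [|exact: (odiff_antisym (F := G) _ dDP)].
  congr (_ *: _); exact: (D_op_antisym phi g T (thead b') (F := G) _ Ux dDP).
rewrite (d_D_antisym T hg _ _ Ux) (eq_antisym _ E) antisymZ antisym_tail.
(* The transposition of the two derivative indices; it leaves the indices of [P] alone. *)
rewrite (antisym_half _ _ (t := tperm ord0 (lift ord0 ord0))); last by rewrite odd_tperm.
rewrite !scalerA; congr (_ *: _); apply: eq_bigr => s _; congr (_ *: _).
move: (perm_idx s b) => b' /=.
set b'' := perm_idx _ b'.
have h0 : thead b'' = thead (tail_idx b').
  by rewrite /thead tnth_mktuple tpermL tnth_tail.
have h1 : thead (tail_idx b'') = thead b'.
  by rewrite {1}/thead tnth_tail tnth_mktuple tpermR.
have h2 : tail_idx (tail_idx b'') = tail_idx (tail_idx b').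
  by apply: eq_from_tnth => k; rewrite !tnth_tail tnth_mktuple tpermD.
by rewrite /F h0 h1 h2 (D_op_comm hphi hg hT hRiem).
Qed.

Lemma twisted_square p (P : tensor M (octo R) p) x (b : mindex p.+2) : U x -> oform P ->
  d_D phi g T (d_D phi g T P) c x b =
  riem_wedge Riem (Im_part P) c x b
  - cast_deg (addn2 p) (owedge phi g P (d_D phi g T (torsion_octo g T))) c x b.
Proof.
move=> Ux oP; rewrite d_D_d_D // antisymB scalerBr; congr (_ - _).
  rewrite antisym_pair0 /riem_wedge /wedge fact_ratio2.
  rewrite [LHS]surjective_pairing; congr (_, _); first exact: scaler0.
  apply: (congr2 *:%R); first by rewrite addnC [_%:R * p`!%:R]mulrC.
  apply: eq_antisym => b'.
  (* In [riem_wedge] the curvature occupies the first two slots, so its indices are already the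
     derivative indices, and [2 + p] converts to [p.+2] without a cast. *)
  have -> : left_idx (b' : mindex (2 + p)) = [tuple thead b'; thead (tail_idx b')].
    apply: eq_from_tnth => -[[|[|]] //= k]; rewrite tnth_mktuple /thead ?tnth_tail.
      by congr tnth; exact: val_inj.
    by congr tnth; exact: val_inj.
  have -> : right_idx (b' : mindex (2 + p)) = tail_idx (tail_idx b').
    apply: eq_from_tnth => k; rewrite tnth_mktuple !tnth_tail.
    by congr tnth; exact: val_inj.
  by [].
rewrite /cast_deg /owedge /wedge.
(* The octonion factor F stands on the right, so its two indices come last and have to be rotated to
   the front. *)
rewrite (antisym_rot2 (fun a d => mul x (P c x a) (d_D phi g T (torsion_octo g T) c x d))).
rewrite -fact_ratio2; apply: (congr2 *:%R) => //; apply: eq_antisym => b'.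
by rewrite d_D_torsion.
Qed.

Lemma owedge_pi7 p (P : tensor M (octo R) p) x (b : mindex p.+2) : U x ->
  cast_deg (addn2 p) (owedge phi g P (d_D phi g T (torsion_octo g T))) c x b =
  4^-1 *: cast_deg (addn2 p) (owedge phi g P (pi7_riem phi g Riem)) c x b.
Proof.
move=> Ux; rewrite /cast_deg /owedge /wedge; set k := _ / _.
rewrite [RHS]scalerA [4^-1 * k]mulrC -[RHS]scalerA; apply: (congr2 *:%R) => //.
rewrite -antisymZ; apply: eq_antisym => b'; rewrite -omulZr; congr omul.
set d := right_idx b'; rewrite (mindex2_eta d) d_D_torsion //.
exact: (tors_curv_pi7 hphi hg hT hRiem).
Qed.

End Final.

Theorem proposition6p8 (R : realType) (M : manifold7 R)
    (phi : tensor M R^o 3) (g : tensor M R^o 2) (vol : tensor M R^o 7)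
    (T : tensor M R^o 2) (Riem : tensor M 'M[R]_7 2)
    (hphi : G2_structure phi) (hg : G2_metric phi g vol)
    (hT : is_torsion phi g vol T) (hRiem : is_riemann g Riem)
    (p : nat) (P : tensor M (octo R) p) (hP : oform P) :
  forall (c : atlas M) (x : 'rV[R]_7), img c x -> forall b : mindex p.+2,
    d_D phi g T (d_D phi g T P) c x b =
      riem_wedge Riem (Im_part P) c x b
      - cast_deg (addn2 p)
          (owedge phi g P (d_D phi g T (torsion_octo g T))) c x b
    /\
    riem_wedge Riem (Im_part P) c x b
      - cast_deg (addn2 p)
          (owedge phi g P (d_D phi g T (torsion_octo g T))) c x b =
    riem_wedge Riem (Im_part P) c x b
      - 4^-1 *: cast_deg (addn2 p)
          (owedge phi g P (pi7_riem phi g Riem)) c x b.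
Proof.
move=> c x Ux b; split; first exact: (twisted_square hphi hg hT hRiem).
by rewrite (owedge_pi7 hphi hg hT hRiem).
Qed.
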